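(* Let $X$ be a real separable Hilbert space and let $\{U(t,s)\}_{s\le t}$, $\{B(t)\}_{t\in\mathbb R}$ satisfy assumptions (A1)--(A4) of the context, with $P_{s,t}$, $\gamma_t$, $\mathcal H_t$ and $\Gamma_{\nu,\mu}$ as defined there. For every $s\le t$ and every bounded Borel function $f:X\to\mathbb R$, $$P_{s,t}f=\Gamma_{\gamma_s,\gamma_t}(L)f,$$ i.e. $(P_{s,t}f)(x)=(\Gamma_{\gamma_s,\gamma_t}(L)f)(x)$ for every $x\in X$, where $L:=(U(t,s)_{|\mathcal H_s})^\star$, the Hilbert space adjoint of $U(t,s)_{|\mathcal H_s}:\mathcal H_s\to\mathcal H_t$, belongs to $\mathscr L(\mathcal H_t,\mathcal H_s)$. As a consequence, for every $p\in[1,\infty)$ and $s<t$, the extension of $P_{s,t}$ to an operator from $L^p(X,\gamma_t)$ into $L^p(X,\gamma_s)$ coincides with the extension of $\Gamma_{\gamma_s,\gamma_t}(L)$ to an operator from $L^p(X,\gamma_t)$ into $L^p(X,\gamma_s)$.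
   Context: Assumptions. (A1) $\{U(t,s)\}_{s\le t}\subseteq\mathscr L(X)$ is a strongly continuous evolution operator: $(s,t)\mapsto U(t,s)x$ is continuous for every $x\in X$, $U(t,t)=I$ and $U(t,r)U(r,s)=U(t,s)$ for $s\le r\le t$. (A2) $\{B(t)\}_{t\in\mathbb R}\subseteq\mathscr L(X)$, $\sup_{t}\|B(t)\|_{\mathscr L(X)}<\infty$, and $t\mapsto B(t)x$ is bounded and measurable for every $x\in X$. (A3) With $Q(r):=B(r)B(r)^\star$, for every $s<t$ the operator $Q(t,s)=\int_s^tU(t,r)Q(r)U(t,r)^\star\,dr$ has finite trace. (A4) For every $t\in\mathbb R$, $\sup_{s<t}\mathrm{Tr}[Q(t,s)]<\infty$, and $\lim_{s\to-\infty}U(t,s)x=0$ for every $x\in X$. $P_{t,t}=I$ and, for $s<t$ and $\varphi$ bounded Borel, $P_{s,t}\varphi(x)=\int_X\varphi(y)\,\mathcal N_{U(t,s)x,Q(t,s)}(dy)$, where $\mathcal N_{a,Q}=\mathcal N(a,Q)$ is the Gaussian measure with mean $a$ and covariance $Q$. Put $Q(t,-\infty)=\int_{-\infty}^tU(t,r)Q(r)U(t,r)^\star\,dr$ and $\gamma_t=\mathcal N_{0,Q(t,-\infty)}$. One has $\int_XP_{s,t}\varphi\,d\gamma_s=\int_X\varphi\,d\gamma_t$, and for every $p\in[1,\infty)$ and $s<t$ the operator $P_{s,t}$ extends to a bounded operator $L^p(X,\gamma_t)\to L^p(X,\gamma_s)$ with norm $1$, still denoted $P_{s,t}$. For a centered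 Gaussian measure $\gamma=\mathcal N(0,Q_\gamma)$ on $X$, its Cameron–Martin space is $H_\gamma=Q_\gamma^{1/2}(X)$ with inner product $\langle h,k\rangle_{H_\gamma}=\langle Q_\gamma^{-1/2}h,Q_\gamma^{-1/2}k\rangle_X$, $Q_\gamma^{-1/2}$ being the pseudo-inverse of $Q_\gamma^{1/2}$ ($Q_\gamma^{-1/2}h$ is the unique $z\in(\ker Q_\gamma^{1/2})^\perp$ with $Q_\gamma^{1/2}z=h$). $\mathcal H_t$ denotes the Cameron–Martin space of $\gamma_t$. Under the assumptions $U(t,s)$ maps $\mathcal H_s$ into $\mathcal H_t$ with norm at most $1$. Let $\mu=\mathcal N(0,Q_\mu)$, $\nu=\mathcal N(0,Q_\nu)$. For $T\in\mathscr L(H_\mu,H_\nu)$ let $(f_k)$ be an orthonormal basis of $(\ker Q_\mu)^\perp$ of eigenvectors of $Q_\mu$, and let $\pi_m$ be the orthogonal projection of $X$ onto $\mathrm{span}\{f_1,\dots,f_m\}\subseteq H_\mu$; $T_\infty^{\nu,\mu}$ is the limit (it exists) of $T\pi_m$ in $L^2(X,\mu;X)$. It has a version that is linear on $X$ and measurable with respect to the $\mu$-completion of the Borel $\sigma$-algebra, and such a linear version is always fixed. Moreover, if $T$ extends to a bounded linear operator from $\overline{H_\mu}$ into $\overline{H_\nu}$ (closures in $X$), the version considered is the bounded operator on $X$ equal to this extension on $\overline{H_\mu}$ and to $0$ on $\overline{H_\mu}^\perp$; also, any operator in $\mathscr L(X)$ whose restriction to $H_\mu$ is $T$ is a version of $T_\infty^{\nu,\mu}$.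 Write $T_\infty^\mu:=T_\infty^{\mu,\mu}$ when $\nu=\mu$. For $\|T\|_{\mathscr L(H_\mu,H_\nu)}\le1$ and $f:X\to\mathbb R$ measurable with $|f(x)|\le Me^{c\|x\|_X}$ for some $M,c>0$, $$(\Gamma_{\nu,\mu}(T)f)(x)=\int_Xf\big[(T^\star)_\infty^{\mu,\nu}x+((I-T^\star T)^{1/2})_\infty^\mu y\big]\mu(dy),\qquad x\in X,$$ with $T^\star\in\mathscr L(H_\nu,H_\mu)$ the adjoint of $T$. For each $p\in[1,\infty)$, $\Gamma_{\nu,\mu}(T)$ extends by density to a bounded operator $L^p(X,\mu)\to L^p(X,\nu)$, denoted in the same way.
   Formalization: Equality at every x is proved taking U(t,s) as the version of (L* )_∞; with the version vanishing on the orthogonal of H_s it fails if B=0, and is proved for x in the closure of H_s (any bounded version) and γ_s-a.e. (any linear version). *)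

(* Defs.v *)
From HB Require Import structures.
From mathcomp Require Import all_boot all_order all_algebra.
From mathcomp Require Import all_classical all_reals all_analysis.
From mathcomp Require Import measurable_realfun.

Set Implicit Arguments.
Unset Strict Implicit.
Unset Printing Implicit Defensive.

Import Order.TTheory GRing.Theory Num.Theory.
Import numFieldNormedType.Exports.

Local Open Scope classical_set_scope.
Local Open Scope ring_scope.

HB.mixin Record isHilbert (R : realType) X & CompleteNormedModule R X := {
  inner : X -> X -> R ;
  innerC : forall x y, inner x y = inner y x ;
  inner_linear : forall z a x y,
    inner (a *: x + y) z = a * inner x z + inner y z ;
  inner_norm : forall x, inner x x = `|x| ^+ 2
}.

#[short(type="hilbertType")]
HB.structure Definition Hilbert (R : realType) :=
  {X of CompleteNormedModule R X & isHilbert R X}.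

Definition separable (T : topologicalType) : Prop :=
  exists2 A : set T, countable A & dense A.

(* [X] with its Borel sigma-algebra. *)
Definition borel (R : realType) (X : hilbertType R) : Type :=
  g_sigma_algebraType (@open X).
HB.instance Definition _ (R : realType) (X : hilbertType R) :=
  Measurable.on (borel X).

Section Operators.
Context (R : realType) (X : hilbertType R).
Implicit Types (A Q T S : X -> X) (e : nat -> X).

Definition bounded_operator A : Prop := linear A /\ continuous A.

Definition orthogonal_compl (V : set X) : set X :=
  [set x | forall v, V v -> inner x v = 0].

Definition kernel A : set X := [set x | A x = 0].

(* The projection onto span {e_0, ..., e_{m-1}}, for orthonormal [e]. *)
Definition proj e (m : nat) (x : X) : X := \sum_(i < m) inner x (e i) *: e i.

(* An orthonormal basis of the closed subspace [V], indexed by [nat]: vectors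
   [e i] equal to 0 are allowed as padding, so that finite bases are covered. *)
Definition orthonormal_basis (V : set X) e : Prop :=
  [/\ forall i j, i != j -> inner (e i) (e j) = 0,
      forall i, e i = 0 \/ `|e i| = 1,
      forall i, V (e i)
    & forall x, V x -> proj e m x @[m --> \oo] --> x].

(* The trace of a nonnegative operator, which does not depend on the basis. *)
Definition trace A : \bar R :=
  let e := xget (fun=> 0) (orthonormal_basis setT) in
  (\sum_(0 <= k <oo) (inner (A (e k)) (e k))%:E)%E.

(* An orthonormal basis of (ker Q)^\perp made of eigenvectors of [Q]. *)
Definition eigenbasis Q e : Prop :=
  orthonormal_basis (orthogonal_compl (kernel Q)) e /\
  forall i, exists lambda : R, Q (e i) = lambda *: e i.

(* A linear subspace of [X] carrying its own inner product. An operator between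
   two such spaces is represented by a function [X -> X], of which only the
   values on the domain matter. *)
Record ipspace := IPSpace { carrier : set X ; ip : X -> X -> R }.
Implicit Types H K : ipspace.

Definition whole : ipspace := IPSpace setT (@inner R X).

Definition ipnorm H (h : X) : R := Num.sqrt (ip H h h).

(* [T] belongs to L(H, K) and has norm at most [C]. *)
Definition operator_le (C : R) H K T : Prop :=
  [/\ forall h, carrier H h -> carrier K (T h),
      forall a h h', carrier H h -> carrier H h' ->
        T (a *: h + h') = a *: T h + T h'
    & forall h, carrier H h -> ipnorm K (T h) <= C * ipnorm H h].

Definition operator H K T : Prop := exists C, operator_le C H K T.

Definition is_adjoint H K T S : Prop :=
  (forall k, carrier K k -> carrier H (S k)) /\
  forall h k, carrier H h -> carrier K k -> ip K (T h) k = ip H h (S k).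

(* The adjoint in L(K, H) of [T] in L(H, K), pointwise by Riesz. *)
Definition adjoint H K T : X -> X := fun k =>
  xget 0 [set g | carrier H g /\
                  forall h, carrier H h -> ip K (T h) k = ip H h g].

Definition nonneg_operator H A : Prop :=
  [/\ operator H H A,
      forall h k, carrier H h -> carrier H k -> ip H (A h) k = ip H h (A k)
    & forall h, carrier H h -> 0 <= ip H (A h) h].

(* The nonnegative square root (unique on [H]) of the nonnegative [A]. *)
Definition sqrt_operator H A : X -> X :=
  xget (fun=> 0) [set S | nonneg_operator H S /\
                          forall h, carrier H h -> S (S h) = A h].

(* Pseudo-inverse: [pinv A h] is the z in (ker A)^\perp with A z = h. *)
Definition pinv A (h : X) : X :=
  xget 0 [set z | orthogonal_compl (kernel A) z /\ A z = h].

Definition cameron_martin Q : ipspace :=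
  let rQ := sqrt_operator whole Q in
  IPSpace (range rQ) (fun h k => inner (pinv rQ h) (pinv rQ k)).

Definition covariance_operator Q : Prop :=
  nonneg_operator whole Q /\ (trace Q < +oo)%E.

(* Real and imaginary parts of the characteristic function
   exp (i <a, h> - <Q h, h> / 2). *)
Definition is_gaussian (mu : probability (borel X) R) (a : X) Q : Prop :=
  forall h : X,
    \int[mu]_x cos (inner x h) =
      cos (inner a h) * expR (- (inner (Q h) h / 2)) /\
    \int[mu]_x sin (inner x h) =
      sin (inner a h) * expR (- (inner (Q h) h / 2)).

(* [N a Q] is the Gaussian measure with mean [a] and covariance [Q]. *)
Definition gaussian_family (N : X -> (X -> X) -> probability (borel X) R) :=
  forall a Q, covariance_operator Q -> is_gaussian (N a Q) a Q.

(* [linear_version mu e T S]: [S] is a linear version of [T_oo^{nu,mu}], where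
  [T] is in L(H_mu, H_nu) and [e] is an eigenbasis of the covariance of [mu];
  i.e. [S] is linear, measurable for the mu-completion of the Borel
  sigma-algebra, and is the limit of [T \o proj e m] in L^2(X, mu; X).

  Integrals of functions that are only measurable for the mu-completion are
  written with [mu] itself: the integral of a nonnegative function is a
  supremum over measurable simple functions below it, which for such functions
  is the integral with respect to the completed measure. *)
Definition linear_version (mu : probability (borel X) R) e T S : Prop :=
  [/\ linear S,
      forall B : set (borel X), measurable B ->
        completed_algebra_gen mu (S @^-1` B)
    & (\int[mu]_x (`|T (proj e m x) - S x| ^+ 2)%:E)%E @[m --> \oo]
        --> (0 : \bar R)%E].

(* [Gamma mu V W] is Gamma_{nu,mu}(T) when [V] and [W] are the versions chosen
   for (T^\star)_oo^{mu,nu} and ((I - T^\star T)^{1/2})_oo^mu;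
   see [Gamma_versions]. *)
Definition Gamma (mu : probability (borel X) R) (V W : X -> X)
    (f : borel X -> R) : borel X -> R :=
  fun x => \int[mu]_y f (V x + W y).

(* (I - T^\star T)^{1/2} for a contraction [T] in L(H, K). *)
Definition defect H K T : X -> X :=
  sqrt_operator H (fun h => h - adjoint H K T (T h)).

(* [Hmu], [Hnu] are the Cameron-Martin spaces of [mu], [nu], and [emu], [enu]
   eigenbases of their covariances. *)
Definition Gamma_versions (mu nu : probability (borel X) R) (Hmu Hnu : ipspace)
    (emu enu : nat -> X) T (V W : X -> X) : Prop :=
  linear_version nu enu (adjoint Hmu Hnu T) V /\
  linear_version mu emu (defect Hmu Hnu T) W.

Definition bounded_borel : set (borel X -> R) :=
  [set f : borel X -> R | measurable_fun setT f /\
    exists M, forall x, `|f x| <= M].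

Definition exp_growth : set (borel X -> R) :=
  [set f : borel X -> R | measurable_fun setT f /\
    exists M c, [/\ 0 < M, 0 < c &
                    forall x : X, `|f x| <= M * expR (c * `|x|)]].

(* L^p classes are represented by functions, so an operator on L^p is a map
   between functions that is linear and compatible up to a.e. equality. *)
Definition Lp_operator (mu nu : probability (borel X) R) (p : \bar R)
    (p1 : (1 <= p)%E) (E : LfunType mu p1 -> LfunType nu p1) : Prop :=
  [/\ forall f g : LfunType mu p1, f = g %[ae mu] -> E f = E g %[ae nu],
      forall (a : R) (f g : LfunType mu p1),
        E (a *: f + g) = (fun x => a * E f x + E g x) %[ae nu]
    & exists2 C : R, 0 <= C & forall f : LfunType mu p1,
        ('N[nu]_p[EFin \o E f] <= C%:E * 'N[mu]_p[EFin \o f])%E].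

(* [E] is a bounded operator from L^p(mu) to L^p(nu) which agrees with [A] on
   the functions of [D]. *)
Definition Lp_extension (mu nu : probability (borel X) R) (p : \bar R)
    (p1 : (1 <= p)%E) (D : set (borel X -> R))
    (A : (borel X -> R) -> (borel X -> R))
    (E : LfunType mu p1 -> LfunType nu p1) : Prop :=
  Lp_operator E /\
  forall f : LfunType mu p1, D f -> E f = A f %[ae nu].

Implicit Types (U : R -> R -> X -> X) (B : R -> X -> X).

(* [U t s] is only constrained for [s <= t]. *)
Definition evolution_operator U : Prop :=
  [/\ forall s t, s <= t -> bounded_operator (U t s),
      forall x, {within [set st : R * R | st.1 <= st.2],
                 continuous (fun st => U st.2 st.1 x)},
      forall t x, U t t x = x
    & forall s r t x, s <= r -> r <= t -> U t r (U r s x) = U t s x].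

Definition bounded_measurable_family B : Prop :=
  [/\ forall t, bounded_operator (B t),
      exists M, forall t x, `|B t x| <= M * `|x|
    & forall x, [bounded B t x | t in setT] /\
                measurable_fun setT (fun t => B t x : borel X)].

(* The weak (Pettis) integral over [D] of the X-valued function [g]. *)
Definition vintegral (D : set R) (g : R -> X) : X :=
  xget 0 [set v | forall h,
    lebesgue_measure.-integrable D (fun r => (inner (g r) h)%:E) /\
    inner v h = \int[lebesgue_measure]_(r in D) inner (g r) h].

Definition noise_integral U B (t : R) (D : set R) : X -> X := fun x =>
  vintegral D (fun r =>
    U t r (B r (adjoint whole whole (B r) (adjoint whole whole (U t r) x)))).

Definition Qcov U B (t s : R) : X -> X := noise_integral U B t `[s, t].

Definition Qinf U B (t : R) : X -> X := noise_integral U B t `]-oo, t].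

Definition finite_trace U B : Prop :=
  forall s t, s < t -> (trace (Qcov U B t s) < +oo)%E.

Definition stable U B : Prop := forall t,
  (ereal_sup [set trace (Qcov U B t s) | s in `]-oo, t[] < +oo)%E /\
  forall x, U t s x @[s --> -oo] --> (0 : X).

Definition transition (N : X -> (X -> X) -> probability (borel X) R) U B
    (s t : R) (f : borel X -> R) : borel X -> R :=
  fun x => if s < t then \int[N (U t s x) (Qcov U B t s)]_y f y else f x.

End Operators.

Arguments whole {R X}.
Arguments bounded_borel {R X}.
Arguments exp_growth {R X}.
Arguments transition {R X} N U B s t f.
Arguments Lp_extension {R X} mu nu {p p1} D A E.

(* Main.v *)
(* Both sides are Mehler-type averages, and they agree because of the splitting
   [Q(t,-oo) = U(t,s) Q(s,-oo) U(t,s)^* + Q(t,s)]. It shows that U(t,s) is a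
   contraction from H_s to H_t (Douglas' lemma), and that, if y has law gamma_t
   and W is a version of the defect operator D of L, the variance of <W y, h> is
   <Q(t,-oo) h, h> - <Q(s,-oo) U^* h, U^* h> = <Q(t,s) h, h>, computed as the sum
   of the series of <Q e_i, e_i> <D e_i, h>^2 over the eigenbasis. Hence
   U(t,s) x + W y has the characteristic function of N(U(t,s) x, Q(t,s)), and,
   for x distributed along gamma_s independently of y, that of gamma_t.
   Uniqueness of characteristic functions turns the first fact into
   P f = Gamma(L) f and the second into the contractivity of the average on L^p,
   in which bounded functions are dense by truncation. *)

Require Import Defs.
From HB Require Import structures.
From mathcomp Require Import all_boot all_order all_algebra.
From mathcomp Require Import all_classical all_reals all_analysis.
From mathcomp Require Import measurable_realfun ring lra.

Set Implicit Arguments.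
Unset Strict Implicit.
Unset Printing Implicit Defensive.

Import Order.TTheory GRing.Theory Num.Theory.
Import numFieldNormedType.Exports.

Local Open Scope classical_set_scope.
Local Open Scope ring_scope.

(** Three obstacles shape the development. The defect operator is defined on H_t only. The
    pseudo-inverses of the covariance roots carry H_s and H_t isometrically onto subspaces of X,
    where U(t,s) becomes a contraction C of X with adjoint C'; the defect operator then corresponds
    to a root of I - C C', obtained as I - Y by iterating a quadratic equation, so that no spectral
    theorem enters beyond the given eigenbases. A version W is measurable only for the completed
    sigma-algebra. It is traded for a Borel map W', equal to W off a null set and the same for all
    x, so that image laws and Fubini make sense while the integral in y is unchanged. The summand V
    x, by contrast, is evaluated at the given x, whence the distinction between all x, the closure
    of H_s and almost all x. The case s = t is included, and there the law of U(t,s) x + W y is a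
    Dirac mass. Laws are therefore compared through the integrals of cos(<y, h> + theta), which
    treat Gaussian and Dirac measures alike. *)

Local Notation proj := Defs.proj.
Local Notation kernel := Defs.kernel.
Local Notation pinv := Defs.pinv.

(** * Hilbert spaces and orthonormal bases *)

Section InnerProduct.
Context (R : realType) (X : hilbertType R).
Implicit Types (x y z : X) (a : R).

Lemma innerDl z x y : inner (x + y) z = inner x z + inner y z.
Proof. by rewrite -[x in LHS]scale1r inner_linear mul1r. Qed.

Lemma inner0l z : inner (0 : X) z = 0.
Proof. by apply: (addrI (inner 0 z)); rewrite -innerDl !addr0. Qed.

Lemma innerZl z a x : inner (a *: x) z = a * inner x z.
Proof. by rewrite -[a *: x in LHS]addr0 inner_linear inner0l addr0. Qed.

Lemma innerNl z x : inner (- x) z = - inner x z.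
Proof. by rewrite -scaleN1r innerZl mulN1r. Qed.

Lemma innerBl z x y : inner (x - y) z = inner x z - inner y z.
Proof. by rewrite innerDl innerNl. Qed.

Lemma inner0r z : inner z (0 : X) = 0.
Proof. by rewrite innerC inner0l. Qed.

Lemma innerDr z x y : inner z (x + y) = inner z x + inner z y.
Proof. by rewrite innerC innerDl !(innerC z). Qed.

Lemma innerZr z a x : inner z (a *: x) = a * inner z x.
Proof. by rewrite innerC innerZl (innerC z). Qed.

Lemma innerNr z x : inner z (- x) = - inner z x.
Proof. by rewrite innerC innerNl (innerC z). Qed.

Lemma innerBr z x y : inner z (x - y) = inner z x - inner z y.
Proof. by rewrite innerDr innerNr. Qed.

Lemma inner_suml (I : Type) (r : seq I) (P : pred I) (F : I -> X) z :
  inner (\sum_(i <- r | P i) F i) z = \sum_(i <- r | P i) inner (F i) z.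
Proof.
by elim/big_rec2: _ => [|i ? ? _ <-]; rewrite ?inner0l ?innerDl.
Qed.

Lemma inner_ge0 x : 0 <= inner x x.
Proof. by rewrite inner_norm sqr_ge0. Qed.

Lemma inner_eq0 x : inner x x = 0 -> x = 0.
Proof. by rewrite inner_norm => /eqP; rewrite sqrf_eq0 normr_eq0 => /eqP. Qed.

Lemma inner_ext x y : (forall z, inner x z = inner y z) -> x = y.
Proof.
by move=> xy; apply/subr0_eq/inner_eq0; rewrite innerBl xy subrr.
Qed.

Lemma sqr_normD x y : `|x + y| ^+ 2 = `|x| ^+ 2 + 2 * inner x y + `|y| ^+ 2.
Proof. by rewrite -!inner_norm innerDl !innerDr (innerC y x); ring. Qed.

Lemma sqr_normB x y : `|x - y| ^+ 2 = `|x| ^+ 2 - 2 * inner x y + `|y| ^+ 2.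
Proof. by rewrite sqr_normD innerNr normrN; ring. Qed.

Lemma cauchy_schwarz x y : `|inner x y| <= `|x| * `|y|.
Proof.
have [->|y0] := eqVneq y 0; first by rewrite inner0r normr0 normr0 mulr0.
rewrite -(@ler_pXn2r _ 2) ?nnegrE ?mulr_ge0// exprMn real_normK ?num_real//.
have yy : 0 < `|y| ^+ 2 by rewrite exprn_gt0 ?normr_gt0.
have := sqr_ge0 (`| x - (inner x y / `|y| ^+ 2) *: y |).
rewrite sqr_normB innerZr normrZ exprMn real_normK ?num_real//.
rewrite (_ : _ + _ = `|x| ^+ 2 - inner x y ^+ 2 / `|y| ^+ 2); last first.
  by field; rewrite normr_eq0.
by rewrite subr_ge0 ler_pdivrMr.
Qed.

Lemma ler_inner x y : inner x y <= `|x| * `|y|.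
Proof. exact: le_trans (ler_norm _) (cauchy_schwarz _ _). Qed.

(** Norm bounds by duality: it suffices to bound the functional [inner x] at x itself. *)
Lemma norm_le_inner x (C : R) : 0 <= C -> inner x x <= C * `|x| -> `|x| <= C.
Proof.
move=> C0; have [->|x0] := eqVneq x 0; first by rewrite normr0.
by rewrite inner_norm expr2 ler_pM2r ?normr_gt0.
Qed.

Lemma continuous_innerl y : continuous (fun x => inner x y).
Proof.
move=> x; apply/cvgrPdist_le => e e0; near=> t.
rewrite -innerBl (le_trans (cauchy_schwarz _ _))//.
rewrite (@le_trans _ _ (`|x - t| * (`|y| + 1)))// ?ler_wpM2l ?lerDl//.
rewrite -ler_pdivlMr ?ltr_wpDl//; near: t.
by apply: cvgr_dist_le; [exact: cvg_id|rewrite divr_gt0 ?ltr_wpDl].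
Unshelve. all: by end_near. Qed.

Lemma cvg_innerl (T : Type) (F : set_system T) {FF : Filter F} (f : T -> X) x y :
  f @ F --> x -> inner (f t) y @[t --> F] --> inner x y.
Proof. exact: (@continuous_cvg _ _ _ _ _ _ (fun x => inner x y) x (@continuous_innerl y x)). Qed.

Lemma cvg_innerr (T : Type) (F : set_system T) {FF : Filter F} (f : T -> X) x y :
  f @ F --> x -> inner y (f t) @[t --> F] --> inner y x.
Proof.
move=> fx; rewrite innerC.
by under eq_fun do rewrite innerC; exact: cvg_innerl.
Qed.

End InnerProduct.

Section SubspaceClosure.
Context (R : realType) (X : hilbertType R).

Lemma orthogonal_compl_cvg (V : set X) (u : nat -> X) (x : X) :
  (forall n, orthogonal_compl V (u n)) -> u @ \oo --> x ->
  orthogonal_compl V x.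
Proof.
move=> uV ux v Vv.
have : inner (u n) v @[n --> \oo] --> inner x v by exact: cvg_innerl.
rewrite (_ : (fun t => _) = cst 0); last by apply/funext => n; rewrite uV.
by move=> /(cvg_lim (@Rhausdorff R)) <-; rewrite lim_cst.
Qed.

Lemma orthogonal_compl_linear (V : set X) a (x y : X) :
  orthogonal_compl V x -> orthogonal_compl V y -> orthogonal_compl V (a *: x + y).
Proof. by move=> Vx Vy v Vv; rewrite inner_linear Vx// Vy// mulr0 addr0. Qed.

Lemma orthogonal_compl_inter (V : set X) x :
  V x -> orthogonal_compl V x -> x = 0.
Proof. by move=> Vx /(_ x Vx)/inner_eq0. Qed.

End SubspaceClosure.

Section Cauchy.
Context (R : realType) (X : completeNormedModType R).

Lemma cvgn_dist_le (u : nat -> X) :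
  (forall e : R, 0 < e -> exists N, forall n, (N <= n)%N -> `|u n - u N| <= e) ->
  cvgn u.
Proof.
move=> uC; apply/cauchy_cvgP/cauchy_exP => e e0.
have [N uN] := uC (e / 2) (divr_gt0 e0 (ltr0Sn _ 1)).
exists (u N); exists N => // n /= Nn; rewrite -ball_normE/= distrC.
by rewrite (le_lt_trans (uN n Nn))//; lra.
Qed.

(** The exponent is 2 for orthogonal series, by Pythagoras, and 1 for the iteration that produces
    square roots. *)
Lemma cvgn_dominated (u : nat -> X) (r : nat -> R) (k : nat) :
  {homo r : m n / (m <= n)%N >-> m <= n} -> (exists C, forall n, r n <= C) ->
  (forall m n, (m <= n)%N -> `|u n - u m| ^+ k.+1 <= r n - r m) -> cvgn u.
Proof.
move=> r_mono [C rC] ur; apply: cvgn_dist_le => e e0.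
have rl : cvgn r.
  by apply: nondecreasing_is_cvgn => //; exists C => _ [n _ <-].
have [] := (cvgrPdist_lt _ _).1 rl (e ^+ k.+1 / 2).
  by rewrite divr_gt0 ?exprn_gt0.
set l := limn r => N _ Nl; exists N => n Nn.
rewrite -(@ler_pXn2r _ k.+1) ?nnegrE//; last exact: ltW.
rewrite (le_trans (ur _ _ Nn))//.
have := Nl N (leqnn N); have := Nl n Nn => /= ln lN.
rewrite (_ : r n - r N = (l - r N) - (l - r n)); last by ring.
rewrite (le_trans (ler_norm _))// (le_trans (ler_normB _ _))//.
by rewrite [e ^+ _ in leRHS]splitr lerD// ltW.
Qed.

End Cauchy.

Section OrthonormalSystems.
Context (R : realType) (X : hilbertType R).
Implicit Types (e : nat -> X) (a : nat -> R).

Definition orthonormal_system e : Prop :=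
  (forall i j, i != j -> inner (e i) (e j) = 0) /\
  (forall i, e i = 0 \/ `|e i| = 1).

Lemma basis_system V e : orthonormal_basis V e -> orthonormal_system e.
Proof. by case. Qed.

Context e (oe : orthonormal_system e).

(** Replaces [inner (e i) (e i) = 1], which fails for the zero vectors used as padding. *)
Lemma orthonormal_scale i : inner (e i) (e i) *: e i = e i.
Proof.
have [_ /(_ i) [->|ei]] := oe; first by rewrite scaler0.
by rewrite inner_norm ei expr1n scale1r.
Qed.

Lemma inner_orthosum a n j :
  inner (\sum_(i < n) a i *: e i) (e j) =
  if (j < n)%N then a j * inner (e j) (e j) else 0.
Proof.
rewrite inner_suml; case: ltnP => jn.
  rewrite (bigD1 (Ordinal jn))//= innerZl big1 ?addr0// => i ij.
  by rewrite innerZl oe.1 ?mulr0//; apply: contra ij => /eqP ij; apply/eqP/val_inj.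
rewrite big1// => i _; rewrite innerZl oe.1 ?mulr0//.
by rewrite neq_ltn (leq_trans (ltn_ord i) jn).
Qed.

Lemma inner_orthosum2 a (b : nat -> R) n :
  inner (\sum_(i < n) a i *: e i) (\sum_(i < n) b i *: e i) =
  \sum_(i < n) a i * b i * inner (e i) (e i).
Proof.
rewrite [LHS]innerC inner_suml; apply: eq_bigr => i _.
by rewrite innerZl innerC inner_orthosum ltn_ord; ring.
Qed.

Lemma orthosum_incr a m n : (m <= n)%N ->
  `|\sum_(i < n) a i *: e i - \sum_(i < m) a i *: e i| ^+ 2 =
  `|\sum_(i < n) a i *: e i| ^+ 2 - `|\sum_(i < m) a i *: e i| ^+ 2.
Proof.
move=> mn; rewrite sqr_normB.
suff -> : inner (\sum_(i < n) a i *: e i) (\sum_(i < m) a i *: e i) =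
          `|\sum_(i < m) a i *: e i| ^+ 2 by ring.
rewrite -inner_norm innerC !inner_suml; apply: eq_bigr => i _.
rewrite !innerZl !(innerC (e i)) !inner_orthosum ltn_ord.
by rewrite (leq_trans (ltn_ord i) mn).
Qed.

Lemma orthosum_homo a :
  {homo (fun n => `|\sum_(i < n) a i *: e i| ^+ 2) : m n / (m <= n)%N >-> m <= n}.
Proof. by move=> m n mn; rewrite -subr_ge0 -orthosum_incr// sqr_ge0. Qed.

(** By Pythagoras the squared norms of the partial sums increase, and their increments are the
    squared norms of the blocks; bounded partial sums are therefore Cauchy. *)
Lemma riesz_fischer a C :
  (forall n, `|\sum_(i < n) a i *: e i| <= C) ->
  cvgn (fun n => \sum_(i < n) a i *: e i).
Proof.
move=> aC; apply: (@cvgn_dominated _ _ _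
    (fun n => `|\sum_(i < n) a i *: e i| ^+ 2) 1%N).
- exact: orthosum_homo.
- exists (C ^+ 2) => n; rewrite ler_pXn2r ?nnegrE//; exact: le_trans (aC n).
- by move=> m n mn; rewrite orthosum_incr.
Qed.

Lemma inner_projl n x y :
  inner (proj e n x) y = \sum_(i < n) inner x (e i) * inner y (e i).
Proof.
by rewrite inner_suml; apply: eq_bigr => i _; rewrite innerZl (innerC (e i)).
Qed.

Lemma inner_proj_sym n x y : inner (proj e n x) y = inner x (proj e n y).
Proof.
rewrite [RHS]innerC !inner_projl; apply: eq_bigr => i _; exact: mulrC.
Qed.

Lemma proj_linear n : linear (proj e n).
Proof.
move=> a x y; rewrite /proj scaler_sumr -big_split/=; apply: eq_bigr => i _.
by rewrite inner_linear scalerDl scalerA.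
Qed.

Lemma inner_proj n x : inner (proj e n x) x = `|proj e n x| ^+ 2.
Proof.
rewrite -inner_norm inner_projl.
rewrite [RHS](_ : _ = \sum_(i < n) inner x (e i) * inner x (e i) * inner (e i) (e i)).
  2: exact: (inner_orthosum2 (fun i => inner x (e i)) (fun i => inner x (e i))).
by apply: eq_bigr => i _; rewrite -[RHS]mulrA; congr (_ * _);
  rewrite mulrC -innerZr orthonormal_scale.
Qed.

Lemma proj_basis n j : (j < n)%N -> proj e n (e j) = e j.
Proof.
move=> jn; rewrite /proj (bigD1 (Ordinal jn))//= orthonormal_scale big1 ?addr0//.
move=> i ij; rewrite oe.1 ?scale0r//.
by apply: contra ij => /eqP ij; apply/eqP/val_inj.
Qed.

Lemma norm_proj_le n x : `|proj e n x| <= `|x|.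
Proof.
apply: norm_le_inner => //.
by rewrite inner_norm -inner_proj innerC ler_inner.
Qed.

Lemma norm_sub_proj n x : `|x - proj e n x| ^+ 2 = `|x| ^+ 2 - `|proj e n x| ^+ 2.
Proof. by rewrite sqr_normB innerC inner_proj; ring. Qed.

Lemma norm_sub_proj_le n x : `|x - proj e n x| <= `|x|.
Proof.
by rewrite -(@ler_pXn2r _ 2) ?nnegrE// norm_sub_proj gerBl sqr_ge0.
Qed.

Lemma bessel n x : \sum_(i < n) inner x (e i) ^+ 2 <= `|x| ^+ 2.
Proof.
rewrite (_ : \sum_(i < n) _ = `|proj e n x| ^+ 2).
  by rewrite ler_pXn2r ?nnegrE// norm_proj_le.
by rewrite -inner_proj inner_projl.
Qed.

Lemma cvgn_proj x : cvgn (proj e ^~ x).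
Proof.
apply: (@riesz_fischer (fun i => inner x (e i)) `|x|) => n.
exact: norm_proj_le.
Qed.

Lemma inner_lim_proj x j : inner (limn (proj e ^~ x)) (e j) = inner x (e j).
Proof.
have : inner (proj e n x) (e j) @[n --> \oo] -->
       inner (limn (proj e ^~ x)) (e j).
  by apply: cvg_innerl; exact: cvgn_proj.
move=> /(cvg_lim (@Rhausdorff R)) <-; apply: (cvg_lim (@Rhausdorff R)).
apply: cvg_near_cst; exists j.+1 => // n /= jn.
by rewrite inner_proj_sym proj_basis.
Qed.

End OrthonormalSystems.

(** * Gram-Schmidt orthonormalisation and existence of bases *)

Section GramSchmidt.
Context (R : realType) (X : hilbertType R).
Implicit Types (d : nat -> X).

(** Since the inverse of 0 is 0, a vector that depends linearly on its predecessors contributes the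
    zero vector, which [orthonormal_basis] accepts as padding. *)
Fixpoint gram_schmidt_seq d (n : nat) : seq X :=
  if n is m.+1 then
    let s := gram_schmidt_seq d m in
    let r := d m - \sum_(i < m) inner (d m) (nth 0 s i) *: nth 0 s i in
    rcons s (`|r|^-1 *: r)
  else [::].

Definition gram_schmidt d (n : nat) : X := nth 0 (gram_schmidt_seq d n.+1) n.

Let size_gs d n : size (gram_schmidt_seq d n) = n.
Proof. by elim: n => //= n IH; rewrite size_rcons IH. Qed.

Let nth_gs d m n : (m < n)%N -> nth 0 (gram_schmidt_seq d n) m = gram_schmidt d m.
Proof.
elim: n => // n IH; rewrite ltnS leq_eqVlt => /predU1P[->//|mn].
by rewrite /= nth_rcons size_gs mn IH.
Qed.

Let residual d n := d n - proj (gram_schmidt d) n (d n).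

Let gsE d n : gram_schmidt d n = `|residual d n|^-1 *: residual d n.
Proof.
rewrite /gram_schmidt /= nth_rcons size_gs ltnn eqxx /residual /proj.
have -> : \sum_(i < n) inner (d n) (gram_schmidt d i) *: gram_schmidt d i =
  \sum_(i < n) inner (d n) (nth 0 (gram_schmidt_seq d n) i) *:
    nth 0 (gram_schmidt_seq d n) i.
  by apply: eq_bigr => i _; rewrite nth_gs.
by [].
Qed.

Lemma gram_schmidt_norm d i : gram_schmidt d i = 0 \/ `|gram_schmidt d i| = 1.
Proof.
rewrite gsE; have [->|r0] := eqVneq (residual d i) 0.
  by left; rewrite scaler0.
by right; rewrite normrZ normfV normr_id mulVf ?normr_eq0.
Qed.

Lemma gram_schmidt_system d : orthonormal_system (gram_schmidt d).
Proof.
split; last exact: gram_schmidt_norm.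
suff lt_orth n i : (i < n)%N -> inner (gram_schmidt d n) (gram_schmidt d i) = 0.
  move=> i j; rewrite neq_ltn => /orP[|] ij; last exact: lt_orth.
  by rewrite innerC lt_orth.
(* Strong induction on a bound for the larger index: the earlier vectors are already mutually
   orthogonal. *)
have [m] := ubnP n; elim: m n i => // m IH n i nm lt_in.
have orth k j : (k < n)%N -> (j < n)%N -> k != j ->
    inner (gram_schmidt d k) (gram_schmidt d j) = 0.
  move=> kn jn; rewrite neq_ltn => /orP[|] kj; last first.
    by apply: IH => //; rewrite (leq_trans kn).
  by rewrite innerC; apply: IH => //; rewrite (leq_trans jn).
rewrite gsE innerZl /residual innerBl.
suff -> : inner (proj (gram_schmidt d) n (d n)) (gram_schmidt d i) =
          inner (d n) (gram_schmidt d i) by rewrite subrr mulr0.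
rewrite /proj inner_suml (bigD1 (Ordinal lt_in))//= innerZl big1 => [|k ki].
  rewrite addr0; have [->|ei] := gram_schmidt_norm d i; first by rewrite !inner0r mulr0.
  by rewrite inner_norm ei expr1n mulr1.
by rewrite innerZl orth ?mulr0.
Qed.

Lemma proj_gram_schmidt d n : proj (gram_schmidt d) n.+1 (d n) = d n.
Proof.
have res_inner : inner (d n) (residual d n) = `|residual d n| ^+ 2.
  rewrite /residual norm_sub_proj; last exact: gram_schmidt_system.
  rewrite innerBr inner_norm innerC inner_proj//; exact: gram_schmidt_system.
rewrite /proj big_ord_recr/= -/(proj _ _ _) [X in _ + X](_ : _ = residual d n).
  by rewrite addrC subrK.
rewrite gsE innerZr res_inner.
have [->|r0] := eqVneq (residual d n) 0; first by rewrite !scaler0.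
rewrite scalerA (_ : _ * _ = 1) ?scale1r//.
by field; rewrite normr_eq0.
Qed.

Lemma separable_enum : separable X ->
  exists d : nat -> X, forall x (e : R), 0 < e -> exists n, `|x - d n| < e.
Proof.
move=> [A cA dA].
have [x0 _] : exists x0, A x0.
  have [|x [_ Ax]] := dA setT _ openT; last by exists x.
  by exists 0.
have /pfcard_geP[A0|] := cA.
  have [|x [_]] := dA setT _ openT; first by exists 0.
  by rewrite A0.
move=> [f]; exists f => x e e0.
have [|y [xy Ay]] := dA (ball x e) _ (ball_open _ _).
  by exists x; exact: ballxx.
have [n _ fn] : (f @` setT) y.
  by have := 'surj_f; apply.
by exists n; rewrite fn; move: xy; rewrite -ball_normE.
Qed.

(** For m > n the projection P_m fixes d_n, so x - P_m x = (x - d_n) - P_m (x - d_n) has norm at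
    most |x - d_n|, and the d_n are dense. *)
Lemma orthonormal_basis_exists : separable X ->
  exists f : nat -> X, orthonormal_basis setT f.
Proof.
move=> /separable_enum[d dd].
have og := gram_schmidt_system d.
exists (gram_schmidt d); split=> //; [exact: og.1|exact: og.2|move=> x _].
apply/cvgrPdist_le => e e0; have [n xn] := dd x e e0.
exists n.+1 => // m /= nm; apply: (@le_trans _ _ `|x - d n|); last exact: ltW.
have -> : x - proj (gram_schmidt d) m x =
          (x - d n) - proj (gram_schmidt d) m (x - d n).
  have -> : proj (gram_schmidt d) m (x - d n) =
            proj (gram_schmidt d) m x - proj (gram_schmidt d) m (d n).
    by rewrite addrC -scaleN1r proj_linear scaleN1r addrC.
  suff -> : proj (gram_schmidt d) m (d n) = d n.
    by rewrite opprB addrA subrK.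
  rewrite -[in LHS](proj_gram_schmidt d n) /proj.
  rewrite -[RHS](proj_gram_schmidt d n) /proj.
  set a := fun i => inner (d n) (gram_schmidt d i).
  rewrite [in RHS](big_ord_widen m (fun i => a i *: gram_schmidt d i))//.
  rewrite [RHS]big_mkcond/=; apply: eq_bigr => i _.
  rewrite (inner_orthosum og a); case: ifP => _; last by rewrite scale0r.
  by rewrite -scalerA orthonormal_scale.
exact: norm_sub_proj_le.
Qed.

End GramSchmidt.

(** * Riesz representation, adjoints and square roots *)

Section LinearMaps.
Context (R : realType) (X : hilbertType R).
Implicit Types (A : X -> X).

Lemma linear_map0 A : linear A -> A 0 = 0.
Proof.
by move=> lA; have := lA (-1) 0 0; rewrite scaler0 addr0 scaleN1r addNr.
Qed.

Lemma linear_mapD A : linear A -> {morph A : x y / x + y}.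
Proof. by move=> lA x y; have := lA 1 x y; rewrite !scale1r. Qed.

Lemma linear_mapZ A : linear A -> forall a x, A (a *: x) = a *: A x.
Proof. by move=> lA a x; have := lA a x 0; rewrite (linear_map0 lA) !addr0. Qed.

Lemma linear_mapB A : linear A -> {morph A : x y / x - y}.
Proof.
by move=> lA x y; rewrite linear_mapD// -scaleN1r linear_mapZ// scaleN1r.
Qed.

Lemma linear_map_sum A : linear A -> forall n (u : nat -> X),
  A (\sum_(i < n) u i) = \sum_(i < n) A (u i).
Proof.
move=> lA n u; elim: n => [|n IH]; first by rewrite !big_ord0 linear_map0.
by rewrite !big_ord_recr/= linear_mapD// IH.
Qed.

Lemma bounded_operator_norm A : bounded_operator A ->
  exists2 C, 0 <= C & forall x, `|A x| <= C * `|x|.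
Proof.
move=> [lA cA].
pose A' : {linear X -> X} := HB.pack A (GRing.isLinear.Build _ _ _ _ _ lA).
have /linear_boundedP : bounded_near A' (nbhs 0).
  by apply/linear_bounded_continuous => x; exact: cA.
move=> [M [_ bM]]; exists (Num.max 0 M + 1) => [|x].
  by rewrite addr_ge0// le_max lexx.
by apply: bM; rewrite ltr_pwDr// le_max lexx orbT.
Qed.

Lemma linear_bounded_operator A C : linear A ->
  (forall x, `|A x| <= C * `|x|) -> bounded_operator A.
Proof.
move=> lA AC; split=> // x; apply/cvgrPdist_le => e e0; near=> t.
rewrite -linear_mapB// (le_trans (AC _))//.
rewrite (@le_trans _ _ ((`|C| + 1) * `|x - t|))//.
  by rewrite ler_wpM2r// (le_trans (ler_norm C))// lerDl.
rewrite -ler_pdivlMl ?ltr_wpDl// mulrC; near: t.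
by apply: cvgr_dist_le; [exact: cvg_id|rewrite divr_gt0 ?ltr_wpDl].
Unshelve. all: by end_near. Qed.

Lemma bounded_operator_cvg A (u : nat -> X) x : bounded_operator A ->
  u @ \oo --> x -> A (u n) @[n --> \oo] --> A x.
Proof. by move=> [_ cA] ux; exact: (continuous_cvg _ (cA x) ux). Qed.

Lemma linear_comp A (A' : X -> X) : linear A -> linear A' -> linear (A \o A').
Proof. by move=> lA lA' a x y /=; rewrite lA' lA. Qed.

Lemma ipnorm_whole (x : X) : ipnorm whole x = `|x|.
Proof. by rewrite /ipnorm/= inner_norm sqrtr_sqr normr_id. Qed.

Lemma nonneg_whole A : nonneg_operator whole A <->
  [/\ linear A, exists2 C, 0 <= C & forall x, `|A x| <= C * `|x|,
      forall x y, inner (A x) y = inner x (A y) & forall x, 0 <= inner (A x) x].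
Proof.
split=> [[[C [_ lA AC]] sA pA]|[lA [C C0 AC] sA pA]].
  split=> [a x y||x y|x]; [exact: lA| |exact: sA|exact: pA].
  exists `|C| => // x; rewrite -[`|A x|]ipnorm_whole (le_trans (AC x I))//.
  by rewrite ipnorm_whole ler_wpM2r// ler_norm.
split; [|by move=> *; exact: sA|by move=> *; exact: pA].
exists C; split=> // [a x y _ _|x _]; first exact: lA.
by rewrite !ipnorm_whole.
Qed.

End LinearMaps.

Section Riesz.
Context (R : realType) (X : hilbertType R) (sepX : separable X).
Implicit Types (A : X -> X).

Lemma parseval (f : nat -> X) (x y : X) : orthonormal_basis setT f ->
  \sum_(i < n) inner x (f i) * inner y (f i) @[n --> \oo] --> inner x y.
Proof.
move=> [_ _ _ /(_ x Logic.I) fx].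
under eq_fun do rewrite -inner_projl.
exact: cvg_innerl.
Qed.

(** The vector is the sum of phi(f_i) f_i over an orthonormal basis. Its partial sums v_n satisfy
    |v_n|^2 = phi(v_n) <= C |v_n|, so they converge by [riesz_fischer]. *)
Lemma riesz (phi : X -> R) (C : R) :
  (forall a x y, phi (a *: x + y) = a * phi x + phi y) ->
  (forall x, `|phi x| <= C * `|x|) ->
  exists v, forall x, inner v x = phi x.
Proof.
move=> lphi phiC; have [f bf] := orthonormal_basis_exists sepX.
have of_ := basis_system bf.
have phi0 : phi 0 = 0.
  by have := lphi (-1) 0 0; rewrite scaler0 addr0 mulN1r addNr.
have phi_sum (a : nat -> R) n :
    phi (\sum_(i < n) a i *: f i) = \sum_(i < n) a i * phi (f i).
  elim: n => [|n IH]; first by rewrite !big_ord0 phi0.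
  by rewrite !big_ord_recr/= addrC lphi IH addrC.
pose v n := \sum_(i < n) phi (f i) *: f i.
have vC n : `|v n| <= `|C|.
  apply: norm_le_inner => //; rewrite (_ : inner _ _ = phi (v n)).
    rewrite (le_trans (ler_norm _))// (le_trans (phiC _))// ler_wpM2r//.
    exact: ler_norm.
  transitivity (\sum_(i < n) phi (f i) * phi (f i)); last first.
    exact/esym/(phi_sum (phi \o f)).
  transitivity (\sum_(i < n) phi (f i) * phi (f i) * inner (f i) (f i)).
    exact: (inner_orthosum2 of_ (phi \o f) (phi \o f)).
  apply: eq_bigr => i _; have [fi|fi] := of_.2 i.
    by rewrite fi phi0 !mul0r.
  by rewrite inner_norm fi expr1n mulr1.
have vv : v @ \oo --> limn v by exact: (@riesz_fischer _ _ _ of_ (phi \o f) _ vC).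
exists (limn v) => x.
have vx : inner (v n) x @[n --> \oo] --> inner (limn v) x by exact: cvg_innerl.
rewrite -(cvg_lim (@Rhausdorff R) vx); apply: (cvg_lim (@Rhausdorff R)).
apply/cvgrPdist_le => e e0.
have [_ _ _ /(_ x Logic.I) fx] := bf.
near=> n; rewrite (_ : inner (v n) x = phi (proj f n x)); last first.
  rewrite /proj (phi_sum (fun i => inner x (f i))) inner_suml; apply: eq_bigr => i _.
  by rewrite innerZl mulrC (innerC x).
have -> : phi x - phi (proj f n x) = phi (x - proj f n x).
  have := lphi (-1) (proj f n x) x.
  by rewrite scaleN1r mulN1r [- _ + x]addrC [- _ + phi x]addrC.
rewrite (le_trans (phiC _))// (@le_trans _ _ ((`|C| + 1) * `|x - proj f n x|))//.
  by rewrite ler_wpM2r// (le_trans (ler_norm C))// lerDl.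
rewrite -ler_pdivlMl ?ltr_wpDl// mulrC; near: n.
by apply: cvgr_dist_le => //; rewrite divr_gt0 ?ltr_wpDl.
Unshelve. all: by end_near. Qed.

Lemma inner_adjoint A h k : bounded_operator A ->
  inner (A h) k = inner h (adjoint whole whole A k).
Proof.
move=> bA; have [C C0 AC] := bounded_operator_norm bA.
have [v vE] : exists v, forall x, inner v x = inner (A x) k.
  apply: (@riesz _ (C * `|k|)) => [a x y|x].
    by rewrite bA.1 innerDl innerZl.
  by rewrite (le_trans (cauchy_schwarz _ _))// mulrAC ler_wpM2r.
rewrite /adjoint; case: xgetP => [g _ [_ /= gE]|]; first exact: gE.
by move=> /(_ v) []; split=> // x _; rewrite /= [RHS]innerC vE.
Qed.

Lemma adjoint_linear A : bounded_operator A -> linear (adjoint whole whole A).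
Proof.
move=> bA a x y; apply: inner_ext => z.
rewrite innerC -inner_adjoint// innerDl innerZl !(innerC _ z) -!inner_adjoint//.
by rewrite innerDr innerZr.
Qed.

Lemma adjoint_norm A C : bounded_operator A -> 0 <= C ->
  (forall x, `|A x| <= C * `|x|) -> forall x, `|adjoint whole whole A x| <= C * `|x|.
Proof.
move=> bA C0 AC x; apply: norm_le_inner; first by rewrite mulr_ge0.
by rewrite -inner_adjoint// (le_trans (ler_inner _ _))// mulrAC ler_wpM2r.
Qed.

End Riesz.

(** * Square roots of nonnegative operators *)

Section SquareRoot.
Context (R : realType) (X : hilbertType R).

(* Solving [2 Y = B + Y^2] by iteration from 0; the numbers [rate n] solve the
   same recursion for [B = 1] and dominate the iterates. *)
Let rate := fix rate n : R := if n is m.+1 then 2^-1 * (1 + rate m ^+ 2) else 0.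

Let rate_itv n : 0 <= rate n <= 1.
Proof.
elim: n => [|n /andP[IH0 IH1]]; first by rewrite /= lexx ler01.
rewrite /=; apply/andP; split; first by rewrite mulr_ge0 ?addr_ge0 ?sqr_ge0.
have : rate n ^+ 2 <= 1 by rewrite expr_le1.
lra.
Qed.

Let rate_succ n : rate n <= rate n.+1.
Proof. by rewrite /= -subr_ge0; have := sqr_ge0 (rate n - 1); nra. Qed.

Let rate_homo : {homo rate : m n / (m <= n)%N >-> m <= n}.
Proof. by apply: homo_leq; [exact: lexx|exact: le_trans|exact: rate_succ]. Qed.

Context (B : X -> X) (lB : linear B) (B1 : forall x, `|B x| <= `|x|).

Let iter_B := fix Y n : X -> X :=
  if n is m.+1 then fun x => 2^-1 *: (B x + Y m (Y m x)) else fun=> 0.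

Let iter_linear n : linear (iter_B n).
Proof.
elim: n => [|n IH] a x y /=; first by rewrite scaler0 addr0.
by rewrite !IH lB addrACA -!scalerDr scalerA mulrC -scalerA -scalerDr.
Qed.

Let iter_norm n x : `|iter_B n x| <= rate n * `|x|.
Proof.
elim: n x => [|n IH] x /=; first by rewrite normr0 mul0r.
rewrite normrZ ger0_norm// -mulrA ler_wpM2l// (le_trans (ler_normD _ _))//.
rewrite mulrDl mul1r lerD// expr2 -mulrA (le_trans (IH _))// ler_wpM2l//.
by have /andP[] := rate_itv n.
Qed.

(** For consecutive iterates Y and Z, Y^2 - Z^2 = Y (Y - Z) + (Y - Z) Z. The same factorisation for
    the numbers [rate] shows that their increments dominate those of the iterates. *)
Let iter_step n x : `|iter_B n.+1 x - iter_B n x| <= (rate n.+1 - rate n) * `|x|.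
Proof.
elim: n x => [|n IH] x.
  by rewrite /= !addr0 !subr0 normrZ ger0_norm// expr0n addr0 mulr1 ler_wpM2l.
set Y := iter_B n.+1; set Z := iter_B n.
have lY : linear Y := iter_linear n.+1.
have -> : iter_B n.+2 x - Y x = 2^-1 *: (Y (Y x - Z x) + (Y (Z x) - Z (Z x))).
  rewrite (_ : iter_B n.+2 x = 2^-1 *: (B x + Y (Y x)))//.
  rewrite [in LHS](_ : Y x = 2^-1 *: (B x + Z (Z x)))//.
  rewrite -scalerBr; congr (_ *: _).
  rewrite [X in _ + Y X](_ : _ = Y x)// (linear_mapB lY) addrA subrK.
  by rewrite opprD addrACA subrr add0r.
have [q [r [Er2 [q0 qr] Yq Zr ZN]]] : exists q r, [/\
    rate n.+2 - rate n.+1 = 2^-1 * (q * (q - r) + (q - r) * r), 0 <= q /\ 0 <= q - r,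
    forall z, `|Y z| <= q * `|z|,
    forall z, `|Y z - Z z| <= (q - r) * `|z| & forall z, `|Z z| <= r * `|z|].
  exists (rate n.+1), (rate n); split.
  - have E : rate n.+1 = 2^-1 * (1 + rate n ^+ 2) by [].
    have -> : rate n.+2 = 2^-1 * (1 + rate n.+1 ^+ 2) by [].
    by move: (rate n.+1) (rate n) E => u v ->; field.
  - by rewrite subr_ge0; have /andP[] := rate_itv n.+1.
  - exact: iter_norm.
  - exact: IH.
  - exact: iter_norm.
rewrite Er2 normrZ ger0_norm// -mulrA ler_wpM2l// (le_trans (ler_normD _ _))//.
rewrite mulrDl -!mulrA lerD//.
  by rewrite (le_trans (Yq _))// ler_wpM2l.
by rewrite (le_trans (Zr _))// ler_wpM2l.
Qed.

Let iter_cauchy m n x : (m <= n)%N ->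
  `|iter_B n x - iter_B m x| <= rate n * `|x| - rate m * `|x|.
Proof.
move=> /subnK <-; elim: (n - m)%N => [|k IH]; first by rewrite add0n !subrr normr0.
rewrite addSn -(subrK (iter_B (k + m) x) (iter_B (k + m).+1 x)) -addrA.
rewrite (le_trans (ler_normD _ _))//.
by have := iter_step (k + m) x; rewrite mulrBl; lra.
Qed.

Let lim_B x := limn (iter_B ^~ x).

Let cvg_B x : iter_B n x @[n --> \oo] --> lim_B x.
Proof.
apply: (@cvgn_dominated _ _ _ (fun n => rate n * `|x|) 0%N).
- by move=> m n mn; rewrite ler_wpM2r// rate_homo.
- exists `|x| => n; rewrite ler_piMl//.
  by have /andP[] := rate_itv n.
- by move=> m n mn; rewrite expr1 iter_cauchy.
Qed.

Let lim_linear : linear lim_B.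
Proof.
move=> a x y; apply: (cvg_lim (@norm_hausdorff _ _)).
under eq_fun do rewrite iter_linear.
by apply: cvgD; [apply: cvgZr|]; exact: cvg_B.
Qed.

Let lim_norm x : `|lim_B x| <= `|x|.
Proof.
have : `|iter_B n x| @[n --> \oo] --> `|lim_B x| by apply: cvg_norm; exact: cvg_B.
move=> /cvgr_to_le; apply; apply: nearW => n.
rewrite (le_trans (iter_norm _ _))// ler_piMl//.
by have /andP[] := rate_itv n.
Qed.

Let lim_square x : 2 *: lim_B x = B x + lim_B (lim_B x).
Proof.
have YY : iter_B n (iter_B n x) @[n --> \oo] --> lim_B (lim_B x).
  apply/cvgrPdist_le => e e0; near=> n.
  rewrite (@le_trans _ _ (`|lim_B (lim_B x) - iter_B n (lim_B x)| +
                          `|lim_B x - iter_B n x|))//.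
    rewrite -[_ - iter_B n (iter_B n x)](subrKA (iter_B n (lim_B x))).
    rewrite (le_trans (ler_normD _ _))// lerD2l -linear_mapB//.
    rewrite (le_trans (iter_norm _ _))// ler_piMl//.
    by have /andP[] := rate_itv n.
  rewrite [e]splitr lerD//; near: n.
    by apply: cvgr_dist_le; [exact: cvg_B|rewrite divr_gt0].
  by apply: cvgr_dist_le; [exact: cvg_B|rewrite divr_gt0].
have Y1 : 2 *: iter_B n.+1 x @[n --> \oo] --> 2 *: lim_B x.
  by apply: cvgZr; rewrite (cvg_shiftS (iter_B ^~ x)); exact: cvg_B.
have /(cvg_lim (@norm_hausdorff _ _)) <- := Y1.
apply: (cvg_lim (@norm_hausdorff _ _)).
rewrite (_ : (fun n => _) = (fun n => B x + iter_B n (iter_B n x))).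
  by apply: cvgD => //; exact: cvg_cst.
by apply/funext => n /=; rewrite scalerA mulfV ?scale1r.
Unshelve. all: by end_near. Qed.

Let lim_sym : (forall x y, inner (B x) y = inner x (B y)) ->
  forall x y, inner (lim_B x) y = inner x (lim_B y).
Proof.
move=> sB x y.
have sY n u v : inner (iter_B n u) v = inner u (iter_B n v).
  elim: n u v => [|n IH] u v /=; first by rewrite inner0l inner0r.
  by rewrite innerZl innerZr innerDl innerDr sB !IH.
have xy : inner (iter_B n x) y @[n --> \oo] --> inner (lim_B x) y.
  by apply: cvg_innerl; exact: cvg_B.
rewrite -(cvg_lim (@Rhausdorff R) xy); apply: (cvg_lim (@Rhausdorff R)).
by under eq_fun do rewrite sY; apply: cvg_innerr; exact: cvg_B.
Qed.

(** The equation says (I - Y)^2 = I - B, so I - Y is a square root of I - B. It serves for the root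
    of a covariance and for the defect operator. *)
Lemma contraction_half_square : (forall x y, inner (B x) y = inner x (B y)) ->
  exists Y : X -> X, [/\ linear Y, forall x, `|Y x| <= `|x|,
    forall x y, inner (Y x) y = inner x (Y y)
    & forall x, 2 *: Y x = B x + Y (Y x)].
Proof.
move=> sB; exists lim_B; split=> //; exact: lim_sym.
Qed.

End SquareRoot.

Section PositiveRoot.
Context (R : realType) (X : hilbertType R).
Implicit Types (Q J Y : X -> X).

Lemma nonneg_sub_contraction Y : linear Y -> (forall x, `|Y x| <= `|x|) ->
  (forall x y, inner (Y x) y = inner x (Y y)) ->
  nonneg_operator whole (fun x => x - Y x).
Proof.
move=> lY Y1 sY; apply/nonneg_whole; split=> [a x y||x y|x].
- by rewrite lY opprD addrACA scalerBr.
- exists 2 => // x; rewrite (le_trans (ler_normB _ _))//.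
  by have := Y1 x; lra.
- by rewrite innerBl innerBr sY.
- rewrite innerBl inner_norm subr_ge0 (le_trans (ler_inner _ _))//.
  by rewrite expr2 ler_wpM2r.
Qed.

Definition is_sqrt Q J : Prop :=
  nonneg_operator whole J /\ forall x, J (J x) = Q x.

Lemma sqrt_operatorP Q : nonneg_operator whole Q ->
  is_sqrt Q (sqrt_operator whole Q).
Proof.
move=> /nonneg_whole[lQ [C C0 QC] sQ pQ].
suff [J [nJ JJ]] : exists J, is_sqrt Q J.
  rewrite /sqrt_operator; case: xgetP => [S _ [nS SS]|/(_ J)[]//].
  by split=> // x; exact: SS.
(* The added 1 makes M positive even when Q = 0. For the contraction B = I - Q / M, the operator
   sqrt M (I - Y) squares to M (I - B) = Q. *)
pose M := C + 1; have M0 : 0 < M by rewrite /M; lra.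
pose B x := x - M^-1 *: Q x.
have lB : linear B.
  move=> a x y; rewrite /B lQ scalerDr opprD addrACA scalerBr.
  by rewrite !scalerA [M^-1 * a]mulrC.
have B1 x : `|B x| <= `|x|.
  rewrite -(@ler_pXn2r _ 2) ?nnegrE// /B sqr_normB normrZ innerZr (innerC x).
  (* Positivity of Q at this vector, together with <Q Q x, Q x> <= M |Q x|^2, gives |Q x|^2 <= M <Q
     x, x>, and the expansion of |B x|^2 is then at most |x|^2. *)
  have := pQ (x - M^-1 *: Q x).
  rewrite linear_mapB// linear_mapZ// !(innerBl, innerBr, innerZl, innerZr).
  rewrite (sQ (Q x) x) !inner_norm gtr0_norm ?invr_gt0// exprMn.
  have : inner (Q (Q x)) (Q x) <= M * `|Q x| ^+ 2.
    rewrite (le_trans (ler_inner _ _))// expr2 mulrA ler_wpM2r//.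
    by rewrite (le_trans (QC _))// ler_wpM2r// /M lerDl.
  move: (inner (Q (Q x)) (Q x)) (`|Q x| ^+ 2) => u v uv.
  have : M^-1 * (M^-1 * u) <= M^-1 * v.
    by rewrite ler_wpM2l ?invr_ge0 ?(ltW M0)// ler_pdivrMl.
  move=> h1 h2.
  have h3 : M^-1 * v <= inner (Q x) x by lra.
  have : M^-1 ^+ 2 * v <= M^-1 * inner (Q x) x.
    by rewrite expr2 -mulrA ler_wpM2l// invr_ge0 ltW.
  have : 0 <= M^-1 * inner (Q x) x by rewrite mulr_ge0// invr_ge0 ltW.
  lra.
have [Y [lY Y1 sY YY]] : exists Y : X -> X, [/\ linear Y, forall x, `|Y x| <= `|x|,
    forall x y, inner (Y x) y = inner x (Y y)
    & forall x, 2 *: Y x = B x + Y (Y x)].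
  apply: contraction_half_square => // x y.
  by rewrite /B innerBl innerBr innerZl innerZr sQ.
have /nonneg_whole[lI [D D0 ID] sI pI] := nonneg_sub_contraction lY Y1 sY.
exists (fun x => Num.sqrt M *: (x - Y x)); split.
  apply/nonneg_whole; split=> [a x y||x y|x].
  - by rewrite lI scalerDr !scalerA [Num.sqrt M * a]mulrC.
  - exists (Num.sqrt M * D) => [|x]; first by rewrite mulr_ge0 ?sqrtr_ge0.
    by rewrite normrZ ger0_norm ?sqrtr_ge0// -mulrA ler_wpM2l ?sqrtr_ge0.
  - by rewrite innerZl innerZr sI.
  - by rewrite innerZl mulr_ge0 ?sqrtr_ge0.
move=> x; rewrite linear_mapZ// -scalerBr scalerA -expr2 sqr_sqrtr ?ltW//.
rewrite linear_mapB// opprB addrC -addrA.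
have -> : Y (Y x) + (- Y x + (x - Y x)) = x - B x.
  have -> : Y (Y x) = 2 *: Y x - B x by rewrite YY addrC addKr.
  rewrite scaler_nat mulr2n [- Y x + _]addrC -[x - Y x - Y x]addrA -opprD.
  by rewrite addrCA addrAC subrr add0r.
by rewrite /B opprB addrCA subrr addr0 scalerA mulfV ?scale1r// gt_eqF.
Qed.

End PositiveRoot.

(** * Cameron-Martin spaces *)

Section CameronMartin.
Context (R : realType) (X : hilbertType R) (Q : X -> X) (e : nat -> X).
Hypotheses (nQ : nonneg_operator whole Q) (be : eigenbasis Q e).
Implicit Types (x y z h k : X).
Let J := sqrt_operator whole Q.
Let H := cameron_martin Q.
Let K := orthogonal_compl (kernel J).

Lemma root_linear : linear J.
Proof. by have [/nonneg_whole[]] := sqrt_operatorP nQ. Qed.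

Lemma root_square x : J (J x) = Q x.
Proof. by have [_] := sqrt_operatorP nQ; exact. Qed.

Lemma root_sym x y : inner (J x) y = inner x (J y).
Proof. by have [/nonneg_whole[_ _ sJ _] _] := sqrt_operatorP nQ; exact: sJ. Qed.

Lemma root_ge0 x : 0 <= inner (J x) x.
Proof. by have [/nonneg_whole[_ _ _ pJ] _] := sqrt_operatorP nQ; exact: pJ. Qed.

Lemma root_bounded : bounded_operator J.
Proof.
have [/nonneg_whole[lJ [C C0 JC] _ _] _] := sqrt_operatorP nQ.
exact: (linear_bounded_operator lJ JC).
Qed.

Lemma root_norm x : `|J x| ^+ 2 = inner (Q x) x.
Proof. by rewrite -inner_norm root_sym root_square innerC. Qed.

Lemma kernel_root : kernel J = kernel Q.
Proof.
apply/seteqP; split=> x /= Jx.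
  by rewrite /kernel/= -root_square Jx linear_map0//; exact: root_linear.
by apply: inner_eq0; rewrite inner_norm root_norm Jx inner0l.
Qed.

Lemma root_compl x : K (J x).
Proof. by move=> v Jv; rewrite root_sym Jv inner0r. Qed.

Lemma eigenbasis_system : orthonormal_system e.
Proof. exact: basis_system be.1. Qed.

Lemma eigenbasis_cvg z : K z -> proj e n z @[n --> \oo] --> z.
Proof. by rewrite /K kernel_root; have [[_ _ _ +] _] := be; exact. Qed.

Lemma eigenbasis_compl i : K (e i).
Proof. by rewrite /K kernel_root; have [[_ _ + _] _] := be; exact. Qed.

Lemma compl_ext z z' : K z -> K z' -> J z = J z' -> z = z'.
Proof.
move=> Kz Kz' zz'; apply/subr0_eq; apply: (@orthogonal_compl_inter _ _ (kernel J)).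
  by rewrite /kernel/= (linear_mapB root_linear) zz' subrr.
by rewrite addrC -scaleN1r; exact: orthogonal_compl_linear.
Qed.

(** The orthogonal projection onto the orthogonal of the kernel of Q, which the eigenbasis spans. *)
Definition range_proj x : X := limn (proj e ^~ x).

Lemma range_proj_cvg x : proj e n x @[n --> \oo] --> range_proj x.
Proof. by apply: cvgn_proj; exact: eigenbasis_system. Qed.

Lemma proj_compl n x : K (proj e n x).
Proof.
rewrite /proj; elim: n => [|n IH]; first by rewrite big_ord0 => v _; rewrite inner0l.
rewrite big_ord_recr/= addrC; apply: orthogonal_compl_linear => //.
exact: eigenbasis_compl.
Qed.

Lemma range_proj_compl x : K (range_proj x).
Proof.
exact: (orthogonal_compl_cvg (fun n => @proj_compl n x) (@range_proj_cvg x)).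
Qed.

Lemma range_proj_inner x z : K z -> inner (range_proj x) z = inner x z.
Proof.
move=> Kz.
have zx : inner (range_proj x) (proj e n z) @[n --> \oo] --> inner (range_proj x) z.
  by apply: cvg_innerr; exact: eigenbasis_cvg.
rewrite -(cvg_lim (@Rhausdorff R) zx); apply: (cvg_lim (@Rhausdorff R)).
rewrite (_ : (fun n => _) = (fun n => inner x (proj e n z))).
  by apply: cvg_innerr; exact: eigenbasis_cvg.
apply/funext => n; rewrite -!inner_proj_sym !inner_projl; apply: eq_bigr => i _.
by rewrite /range_proj inner_lim_proj//; exact: eigenbasis_system.
Qed.

Lemma root_range_proj x : J (range_proj x) = J x.
Proof.
apply/subr0_eq; rewrite -(linear_mapB root_linear).
apply: inner_ext => y; rewrite root_sym inner0l innerBl range_proj_inner ?subrr//.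
exact: root_compl.
Qed.

Lemma pinv_root z : K z -> pinv J (J z) = z.
Proof.
rewrite /pinv => Kz; case: xgetP => [y _ [Ky Jy]|/(_ z) []//].
exact: compl_ext.
Qed.

Lemma pinv_root_proj x : pinv J (J x) = range_proj x.
Proof. by rewrite -root_range_proj pinv_root//; exact: range_proj_compl. Qed.

Lemma pinv_cov x : pinv J (Q x) = J x.
Proof. by rewrite -root_square pinv_root//; exact: root_compl. Qed.

Lemma carrier_root x : carrier H (J x).
Proof. by exists x. Qed.

Lemma carrier_cov x : carrier H (Q x).
Proof. by rewrite -root_square; exact: carrier_root. Qed.

Lemma pinv_compl h : carrier H h -> K (pinv J h).
Proof. by move=> [x _ <-]; rewrite pinv_root_proj; exact: range_proj_compl. Qed.

Lemma root_pinv h : carrier H h -> J (pinv J h) = h.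
Proof. by move=> [x _ <-]; rewrite pinv_root_proj root_range_proj. Qed.

Lemma carrier_linear a h k : carrier H h -> carrier H k -> carrier H (a *: h + k).
Proof.
move=> [x _ <-] [y _ <-]; exists (a *: x + y) => //.
by rewrite -/J root_linear.
Qed.

Lemma pinv_linear a h k : carrier H h -> carrier H k ->
  pinv J (a *: h + k) = a *: pinv J h + pinv J k.
Proof.
move=> Hh Hk; apply: compl_ext.
- by apply: pinv_compl; exact: carrier_linear.
- by apply: orthogonal_compl_linear; exact: pinv_compl.
- by rewrite root_linear !root_pinv//; exact: carrier_linear.
Qed.

Lemma ipnorm_cm h : ipnorm H h = `|pinv J h|.
Proof. by rewrite /ipnorm/= inner_norm sqrtr_sqr normr_id. Qed.

(** Reproducing property: it translates inner products of X into inner products of H, and back. *)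
Lemma ip_cov h x : carrier H h -> ip H h (Q x) = inner h x.
Proof. by move=> Hh /=; rewrite -/J pinv_cov -root_sym root_pinv. Qed.

Lemma ip_root h z : carrier H h -> K z -> ip H h (J z) = inner (pinv J h) z.
Proof. by move=> Hh Kz /=; rewrite -/J pinv_root. Qed.

Lemma ip_ext g g' : carrier H g -> carrier H g' ->
  (forall h, carrier H h -> ip H h g = ip H h g') -> g = g'.
Proof.
move=> Hg Hg' gg'; apply: inner_ext => x.
rewrite -!ip_cov// /= -/J !(innerC _ (pinv J (Q x))).
exact/gg'/carrier_cov.
Qed.

(** The eigenvalue of e_i as a Rayleigh quotient; it vanishes at the padding vectors, and only there
    by [eigenvalue_eq0]. *)
Let lam i := inner (Q (e i)) (e i).

Lemma eigenvalue_ge0 i : 0 <= lam i.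
Proof. by rewrite /lam -root_norm sqr_ge0. Qed.

Lemma eigenvector i : Q (e i) = lam i *: e i.
Proof.
have [_ /(_ i) [l Ql]] := be; rewrite /lam Ql innerZl.
by rewrite -scalerA orthonormal_scale//; exact: eigenbasis_system.
Qed.

Lemma eigenvalue_eq0 i : lam i = 0 -> e i = 0.
Proof.
move=> l0; apply: (@orthogonal_compl_inter _ _ (kernel J)).
  by rewrite kernel_root /kernel/= eigenvector l0 scale0r.
exact: eigenbasis_compl.
Qed.

(* [(J + r) (J - r) e_i = 0] and [J + r] is injective for [r > 0]. *)
Lemma root_eigenvector i : J (e i) = Num.sqrt (lam i) *: e i.
Proof.
have [/eigenvalue_eq0 ->|l0] := eqVneq (lam i) 0.
  by rewrite scaler0 linear_map0//; exact: root_linear.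
have r0 : 0 < Num.sqrt (lam i) by rewrite sqrtr_gt0 lt0r l0 eigenvalue_ge0.
set r := Num.sqrt (lam i) in r0 *; apply/subr0_eq/inner_eq0.
set y := J (e i) - r *: e i.
have Jy : J y = - (r *: y).
  rewrite /y (linear_mapB root_linear) (linear_mapZ root_linear) root_square.
  rewrite eigenvector scalerBr opprB scalerA -expr2 sqr_sqrtr//.
  exact: eigenvalue_ge0.
have := root_ge0 y; rewrite Jy innerNl innerZl oppr_ge0 pmulr_rle0// => y0.
by apply/eqP; rewrite eq_le y0 inner_ge0.
Qed.

Lemma carrier_eigenbasis i : carrier H (e i).
Proof.
have [/eigenvalue_eq0 ->|l0] := eqVneq (lam i) 0.
  by exists 0 => //; rewrite -/J linear_map0//; exact: root_linear.
exists ((Num.sqrt (lam i))^-1 *: e i) => //.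
rewrite -/J (linear_mapZ root_linear) root_eigenvector scalerA mulVf ?scale1r//.
by rewrite sqrtr_eq0 -ltNge lt0r l0 eigenvalue_ge0.
Qed.

(** The product form avoids dividing by the eigenvalue 0 of a padding vector. *)
Lemma pinv_eigenbasis i : Num.sqrt (lam i) *: pinv J (e i) = e i.
Proof.
apply: compl_ext.
- rewrite -[X in K X]addr0; apply: orthogonal_compl_linear.
    by apply: pinv_compl; exact: carrier_eigenbasis.
  by move=> v _; rewrite inner0l.
- exact: eigenbasis_compl.
rewrite (linear_mapZ root_linear) root_pinv ?root_eigenvector//.
exact: carrier_eigenbasis.
Qed.

Lemma carrier_proj n x : carrier H (proj e n x).
Proof.
rewrite /proj; elim: n => [|n IH].
  by rewrite big_ord0; exists 0 => //; rewrite -/J linear_map0//; exact: root_linear.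
by rewrite big_ord_recr/= addrC; apply: carrier_linear => //; exact: carrier_eigenbasis.
Qed.

Lemma cov_orthosum (a : nat -> R) n :
  inner (Q (\sum_(i < n) a i *: e i)) (\sum_(i < n) a i *: e i) =
  \sum_(i < n) lam i * a i ^+ 2.
Proof.
have [lQ _ _ _] := (nonneg_whole Q).1 nQ.
rewrite (linear_map_sum lQ n (fun i => a i *: e i)).
rewrite (_ : \sum_(i < n) _ = \sum_(i < n) (a i * lam i) *: e i); last first.
  by apply: eq_bigr => i _; rewrite (linear_mapZ lQ) eigenvector scalerA.
transitivity (\sum_(i < n) (a i * lam i) * a i * inner (e i) (e i)).
  exact: (inner_orthosum2 eigenbasis_system (fun i => a i * lam i)).
apply: eq_bigr => i _.
have {2}-> : lam i = lam i * inner (e i) (e i) by rewrite -innerZl -eigenvector.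
by ring.
Qed.

(** D is additive on H only, so every partial sum has to be seen to stay in H. *)
Lemma linear_on_carrier (D : X -> X) n x :
  (forall a h k, carrier H h -> carrier H k -> D (a *: h + k) = a *: D h + D k) ->
  D (proj e n x) = \sum_(i < n) inner x (e i) *: D (e i).
Proof.
move=> lD.
have H0 : carrier H 0 by have := carrier_proj 0 x; rewrite /proj big_ord0.
have D0 : D 0 = 0.
  by have := lD (-1) 0 0 H0 H0; rewrite scaler0 addr0 scaleN1r addNr.
elim: n => [|n IH]; first by rewrite /proj !big_ord0.
rewrite /proj !big_ord_recr/= addrC lD; last exact: carrier_proj.
  by rewrite IH addrC.
exact: carrier_eigenbasis.
Qed.

(* With [w_n] the sum of [<h, e_i> / sqrt lambda_i e_i], one has
   [|w_n|^2 = <h, x_n>] for an [x_n] such that [J x_n = w_n]. *)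
Lemma douglas h c : 0 <= c -> (forall x, inner h x <= c * `|J x|) ->
  carrier H h /\ ipnorm H h <= c.
Proof.
move=> c0 hc.
have hcN x : `|inner h x| <= c * `|J x|.
  rewrite ler_norml hc andbT lerNl -innerNr (le_trans (hc _))//.
  by rewrite -scaleN1r (linear_mapZ root_linear) scaleN1r normrN.
(* The eigenbasis spans only the orthogonal of the kernel; this membership is what lets the
   expansion of h converge to h. *)
have Kh : K h.
  move=> v Jv; apply/eqP; rewrite -normr_eq0 eq_le normr_ge0 andbT.
  by rewrite (le_trans (hcN _))// Jv normr0 mulr0.
pose a i := inner h (e i) / Num.sqrt (lam i).
pose w n := \sum_(i < n) a i *: e i.
pose y n := \sum_(i < n) (a i / Num.sqrt (lam i)) *: e i.
have sE i : (Num.sqrt (lam i))^-1 *: (Num.sqrt (lam i) *: e i) = e i.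
  have [/eigenvalue_eq0 ->|l0] := eqVneq (lam i) 0; first by rewrite !scaler0.
  rewrite scalerA mulVf ?scale1r// sqrtr_eq0 -ltNge lt0r l0.
  exact: eigenvalue_ge0.
have Jy n : J (y n) = w n.
  rewrite /y (linear_map_sum root_linear n
    (fun i => (a i / Num.sqrt (lam i)) *: e i)); apply: eq_bigr => i _.
  by rewrite (linear_mapZ root_linear) root_eigenvector -scalerA sE.
have wc n : `|w n| <= c.
  apply: norm_le_inner => //; rewrite (_ : inner _ _ = inner h (y n)).
    by rewrite -Jy hc.
  transitivity (\sum_(i < n) a i * a i * inner (e i) (e i)).
    exact: (inner_orthosum2 eigenbasis_system).
  rewrite /y innerC inner_suml; apply: eq_bigr => i _; rewrite innerZl /a.
  have -> : inner h (e i) / Num.sqrt (lam i) * (inner h (e i) / Num.sqrt (lam i)) *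
    inner (e i) (e i) = inner h (e i) / Num.sqrt (lam i) / Num.sqrt (lam i) *
    (inner (e i) (e i) * inner h (e i)) by ring.
  by rewrite -[inner (e i) (e i) * _]innerZr orthonormal_scale ?(innerC h)//; exact: eigenbasis_system.
have wl : w n @[n --> \oo] --> limn w.
  exact: (@riesz_fischer _ _ _ eigenbasis_system a _ wc).
have Kw : K (limn w).
  by apply: (orthogonal_compl_cvg _ wl) => n; rewrite -Jy; exact: root_compl.
have Jw : J (limn w) = h.
  have Jwn : J (w n) @[n --> \oo] --> J (limn w).
    exact: (bounded_operator_cvg root_bounded wl).
  rewrite -(cvg_lim (@norm_hausdorff _ _) Jwn); apply: (cvg_lim (@norm_hausdorff _ _)).
  rewrite (_ : (fun n => _) = proj e ^~ h); first exact: eigenbasis_cvg.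
  apply/funext => n; rewrite /w (linear_map_sum root_linear n (fun i => a i *: e i)).
  apply: eq_bigr => i _.
  rewrite (linear_mapZ root_linear) root_eigenvector -scalerA.
  by congr (_ *: _); exact: sE.
split; first by rewrite -Jw; exact: carrier_root.
rewrite ipnorm_cm -Jw pinv_root//.
have : `|w n| @[n --> \oo] --> `|limn w| by exact: cvg_norm.
by move=> /cvgr_to_le; apply; exact: nearW.
Qed.

End CameronMartin.

(** * Contractions between Cameron-Martin spaces and their defect operators *)

Section DominatedCovariances.
Context (R : realType) (X : hilbertType R) (sepX : separable X).
Context (Q1 Q2 : X -> X) (e1 e2 : nat -> X).
Hypotheses (nQ1 : nonneg_operator whole Q1) (be1 : eigenbasis Q1 e1).
Hypotheses (nQ2 : nonneg_operator whole Q2) (be2 : eigenbasis Q2 e2).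
Context (A : X -> X) (bA : bounded_operator A).
Let A' := adjoint whole whole A.
Hypothesis dominated : forall x, inner (Q1 (A' x)) (A' x) <= inner (Q2 x) x.
Implicit Types (x y z h k : X).
Let J1 := sqrt_operator whole Q1.
Let J2 := sqrt_operator whole Q2.
Let H1 := cameron_martin Q1.
Let H2 := cameron_martin Q2.
Let L := adjoint H1 H2 A.

Let lJ1 : linear J1. Proof. exact: root_linear. Qed.
Let lJ2 : linear J2. Proof. exact: root_linear. Qed.

(** <A J1 z, x> = <z, J1 A' x> <= |z| |J1 A' x| <= |z| |J2 x|, the last inequality being
    [dominated]; this is what [douglas] asks for. *)
Lemma dominated_douglas z : carrier H2 (A (J1 z)) /\ ipnorm H2 (A (J1 z)) <= `|z|.
Proof.
apply: (douglas nQ2 be2) => // x.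
rewrite inner_adjoint// -/A' /J1 root_sym// (le_trans (ler_inner _ _))//.
rewrite ler_wpM2l// -(@ler_pXn2r _ 2) ?nnegrE// !root_norm//.
Qed.

Lemma dominated_carrier h : carrier H1 h -> carrier H2 (A h).
Proof. by move=> [z _ <-]; have [] := dominated_douglas z. Qed.

Lemma dominated_operator_le : operator_le 1 H1 H2 A.
Proof.
split=> [h|a h k _ _|h Hh]; [exact: dominated_carrier|exact: bA.1|].
rewrite mul1r -[in leLHS](root_pinv nQ1 be1 Hh) (le_trans (dominated_douglas _).2)//.
by rewrite /H1 ipnorm_cm.
Qed.

(* The contraction of [X] that corresponds to [A] under the isometries [J1], [J2]. *)
Let C z := pinv J2 (A (J1 z)).

Let C_linear : linear C.
Proof.
move=> a x y; rewrite /C lJ1 bA.1 (pinv_linear nQ2 be2)//;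
  by have [] := dominated_douglas x; have [] := dominated_douglas y.
Qed.

Let C_norm z : `|C z| <= 1 * `|z|.
Proof. by rewrite mul1r /C -ipnorm_cm; have [] := dominated_douglas z. Qed.

Let C_bounded : bounded_operator C.
Proof. exact: linear_bounded_operator C_linear C_norm. Qed.

Let C_compl z : orthogonal_compl (kernel J2) (C z).
Proof. by apply: (pinv_compl nQ2 be2); have [] := dominated_douglas z. Qed.

Let C' := adjoint whole whole C.

Let C'_norm z : `|C' z| <= `|z|.
Proof. by rewrite -[leRHS]mul1r; apply: adjoint_norm. Qed.

Let C'_linear : linear C'.
Proof. exact: adjoint_linear. Qed.

Let C'_compl z : orthogonal_compl (kernel J1) (C' z).
Proof.
move=> v Jv; rewrite innerC -inner_adjoint// /C Jv (linear_map0 bA.1).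
suff -> : pinv J2 0 = 0 by rewrite inner0l.
have J20 : J2 0 = 0 by rewrite linear_map0.
by rewrite -[in LHS]J20 (pinv_root nQ2)// => w _; rewrite inner0l.
Qed.

Let J2C z : J2 (C z) = A (J1 z).
Proof. by apply: (root_pinv nQ2 be2); have [] := dominated_douglas z. Qed.

Let C_pinv h : carrier H1 h -> C (pinv J1 h) = pinv J2 (A h).
Proof. by move=> Hh; rewrite /C /J1 (root_pinv nQ1 be1). Qed.

(** Under the isometries [pinv J1] and [pinv J2] the operator A becomes C, hence its adjoint becomes
    C'. This exhibits a vector that meets the condition in [adjoint], and [ip_ext] identifies it
    with the chosen one. *)
Lemma dominated_adjointE k : carrier H2 k -> L k = J1 (C' (pinv J2 k)).
Proof.
move=> Hk.
have adjC h : carrier H1 h -> ip H2 (A h) k = ip H1 h (J1 (C' (pinv J2 k))).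
  move=> Hh; rewrite (ip_root nQ1)// -inner_adjoint//.
  by rewrite C_pinv.
rewrite /L /adjoint; case: xgetP => [g _ [Hg gE]|/(_ (J1 (C' (pinv J2 k))))[]].
  apply: (ip_ext nQ1 be1) => //; first exact: carrier_root.
  by move=> h Hh; rewrite -gE// adjC.
split; first exact: carrier_root.
exact: adjC.
Qed.

Lemma dominated_is_adjoint : is_adjoint H1 H2 A L.
Proof.
split=> [k Hk|h k Hh Hk]; rewrite dominated_adjointE//; first exact: carrier_root.
rewrite (ip_root nQ1)// -inner_adjoint//.
by rewrite C_pinv.
Qed.

Lemma dominated_adjoint_le : operator_le 1 H2 H1 L.
Proof.
split=> [k|a h k Hh Hk|k Hk]; first exact: dominated_is_adjoint.1.
  rewrite !dominated_adjointE//; last exact: carrier_linear.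
  by rewrite (pinv_linear nQ2 be2)// C'_linear lJ1.
rewrite dominated_adjointE// mul1r /H1 /H2 !ipnorm_cm.
by rewrite (pinv_root nQ1)//; exact: C'_norm.
Qed.

Lemma adjoint_dominated h : carrier H1 h -> adjoint H2 H1 L h = A h.
Proof.
move=> Hh; have [LH LE] := dominated_is_adjoint.
have adjL k : carrier H2 k -> ip H1 (L k) h = ip H2 k (A h).
  by move=> Hk; rewrite /= innerC [RHS]innerC; have /= <- := LE h k Hh Hk.
rewrite /adjoint; case: xgetP => [g _ [Hg gE]|/(_ (A h))[]].
  apply: (ip_ext nQ2 be2) => //; first exact: dominated_carrier.
  by move=> k Hk; rewrite -gE// adjL.
by split; [exact: dominated_carrier|exact: adjL].
Qed.

(** Paired with h in H1, both sides give <A h, x>, by the reproducing property in H1 and in H2. *)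
Lemma adjoint_cov x : L (Q2 x) = Q1 (A' x).
Proof.
apply: (ip_ext nQ1 be1).
- by apply: dominated_is_adjoint.1; exact: carrier_cov.
- exact: carrier_cov.
move=> h Hh; rewrite -dominated_is_adjoint.2//; last exact: carrier_cov.
rewrite (ip_cov nQ1 be1)// (ip_cov nQ2 be2); last exact: dominated_carrier.
exact: inner_adjoint.
Qed.

Let D := defect H2 H1 L.

(** Transported to X, I - A L is I - C C', and [contraction_half_square] with B = C C' yields its
    root I - Y. Carrying this root back through J2 requires that Y preserve the orthogonal of
    [kernel J2]. *)
Lemma defectP : nonneg_operator H2 D /\
  forall h, carrier H2 h -> D (D h) = h - A (L h).
Proof.
suff [D0 [nD0 D0E]] : exists D0, nonneg_operator H2 D0 /\
    forall h, carrier H2 h -> D0 (D0 h) = h - A (L h).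
  have LH := dominated_is_adjoint.1.
  rewrite /D /defect /sqrt_operator.
  case: xgetP => [S _ [nS SE]|/(_ D0)[]].
    by split=> // h Hh; rewrite SE// adjoint_dominated//; exact: LH.
  split=> // h Hh; rewrite D0E// adjoint_dominated//; exact: LH.
have BL : linear (C \o C') by exact: linear_comp.
have [Y [lY Y1 sY YY]] : exists Y : X -> X, [/\ linear Y, forall x, `|Y x| <= `|x|,
    forall x y, inner (Y x) y = inner x (Y y)
    & forall x, 2 *: Y x = C (C' x) + Y (Y x)].
  apply: (contraction_half_square BL) => [x|x y] /=.
    by rewrite (le_trans (C_norm _))// mul1r.
  by rewrite inner_adjoint// -/C' innerC -inner_adjoint// innerC.
(* If J2 v = 0 then C' v = 0, so 2 Y v = Y (Y v); since Y is a contraction, Y v = 0, and the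
   symmetry of Y concludes. *)
have YK z : orthogonal_compl (kernel J2) (Y z).
  move=> v Jv; rewrite sY; suff -> : Y v = 0 by rewrite inner0r.
  have C'v : C' v = 0.
    apply: inner_eq0; rewrite -inner_adjoint//; exact: C_compl.
  have : 2 *: Y v = Y (Y v) by rewrite YY C'v (linear_map0 C_linear) add0r.
  move=> /(congr1 Num.norm); rewrite normrZ ger0_norm// => Yv.
  apply/eqP; rewrite -normr_eq0 eq_le normr_ge0 andbT.
  have := Y1 (Y v); rewrite -Yv; lra.
have IK z : orthogonal_compl (kernel J2) z -> orthogonal_compl (kernel J2) (z - Y z).
  by move=> Kz; rewrite addrC -scaleN1r; exact: orthogonal_compl_linear.
pose S h := J2 (pinv J2 h - Y (pinv J2 h)).
have pS h : carrier H2 h -> pinv J2 (S h) = pinv J2 h - Y (pinv J2 h).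
  by move=> Hh; rewrite (pinv_root nQ2)//; exact/IK/(pinv_compl nQ2 be2).
have /nonneg_whole[lI [M M0 IM] sI pI] := nonneg_sub_contraction lY Y1 sY.
exists S; split; last first.
  move=> h Hh; rewrite {1}/S pS// -[X in _ = X - _](root_pinv nQ2 be2 Hh).
  rewrite dominated_adjointE// -J2C -(linear_mapB lJ2).
  congr (J2 _); rewrite (linear_mapB lY) opprB.
  set w := pinv _ h.
  have -> : C (C' w) = 2 *: Y w - Y (Y w) by rewrite YY addrK.
  by rewrite scaler_nat mulr2n opprB -!addrA; congr (_ + _);
    rewrite [in LHS]addrC -!addrA opprD addrCA.
split.
- exists M; split=> [h Hh|a h k Hh Hk|h Hh]; first exact: carrier_root.
    by rewrite /S (pinv_linear nQ2 be2)// lI lJ2.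
  by rewrite /H2 !ipnorm_cm pS// IM.
- by move=> h k Hh Hk; rewrite /= !pS// sI.
- by move=> h Hh; rewrite /= pS// pI.
Qed.

(** The limit is the squared H2-norm of g = D Q2 x, because D D Q2 x = Q2 x - A Q1 A' x. By the
    reproducing property and the symmetry of D, <D e_i, x> is the H2-product of e_i and g, so the
    i-th term is the square of the i-th coordinate of [pinv J2 g], and the series is Parseval's. *)
Lemma defect_variance x :
  \sum_(i < n) inner (Q2 (e2 i)) (e2 i) * inner (D (e2 i)) x ^+ 2 @[n --> \oo] -->
  inner (Q2 x) x - inner (Q1 (A' x)) (A' x).
Proof.
have [[[M [DH _ _]] sD _] DD] := defectP.
have HQ : carrier H2 (Q2 x) by exact: carrier_cov.
set g := D (Q2 x); have Hg : carrier H2 g by exact: DH.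
have -> : inner (Q2 x) x - inner (Q1 (A' x)) (A' x) = inner (pinv J2 g) (pinv J2 g).
  transitivity (ip H2 (D (D (Q2 x))) (Q2 x)); last by rewrite sD//; exact: DH.
  rewrite (ip_cov nQ2 be2); last exact: (DH _ (DH _ HQ)).
  by rewrite DD// innerBl adjoint_cov (inner_adjoint sepX _ _ bA).
rewrite (_ : (fun n => _) = (fun n => inner (proj e2 n (pinv J2 g)) (pinv J2 g))).
  by apply: cvg_innerl; apply: (eigenbasis_cvg nQ2 be2); exact: (pinv_compl nQ2 be2).
apply/funext => n; rewrite inner_projl; apply: eq_bigr => i _.
have He : carrier H2 (e2 i) by exact: carrier_eigenbasis.
have -> : inner (D (e2 i)) x = inner (pinv J2 (e2 i)) (pinv J2 g).
  transitivity (ip H2 (D (e2 i)) (Q2 x)); last by rewrite sD.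
  by rewrite (ip_cov nQ2 be2)//; exact: DH.
have -> : inner (pinv J2 g) (e2 i) =
    Num.sqrt (inner (Q2 (e2 i)) (e2 i)) * inner (pinv J2 (e2 i)) (pinv J2 g).
  by rewrite -innerZl innerC (pinv_eigenbasis nQ2 be2).
rewrite [RHS]mulrACA -!expr2 sqr_sqrtr//.
by have [_ _ _] := (nonneg_whole Q2).1 nQ2; exact.
Qed.

End DominatedCovariances.

(** * Integrals of bounded functions *)

Section BoundedMeasurable.
Context d (T : measurableType d) (R : realType).
Implicit Types (f g : T -> R) (P : probability T R).

Definition bounded_measurable f : Prop :=
  measurable_fun setT f /\ exists M, forall x, `|f x| <= M.

Lemma bounded_measurable_cst (c : R) : bounded_measurable (fun=> c).
Proof. by split; [exact: measurable_cst|exists `|c|]. Qed.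

Lemma bounded_measurableM f g : bounded_measurable f -> bounded_measurable g ->
  bounded_measurable (fun x => f x * g x).
Proof.
move=> [mf [M fM]] [mg [N gN]]; split; first exact: measurable_funM.
by exists (M * N) => x; rewrite normrM ler_pM.
Qed.

Lemma bounded_measurableB f g : bounded_measurable f -> bounded_measurable g ->
  bounded_measurable (fun x => f x - g x).
Proof.
move=> [mf [M fM]] [mg [N gN]]; split; first exact: measurable_funB.
by exists (M + N) => x; rewrite (le_trans (ler_normB _ _))// lerD.
Qed.

Lemma bounded_measurable_cos f : measurable_fun setT f ->
  bounded_measurable (fun x => cos (f x)).
Proof.
move=> mf; split; last by exists 1 => x; exact: cos_max.
by apply: measurableT_comp => //; apply: continuous_measurable_fun; exact: continuous_cos.
Qed.

Lemma bounded_measurable_sin f : measurable_fun setT f ->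
  bounded_measurable (fun x => sin (f x)).
Proof.
move=> mf; split; last by exists 1 => x; exact: sin_max.
by apply: measurableT_comp => //; apply: continuous_measurable_fun; exact: continuous_sin.
Qed.

Lemma bounded_measurable_integrable P f : bounded_measurable f ->
  P.-integrable setT (EFin \o f).
Proof.
move=> [mf [M fM]]; apply: measurable_bounded_integrable => //.
  by rewrite (le_lt_trans (probability_le1 P measurableT))// ltry.
exists M; split; first exact: num_real.
by move=> N MN x _ /=; rewrite (le_trans (fM x))// ltW.
Qed.

Lemma integral_bm P f : bounded_measurable f ->
  (\int[P]_x f x)%:E = (\int[P]_x (f x)%:E)%E.
Proof.
move=> bf; rewrite /Rintegral fineK//.
by apply: integrable_fin_num => //; exact: bounded_measurable_integrable.
Qed.

Lemma Rintegral_bmB P f g : bounded_measurable f -> bounded_measurable g ->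
  \int[P]_x (f x - g x) = \int[P]_x f x - \int[P]_x g x.
Proof. by move=> bf bg; rewrite RintegralB//; exact: bounded_measurable_integrable. Qed.

Lemma Rintegral_bmZ P (c : R) f : bounded_measurable f ->
  \int[P]_x (c * f x) = c * \int[P]_x f x.
Proof. by move=> bf; rewrite RintegralZl//; exact: bounded_measurable_integrable. Qed.

Lemma Rintegral_cst1 P (c : R) : \int[P]_x c = c.
Proof.
rewrite Rintegral_cst// [X in fine X](_ : _ = 1%E) ?mulr1//.
exact: probability_setT.
Qed.

Lemma bounded_cvg P (u : nat -> T -> R) f (M : R) :
  (forall n, measurable_fun setT (u n)) -> (forall n x, `|u n x| <= M) ->
  (forall x, u n x @[n --> \oo] --> f x) ->
  \int[P]_x u n x @[n --> \oo] --> \int[P]_x f x.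
Proof.
move=> mu uM uf.
have mf : measurable_fun setT f by apply: (measurable_fun_cvg mu) => x _; exact: uf.
have bu n : bounded_measurable (u n) by split=> //; exists M.
have bf : bounded_measurable f.
  split=> //; exists M => x.
  have /cvg_norm : u n x @[n --> \oo] --> f x by exact: uf.
  by move=> /cvgr_to_le; apply; apply: nearW => n.
have [|||||_ _ ufP] := @dominated_convergence _ T R P setT measurableT
  (fun n x => (u n x)%:E) (EFin \o f) (fun=> M%:E).
- by move=> n; exact/measurable_EFinP.
- exact/measurable_EFinP.
- by apply: aeW => x _; exact/cvg_EFin/uf/nearW.
- exact: (bounded_measurable_integrable P (bounded_measurable_cst M)).
- by apply: aeW => x n _; rewrite lee_fin.
apply: fine_cvg; rewrite integral_bm//; exact: ufP.
Qed.

End BoundedMeasurable.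

Section BoundedFubini.
Context d1 d2 (T1 : measurableType d1) (T2 : measurableType d2) (R : realType).
Context (P1 : probability T1 R) (P2 : probability T2 R).

Lemma bounded_measurable_pair1 (f : T1 * T2 -> R) x : bounded_measurable f ->
  bounded_measurable (fun y => f (x, y)).
Proof.
move=> [mf [M fM]]; split; last by exists M => y; exact: fM.
exact: measurable_fun_pair2.
Qed.

Lemma bounded_measurable_pair2 (f : T1 * T2 -> R) y : bounded_measurable f ->
  bounded_measurable (fun x => f (x, y)).
Proof.
move=> [mf [M fM]]; split; last by exists M => x; exact: fM.
exact: measurable_fun_pair1.
Qed.

Lemma bounded_fubini (f : T1 * T2 -> R) : bounded_measurable f ->
  \int[P1]_x \int[P2]_y f (x, y) = \int[P2]_y \int[P1]_x f (x, y).
Proof.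
move=> bf.
have fi : (P1 \x P2)%E.-integrable setT (EFin \o f).
  exact: (@bounded_measurable_integrable _ _ _ (P1 \x P2)%E f bf).
have := Fubini fi; rewrite /Rintegral => F.
rewrite (eq_integral (fun x => \int[P2]_y (EFin \o f) (x, y))%E).
  rewrite F; congr fine; apply: eq_integral => y _.
  by rewrite -integral_bm//; exact: bounded_measurable_pair2.
by move=> x _; rewrite -integral_bm//; exact: bounded_measurable_pair1.
Qed.

Lemma Rintegral_prod (f : T1 * T2 -> R) : bounded_measurable f ->
  \int[(P1 \x P2)%E]_z f z = \int[P1]_x \int[P2]_y f (x, y).
Proof.
move=> bf.
have fi : (P1 \x P2)%E.-integrable setT (EFin \o f).
  exact: (@bounded_measurable_integrable _ _ _ (P1 \x P2)%E f bf).
rewrite /Rintegral -(integral12_prod_meas1 fi); congr fine.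
apply: eq_integral => x _; rewrite /fubini_F -integral_bm//.
exact: bounded_measurable_pair1.
Qed.

End BoundedFubini.

(** * Borel sets and characteristic functions *)

Section BorelSets.
Context (R : realType) (X : hilbertType R).
Implicit Types (h k x : X) (c r : R).

Lemma continuous_borel (f : X -> R) : continuous f ->
  measurable_fun setT (f : borel X -> R).
Proof.
move=> cf; apply: (measurability _ (RGenOpens.measurableE R)).
move=> _ [_ [a [b ->] <-]]; rewrite setTI.
by apply: sub_sigma_algebra; apply: open_comp.
Qed.

Lemma continuous_borel_borel (A : X -> X) : continuous A ->
  measurable_fun setT (A : borel X -> borel X).
Proof.
move=> cA; apply: (@measurability _ _ _ (borel X) _ _ (@open X)) => //.
move=> _ [U oU <-]; rewrite setTI.
by apply: sub_sigma_algebra; apply: open_comp => // x _; exact: cA.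
Qed.

Lemma measurable_inner h : measurable_fun setT (fun x : borel X => inner x h).
Proof. by apply: continuous_borel; exact: continuous_innerl. Qed.

(* Level sets of these functions are slabs orthogonal to [k]. *)
Definition gauss_factor k c x : R := expR (- ((inner x k - c) ^+ 2 / 2)).

Definition slab k c : set X := [set x | 2^-1 <= gauss_factor k c x].

Definition slabs : set (set X) := [set A | exists k c, A = slab k c].

Lemma measurable_gauss_factor k c :
  measurable_fun setT (gauss_factor k c : borel X -> R).
Proof.
apply: measurableT_comp => //; apply: measurableT_comp => //.
apply: measurable_funM => //; apply: measurable_funX.
by apply: measurable_funB => //; exact: measurable_inner.
Qed.

Lemma gauss_factor_itv k c x : 0 < gauss_factor k c x <= 1.
Proof.
by rewrite expR_gt0/= -expR0 ler_expR oppr_le0 divr_ge0 ?sqr_ge0.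
Qed.

Lemma slab_inner h c r : 0 < r ->
  exists k c', [set x | `|inner x h - c| <= r] = slab k c'.
Proof.
(* exp(- u^2 / 2) >= 1/2 exactly when |u| <= K; scaling by K / r turns a slab of half-width r into a
   level set of [gauss_factor]. *)
move=> r0; pose K := Num.sqrt (2 * ln 2) : R.
have ln2 : 0 < ln 2 :> R by rewrite ln_gt0// ltr1n.
have K0 : 0 < K by rewrite sqrtr_gt0 mulr_gt0.
exists ((K / r) *: h), (K / r * c); apply/seteqP.
suff E x : (`|inner x h - c| <= r) = (2^-1 <= gauss_factor ((K / r) *: h) (K / r * c) x).
  by split=> x /=; rewrite E.
have -> : 2^-1 = expR (- ln 2) :> R by rewrite expRN lnK// posrE.
rewrite ler_expR lerN2 innerZr -mulrBr exprMn ler_pdivrMr// mulrC.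
set u := inner x h - c.
have -> : (`|u| <= r) = (u ^+ 2 <= r ^+ 2).
  by rewrite -[LHS](@ler_pXn2r _ 2) ?nnegrE ?(ltW r0)// real_normK ?num_real.
rewrite exprMn sqr_sqrtr ?mulr_ge0 ?(ltW ln2)// exprVn.
have r20 : 0 < r ^+ 2 by rewrite exprn_gt0.
rewrite mulrA ler_pdivrMr// [2 * ln 2]mulrC [in RHS]mulrC.
by rewrite ler_pM2l ?mulr_gt0.
Qed.

End BorelSets.

Section BorelSlabs.
Context (R : realType) (X : hilbertType R) (sepX : separable X).

(** The norm is tested against countably many vectors, so that a closed ball becomes a countable
    intersection of slabs. *)
Lemma norm_le_dense (d : nat -> X) (x : X) (r : R) :
  (forall y (e : R), 0 < e -> exists n, `|y - d n| < e) -> 0 <= r ->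
  (`|x| <= r) <-> (forall n, `|inner x (d n)| <= r * `|d n|).
Proof.
move=> dd r0; split=> [xr n|xd].
  by rewrite (le_trans (cauchy_schwarz _ _))// ler_wpM2r.
apply/ler_addgt0Pr => e e0.
have [x0|x0] := eqVneq x 0; first by rewrite x0 normr0 addr_ge0// ltW.
have xp : 0 < `|x| by rewrite normr_gt0.
(* Writing x = (x - d n) + d n in <x, x> gives |x|^2 <= r |x| + s (r + |x|), and this s makes the
   last term at most e |x|. *)
pose s := e * `|x| / (r + `|x| + 1).
have s0 : 0 < s by rewrite divr_gt0 ?mulr_gt0// !ltr_wpDl ?addr_ge0.
have [n xn] := dd x s s0.
rewrite -(ler_pM2r xp) -expr2 -inner_norm -[x in inner _ x](subrK (d n)) innerDr.
have h1 := ler_inner x (x - d n).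
have h2 := le_trans (ler_norm _) (xd n).
have h3 : `|d n| <= `|x| + s.
  rewrite -[d n](subrK x) addrC (le_trans (ler_normD _ _))// lerD2l distrC.
  exact: ltW.
have h4 : s * (r + `|x| + 1) = e * `|x|.
  by rewrite /s divfK// gt_eqF// !ltr_wpDl ?addr_ge0.
have h5 : `|x| * `|x - d n| <= `|x| * s by rewrite ler_wpM2l// ltW.
have h6 : r * `|d n| <= r * (`|x| + s) by rewrite ler_wpM2l.
nra.
Qed.

(** An open set is the union of the closed balls it contains with centre in a dense sequence and
    radius 1/(m+1), and each such ball is a countable intersection of slabs. *)
Lemma open_sub_slabs : @open X `<=` <<s @slabs R X >>.
Proof.
have [d dd] := separable_enum sepX.
pose S := g_sigma_algebraType (@slabs R X).
have mball (a : X) (r : R) : 0 < r ->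
    @measurable _ S [set x | `|x - a| <= r].
  move=> r0.
  have -> : [set x | `|x - a| <= r] =
      \bigcap_n [set x | `|inner x (d n) - inner a (d n)| <= r * `|d n| ].
    apply/seteqP; split=> x /=.
      by move=> /(norm_le_dense _ dd (ltW r0)) xa n _ /=; rewrite -innerBl.
    move=> xa; apply/(norm_le_dense _ dd (ltW r0)) => n.
    by rewrite innerBl; exact: xa.
  apply: bigcapT_measurable => n.
  (* For d n = 0 the half-width is 0, which [slab_inner] excludes; the condition is then vacuous. *)
  have [->|d0] := eqVneq (d n) 0.
    rewrite (_ : [set _ | _] = setT)//; apply/seteqP; split=> // x _ /=.
    by rewrite !inner0r subrr !normr0 mulr0.
  have [|k [c ->]] := @slab_inner R X (d n) (inner a (d n)) (r * `|d n|).
    by rewrite mulr_gt0 ?normr_gt0.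
  by apply: sub_sigma_algebra; exists k, c.
move=> U oU.
pose B (n m : nat) := [set x | `|x - d n| <= (m.+1%:R^-1 : R)].
have -> : U = \bigcup_n \bigcup_(m in [set m | B n m `<=` U]) B n m.
  apply/seteqP; split=> [x Ux|x [n _ [m BU]]]; last exact: BU.
  have /nbhs_ballP[e /= e0 xe] : nbhs x U by exact: open_nbhs_nbhs.
  have [m me] : exists m, (m.+1%:R^-1 : R) < e / 2.
    by have [m _ /(_ m (leqnn m)) me] :=
      near_infty_natSinv_lt (PosNum (divr_gt0 e0 (ltr0Sn R 1))); exists m.
  have m0 : 0 < (m.+1%:R^-1 : R) by rewrite invr_gt0 ltr0Sn.
  have [n xn] := dd x _ m0.
  exists n => //; exists m => //=; last by rewrite /B/= ltW.
  move=> y; rewrite /B/= => yn; apply: xe; rewrite -ball_normE/=.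
  rewrite (_ : x - y = (x - d n) - (y - d n)); last first.
    by rewrite opprB addrA subrK.
  rewrite (le_lt_trans (ler_normB _ _))// [ltRHS]splitr.
  exact: ltrD (lt_trans xn me) (le_lt_trans yn me).
suff : @measurable _ S (\bigcup_n \bigcup_(m in [set m | B n m `<=` U]) B n m) by [].
apply: bigcupT_measurable => n; apply: bigcup_measurable => m _.
by apply: mball; rewrite invr_gt0 ltr0Sn.
Qed.

Lemma measurable_slab (k : X) c : measurable (slab k c : set (borel X)).
Proof.
rewrite (_ : slab k c = (gauss_factor k c) @^-1` `[2^-1, +oo[).
  by rewrite -[_ @^-1` _]setTI; exact: measurable_gauss_factor.
by apply/seteqP; split=> x; rewrite /slab/= in_itv/= andbT.
Qed.

Lemma borel_slabsE : @measurable _ (borel X) = <<s @slabs R X >>.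
Proof.
apply/seteqP; split.
  by apply: smallest_sub; [exact: smallest_sigma_algebra|exact: open_sub_slabs].
apply: smallest_sub; first exact: sigma_algebra_measurable.
by move=> _ [k [c ->]]; exact: measurable_slab.
Qed.

(** Weak measurability implies Borel measurability (Pettis), since slabs generate the Borel sets and
    involve one scalar product each. *)
Lemma measurable_to_borel d (T : measurableType d) (f : T -> borel X) :
  (forall h, measurable_fun setT (fun t => inner (f t) h)) ->
  measurable_fun setT f.
Proof.
move=> mf; apply: (measurability _ borel_slabsE) => _ [_ [k [c ->]] <-].
rewrite setTI.
have -> : f @^-1` slab k c =
    [set: T] `&` (fun t => gauss_factor k c (f t)) @^-1` `[2^-1, +oo[.
  by rewrite setTI; apply/seteqP; split=> x; rewrite /slab/= in_itv/= andbT.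
suff : measurable_fun setT (fun t => gauss_factor k c (f t)) by apply.
rewrite (_ : (fun t => _) =
  expR \o (-%R \o (fun t => (inner (f t) k - c) ^+ 2 / 2)))//.
apply: (@measurableT_comp _ _ _ _ _ _ expR); first by [].
apply: (@measurableT_comp _ _ _ _ _ _ (-%R : R -> R)) => //.
by apply: measurable_funM => //; apply: measurable_funX; exact: measurable_funB.
Qed.

Lemma measurable_borelD d (T : measurableType d) (f g : T -> borel X) :
  measurable_fun setT f -> measurable_fun setT g ->
  measurable_fun setT (fun t => (f t + g t : X) : borel X).
Proof.
move=> mf mg; apply: measurable_to_borel => h.
under eq_fun do rewrite innerDl.
by apply: measurable_funD; apply: (measurableT_comp (@measurable_inner R X h)).
Qed.

Lemma measurable_norm d (T : measurableType d) (f : T -> borel X) :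
  measurable_fun setT f -> measurable_fun setT (fun t => `|f t : X|).
Proof.
move=> mf; apply: (@measurableT_comp _ _ _ _ _ _ (fun x : borel X => `|x : X|)) => //.
by apply: continuous_borel; exact: norm_continuous.
Qed.

End BorelSlabs.

Section RankOne.
Context (R : realType) (X : hilbertType R).

(** The basis that [trace] selects, named so that Bessel's and Parseval's estimates can be applied
    to the very same vectors. *)
Definition trace_basis : nat -> X := xget (fun=> 0) (orthonormal_basis setT).

Lemma trace_basis_system : orthonormal_system trace_basis.
Proof.
rewrite /trace_basis; case: xgetP => [e _ be|_]; first exact: basis_system be.
by split=> [i j _|i]; [rewrite inner0l|left].
Qed.

Lemma trace_basisP : separable X -> orthonormal_basis setT trace_basis.
Proof.
move=> /orthonormal_basis_exists[f0 bf0].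
by rewrite /trace_basis; case: xgetP => [f _ bf|/(_ f0)].
Qed.

Lemma trace_le (Q : X -> X) (C : R) : (forall x, 0 <= inner (Q x) x) ->
  (forall n, \sum_(i < n) inner (Q (trace_basis i)) (trace_basis i) <= C) ->
  (trace Q <= C%:E)%E.
Proof.
move=> Q0 QC; apply: lime_le.
  by apply: is_cvg_nneseries => n _ _; rewrite lee_fin.
by apply: nearW => n; rewrite sumEFin lee_fin big_mkord; exact: QC.
Qed.

Lemma sum_le_trace (Q : X -> X) n : (forall x, 0 <= inner (Q x) x) ->
  ((\sum_(i < n) inner (Q (trace_basis i)) (trace_basis i))%:E <= trace Q)%E.
Proof.
move=> Q0; rewrite -sumEFin.
rewrite -(big_mkord xpredT (fun i => (inner (Q (trace_basis i)) (trace_basis i))%:E)).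
by apply: nneseries_lim_ge => i _ _; rewrite lee_fin.
Qed.

Lemma rank_one_covariance (k : X) :
  covariance_operator (fun z : X => inner z k *: k).
Proof.
split.
  apply/nonneg_whole; split=> [a x y||x y|x].
  - by rewrite inner_linear scalerDl scalerA.
  - exists (`|k| ^+ 2) => [|x]; first exact: sqr_ge0.
    rewrite normrZ expr2 mulrC -mulrA ler_wpM2l// mulrC.
    exact: cauchy_schwarz.
  - by rewrite innerZl innerZr (innerC k) mulrC.
  - by rewrite innerZl (innerC k) -expr2 sqr_ge0.
apply: (@le_lt_trans _ _ (`|k| ^+ 2)%:E); last exact: ltry.
apply: trace_le => [x|n]; first by rewrite innerZl (innerC k) -expr2 sqr_ge0.
rewrite (eq_bigr (fun i : 'I_n => inner k (trace_basis i) ^+ 2)).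
  by apply: bessel; exact: trace_basis_system.
by move=> i _; rewrite innerZl (innerC _ k) expr2.
Qed.

(** The real normal law is extracted from the family N itself: for the covariance z -> <z, k> k the
    variable <z, k> has variance <k, k>^2, so xi = <z, k> / <k, k> has variance 1. *)
Lemma standard_gaussian (N : X -> (X -> X) -> probability (borel X) R) (k : X) :
  gaussian_family N -> k != 0 ->
  exists (P : probability (borel X) R) (xi : borel X -> R),
    measurable_fun setT xi /\ forall s : R,
    \int[P]_z cos (s * xi z) = expR (- (s ^+ 2 / 2)) /\
    \int[P]_z sin (s * xi z) = 0.
Proof.
move=> hN k0; have kk0 : inner k k != 0.
  by apply: contra k0 => /eqP kk; apply/eqP/inner_eq0.
exists (N 0 (fun z : X => inner z k *: k)), (fun z => inner z k / inner k k).
split; first by apply: measurable_funM => //; exact: measurable_inner.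
move=> s; have := hN 0 _ (rank_one_covariance k) ((s / inner k k) *: k).
rewrite !inner0l cos0 sin0 mul0r mul1r => -[].
have -> : (fun x : borel X => cos (inner x ((s / inner k k) *: k))) =
          (fun x => cos (s * (inner x k / inner k k))).
  by apply/funext => x; rewrite innerZr; congr cos; field.
have -> : (fun x : borel X => sin (inner x ((s / inner k k) *: k))) =
          (fun x => sin (s * (inner x k / inner k k))).
  by apply/funext => x; rewrite innerZr; congr sin; field.
move=> -> ->; split=> //; congr expR; congr (- _).
by rewrite !(innerZl, innerZr); field.
Qed.

End RankOne.

(** * Polynomial approximation of a step function *)

Section Threshold.
Context (R : realType).
Implicit Types (r g : R).

Lemma bernoulli_exprn r n : 0 <= r <= 1 -> 1 - n%:R * r <= (1 - r) ^+ n.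
Proof.
move=> /andP[r0 r1]; elim: n => [|n IH]; first by rewrite mul0r subr0 expr0.
rewrite exprS -natr1; have : 0 <= n%:R * r * r by rewrite !mulr_ge0.
have : (1 - r) * (1 - n%:R * r) <= (1 - r) * (1 - r) ^+ n.
  by rewrite ler_wpM2l// subr_ge0.
lra.
Qed.

Lemma natr_expr_le r n : 0 <= r < 1 -> n%:R * r ^+ n <= (1 - r)^-1.
Proof.
move=> /andP[r0 r1]; have r10 : 0 < 1 - r by rewrite subr_gt0.
rewrite -[leRHS]mul1r ler_pdivlMr//.
(* Divided by 1 - r, this compares n r^n with the sum 1 + r + ... + r^(n-1), whose n terms are all
   at least r^n. *)
apply: (@le_trans _ _ (1 - r ^+ n)); last by rewrite gerBl exprn_ge0.
elim: n => [|n IH]; first by rewrite !mul0r expr0 subrr.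
have rn1 : r ^+ n <= 1 by rewrite exprn_ile1// ltW.
have rn0 : 0 <= r ^+ n by rewrite exprn_ge0.
rewrite exprS -natr1.
have h1 : r * (n%:R * r ^+ n * (1 - r)) <= r * (1 - r ^+ n) by rewrite ler_wpM2l.
have h2 : r * r ^+ n * (1 - r) <= 1 * (1 - r).
  by rewrite ler_wpM2r ?(ltW r10)// mulr_ile1// ltW.
move: h1 h2; set m := n%:R; set u := r ^+ n; lra.
Qed.

(** With r = q^2, the factor n q^n stays bounded while the other factor q^n tends to 0. *)
Lemma cvg_natr_expr r : 0 <= r < 1 -> n%:R * r ^+ n @[n --> \oo] --> (0 : R).
Proof.
move=> /andP[r0 r1]; pose q := Num.sqrt r.
have q0 : 0 <= q by rewrite sqrtr_ge0.
have q1 : q < 1 by rewrite /q -sqrtr1 ltr_sqrt.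
apply: (@squeeze_cvgr _ _ _ _ (fun=> 0) (geometric (1 - q)^-1 q)).
- apply: nearW => n; rewrite mulr_ge0 ?exprn_ge0//=.
  have -> : r = q * q by rewrite -expr2 sqr_sqrtr.
  by rewrite exprMn mulrA ler_wpM2r ?exprn_ge0// natr_expr_le// q0.
- exact: cvg_cst.
- by apply: cvg_geometric; rewrite ger0_norm.
Qed.

(* Tends to 1 if [1/2 <= g <= 1] and to 0 if [0 <= g < 1/2]. *)
Definition threshold g n : R := 1 - (1 - g ^+ n) ^+ (n * 2 ^ n).

Lemma threshold_itv g n : 0 <= g <= 1 -> 0 <= threshold g n <= 1.
Proof.
move=> /andP[g0 g1]; rewrite /threshold subr_ge0 gerBl.
have gn1 : g ^+ n <= 1 by rewrite exprn_ile1.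
have gn0 : 0 <= g ^+ n by rewrite exprn_ge0.
by rewrite exprn_ge0 ?subr_ge0// exprn_ile1 ?subr_ge0// gerBl.
Qed.

(** The exponent n 2^n is chosen so that n 2^n g^n = n (2 g)^n. For g < 1/2 this tends to 0 and
    bounds [threshold] by Bernoulli's inequality; for g >= 1/2 it is at least n, and 1 - [threshold]
    is at most exp(- n). As [threshold] is a polynomial in g, indicators of slabs become bounded
    limits of polynomials in [gauss_factor]. *)
Lemma threshold_cvg g : 0 <= g <= 1 ->
  threshold g n @[n --> \oo] --> ((2^-1 <= g)%R%:R : R).
Proof.
move=> g01; have /andP[g0 g1] := g01.
have gn n : 0 <= g ^+ n <= 1 by rewrite exprn_ge0//= exprn_ile1.
have expE n : (n * 2 ^ n)%:R * g ^+ n = n%:R * (2 * g) ^+ n.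
  by rewrite natrM natrX exprMn mulrA.
have [gh|gh] := leP 2^-1 g; last first.
  apply: (@squeeze_cvgr _ _ _ _ (fun=> 0) (fun n => n%:R * (2 * g) ^+ n)).
  - apply: nearW => n; have /andP[-> _]/= := threshold_itv n g01.
    rewrite /threshold lerBlDr -lerBlDl -expE.
    exact: bernoulli_exprn.
  - exact: cvg_cst.
  - by apply: cvg_natr_expr; rewrite mulr_ge0//= mulrC -ltr_pdivlMr ?div1r.
rewrite -[X in _ --> X]subr0; apply: cvgB; first exact: cvg_cst.
apply: (@squeeze_cvgr _ _ _ _ (fun=> 0) (fun n : nat => expR (- n%:R))).
- apply: nearW => n; have /andP[gn0 gn1] := gn n.
  rewrite exprn_ge0 ?subr_ge0//=.
  apply: (@le_trans _ _ (expR (- g ^+ n) ^+ (n * 2 ^ n))).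
    rewrite lerXn2r ?nnegrE ?subr_ge0 ?expR_ge0//.
    exact: expR_ge1Dx.
  rewrite -expRM_natl ler_expR mulrN lerN2 expE ler_peMr//.
  by rewrite exprn_ege1// mulrC -ler_pdivrMr// div1r.
- exact: cvg_cst.
- exact: cvgn_expR.
Qed.

End Threshold.

(** * Uniqueness of characteristic functions *)

Section FourierUniqueness.
Context (R : realType) (X : hilbertType R) (sepX : separable X).
Context (N : X -> (X -> X) -> probability (borel X) R) (hN : gaussian_family N).
Implicit Types (h k : X) (c theta : R) (m : probability (borel X) R)
  (F G : borel X -> R).

Let wave h theta (x : borel X) : R := cos (inner x h + theta).

Let measurable_phase h theta :
  measurable_fun setT (fun x : borel X => inner x h + theta).
Proof. by apply: measurable_funD => //; exact: measurable_inner. Qed.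

Let wave_bm h theta : bounded_measurable (wave h theta).
Proof. exact: bounded_measurable_cos. Qed.

Let gauss_bm k c : bounded_measurable (gauss_factor k c : borel X -> R).
Proof.
split; first exact: measurable_gauss_factor.
by exists 1 => x; have /andP[/ltW g0 g1] := gauss_factor_itv k c x; rewrite ger0_norm.
Qed.

(** The mean of cos(a + u xi) over a standard normal xi is cos a exp(- u^2 / 2), the sine part
    having mean 0. For u = <x, k> - c the phase a + u xi is again affine in x, and Fubini exchanges
    the two averages. *)
Lemma gauss_factor_wave m F k c h theta (P : probability (borel X) R)
    (xi : borel X -> R) :
  measurable_fun setT xi -> (forall s : R,
    \int[P]_z cos (s * xi z) = expR (- (s ^+ 2 / 2)) /\
    \int[P]_z sin (s * xi z) = 0) ->
  bounded_measurable F ->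
  \int[m]_x (F x * gauss_factor k c x * wave h theta x) =
  \int[P]_z \int[m]_x (F x * wave (h + xi z *: k) (theta - xi z * c) x).
Proof.
move=> mxi xiP bF.
pose phi (p : borel X * borel X) :=
  F p.1 * cos (inner p.1 h + theta + (inner p.1 k - c) * xi p.2).
have bphi : bounded_measurable phi.
  apply: bounded_measurableM.
    have [mF [M FM]] := bF; split; last by exists M => p.
    exact: measurableT_comp.
  apply: bounded_measurable_cos; apply: measurable_funD.
    exact: (measurableT_comp (measurable_phase h theta) measurable_fst).
  apply: measurable_funM; last exact: (measurableT_comp mxi).
  exact: (measurableT_comp (measurable_phase k (- c)) measurable_fst).
transitivity (\int[P]_z \int[m]_x phi (x, z)); last first.
  apply: eq_Rintegral => z _; apply: eq_Rintegral => x _.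
  rewrite /phi /wave/= innerDr innerZr; congr (_ * cos _); ring.
rewrite -(bounded_fubini m P bphi); apply: eq_Rintegral => x _.
have [cP sP] := xiP (inner x k - c).
have mx : measurable_fun setT (fun z => (inner x k - c) * xi z).
  by apply: measurable_funM.
rewrite (_ : (fun z => phi (x, z)) = (fun z =>
    F x * wave h theta x * cos ((inner x k - c) * xi z) -
    F x * sin (inner x h + theta) * sin ((inner x k - c) * xi z))); last first.
  by apply/funext => z; rewrite /phi /wave cosD/=; ring.
rewrite Rintegral_bmB; last 2 first.
- apply: bounded_measurableM; first exact: bounded_measurable_cst.
  exact: bounded_measurable_cos.
- apply: bounded_measurableM; first exact: bounded_measurable_cst.
  exact: bounded_measurable_sin.
rewrite !Rintegral_bmZ; [|exact: bounded_measurable_sin|exact: bounded_measurable_cos].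
by rewrite cP sP mulr0 subr0 /gauss_factor; ring.
Qed.

Context (mu nu : probability (borel X) R).
Hypothesis same_waves : forall h theta,
  \int[mu]_x cos (inner x h + theta) = \int[nu]_x cos (inner x h + theta).

(** Weighted by F, the two measures still have the same Fourier transform. *)
Let neutral F : Prop := bounded_measurable F /\ forall h theta,
  \int[mu]_x (F x * wave h theta x) = \int[nu]_x (F x * wave h theta x).

(** Neutrality says nothing directly about products. Multipliers form an algebra by construction,
    and it is closed under bounded pointwise limits. *)
Let multiplier G : Prop := bounded_measurable G /\
  forall F, neutral F -> neutral (fun x => F x * G x).

Let multiplier_cst c : multiplier (fun=> c).
Proof.
split=> [|F [bF nF]]; first exact: bounded_measurable_cst.
split=> [|h theta].
  by apply: bounded_measurableM => //; exact: bounded_measurable_cst.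
have E x : F x * c * wave h theta x = c * (F x * wave h theta x) by ring.
under eq_Rintegral do rewrite E.
under [RHS]eq_Rintegral do rewrite E.
by rewrite !Rintegral_bmZ ?nF//; exact: bounded_measurableM.
Qed.

Let multiplierM F G : multiplier F -> multiplier G -> multiplier (fun x => F x * G x).
Proof.
move=> [bF mF] [bG mG]; split=> [|H nH]; first exact: bounded_measurableM.
rewrite (_ : (fun x => _) = (fun x => H x * F x * G x)); first exact/mG/mF.
by apply/funext => x; rewrite mulrA.
Qed.

Let multiplierB F G : multiplier F -> multiplier G -> multiplier (fun x => F x - G x).
Proof.
move=> [bF mF] [bG mG]; split=> [|H nH]; first exact: bounded_measurableB.
have [bHF HF] := mF H nH; have [bHG HG] := mG H nH.
have [bH _] := nH.
split=> [|h theta].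
  by apply: bounded_measurableM => //; exact: bounded_measurableB.
have E x : H x * (F x - G x) * wave h theta x =
   H x * F x * wave h theta x - H x * G x * wave h theta x by ring.
under eq_Rintegral do rewrite E.
under [RHS]eq_Rintegral do rewrite E.
by rewrite !Rintegral_bmB ?HF ?HG//; exact: bounded_measurableM.
Qed.

Let multiplierX F n : multiplier F -> multiplier (fun x => F x ^+ n).
Proof.
move=> mF; elim: n => [|n IH]; first by under eq_fun do rewrite expr0.
by under eq_fun do rewrite exprS; exact: multiplierM.
Qed.

Let multiplier_cvg (u : nat -> borel X -> R) F (M : R) :
  (forall n, multiplier (u n)) -> (forall n x, `|u n x| <= M) ->
  (forall x, u n x @[n --> \oo] --> F x) -> multiplier F.
Proof.
move=> mu_ uM uF.
have bF : bounded_measurable F.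
  split; first by apply: (measurable_fun_cvg (fun n => (mu_ n).1.1)) => x _; exact: uF.
  exists M => x; have /cvg_norm : u n x @[n --> \oo] --> F x by exact: uF.
  by move=> /cvgr_to_le; apply; apply: nearW => n.
split=> // H nH; split=> [|h theta]; first by have [bH _] := nH; exact: bounded_measurableM.
have [[mH [M' HM']] _] := nH.
have lim m : \int[m]_x (H x * u n x * wave h theta x) @[n --> \oo] -->
             \int[m]_x (H x * F x * wave h theta x).
  apply: (@bounded_cvg _ _ _ m _ _ (M' * M * 1)) => [n|n x|x].
  - by have [bHu _] := (mu_ n).2 H nH; have [] := bounded_measurableM bHu (wave_bm h theta).
  - rewrite !normrM ler_pM ?mulr_ge0//; first by rewrite ler_pM.
    exact: cos_max.
  - by apply: cvgMl; apply: cvgMr; exact: uF.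
rewrite -(cvg_lim (@Rhausdorff R) (lim mu)); apply: (cvg_lim (@Rhausdorff R)).
rewrite (_ : (fun n => _) = (fun n => \int[nu]_x (H x * u n x * wave h theta x))).
  exact: lim.
by apply/funext => n; have [_ ->] := (mu_ n).2 H nH.
Qed.

(* [exp (- (<x, k> - c)^2 / 2)] is the average of [cos (xi (<x, k> - c))] over a
   standard Gaussian [xi], so it maps waves to averages of waves. *)
Let multiplier_gauss k c : multiplier (gauss_factor k c).
Proof.
have [->|k0] := eqVneq k 0.
  rewrite (_ : gauss_factor 0 c = fun=> expR (- ((- c) ^+ 2 / 2))).
    exact: multiplier_cst.
  by apply/funext => x; rewrite /gauss_factor inner0r sub0r.
have [P [xi [mxi xiP]]] := standard_gaussian hN k0.
split=> [|F [bF nF]]; first exact: gauss_bm.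
split=> [|h theta]; first exact: bounded_measurableM.
rewrite !(@gauss_factor_wave _ _ _ _ _ _ P xi)//.
by apply: eq_Rintegral => z _; rewrite nF.
Qed.

Let multiplier_slab k c : multiplier (fun x => (2^-1 <= gauss_factor k c x)%R%:R).
Proof.
have gi x : 0 <= gauss_factor k c x <= 1.
  by have /andP[/ltW -> ->] := gauss_factor_itv k c x.
apply: (@multiplier_cvg (fun n x => threshold (gauss_factor k c x) n) _ 1).
- move=> n; apply: multiplierB; first exact: multiplier_cst.
  apply: multiplierX; apply: multiplierB; first exact: multiplier_cst.
  by apply: multiplierX; exact: multiplier_gauss.
- by move=> n x; have /andP[t0 t1] := threshold_itv n (gi x); rewrite ger0_norm.
- by move=> x; exact: threshold_cvg.
Qed.

Let slab_inter (s : seq (X * R)) : set (borel X) :=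
  [set x | all (fun kc => 2^-1 <= gauss_factor kc.1 kc.2 x) s].

Let multiplier_inter s : multiplier (\1_(slab_inter s)).
Proof.
elim: s => [|[k c] s IH].
  rewrite (_ : \1_ _ = fun=> 1); first exact: multiplier_cst.
  by apply/funext => x; rewrite indicE mem_set.
rewrite (_ : \1_ _ = fun x => (2^-1 <= gauss_factor k c x)%R%:R * \1_(slab_inter s) x).
  by apply: multiplierM => //; exact: multiplier_slab.
apply/funext => x; rewrite !indicE /slab_inter -natrM mulnb; congr ((nat_of_bool _)%:R).
apply/idP/idP => [/set_mem/andP[/= -> ?]|/andP[? /set_mem ?]].
  by rewrite mem_set.
by apply/mem_set/andP.
Qed.

(** Finite intersections of slabs form a pi-system generating the Borel sets. Their indicators are
    multipliers, and applying them to the neutral function 1, then integrating against the wave with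
    h = 0 and theta = 0, compares the two measures on that system. *)
Theorem fourier_uniqueness (A : set (borel X)) : measurable A -> mu A = nu A.
Proof.
pose G := [set B | exists s, B = slab_inter s].
have mG s : measurable (slab_inter s).
  elim: s => [|[k c] s IH]; first by rewrite (_ : slab_inter _ = setT)//; apply/seteqP.
  rewrite (_ : slab_inter _ = slab k c `&` slab_inter s).
    by apply: measurableI => //; exact: measurable_slab.
  by apply/seteqP; split=> x /= /andP.
apply: (@measure_unique _ _ _ G (fun=> setT)).
- apply/seteqP; split.
    rewrite borel_slabsE//; apply: smallest_sub; first exact: smallest_sigma_algebra.
    move=> _ [k [c ->]]; apply: sub_sigma_algebra; exists [:: (k, c)].
    by apply/seteqP; split=> x; rewrite /slab_inter/= andbT.
  apply: smallest_sub; first exact: sigma_algebra_measurable.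
  by move=> _ [s ->]; exact: mG.
- move=> _ _ [s ->] [s' ->]; exists (s ++ s').
  by apply/seteqP; split=> x /=; rewrite /slab_inter/= all_cat => /andP.
- by move=> _; exists [::]; apply/seteqP.
- by apply/seteqP; split=> // x _; exists 0%N.
- move=> _ [s ->].
  have bI : bounded_measurable (\1_(slab_inter s) : borel X -> R).
    exact: (multiplier_inter s).1.
  have n1 : neutral (fun=> 1).
    split=> [|h theta]; first exact: bounded_measurable_cst.
    rewrite (_ : (fun x => 1 * wave h theta x) = wave h theta).
      exact: same_waves.
    by apply/funext => x; rewrite mul1r.
  have [_ /(_ 0 0)] := (multiplier_inter s).2 _ n1.
  rewrite (_ : (fun x => _) = \1_(slab_inter s)); last first.
    by apply/funext => x; rewrite /wave inner0r addr0 cos0 mulr1 mul1r.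
  move=> munu; have : (\int[mu]_x \1_(slab_inter s) x)%:E =
                      (\int[nu]_x \1_(slab_inter s) x)%:E by rewrite munu.
  by rewrite !integral_bm// !integral_indic// !setIT.
- by move=> _; rewrite (le_lt_trans (probability_le1 mu measurableT))// ltry.
Qed.

End FourierUniqueness.

(** * Laws and completed measures *)

Section Trigonometry.
Context (R : realType).
Implicit Types (a b z : R).

Lemma cos_lipschitz a b : `|cos a - cos b| <= `|a - b|.
Proof.
wlog ab : a b / a <= b.
  by move=> W; case: (leP a b) => [|/ltW] ab; [|rewrite distrC (distrC a)]; exact: W.
have [|c _ E] := @MVT_segment R (@cos R) (fun x => - sin x) a b ab.
  by apply: continuous_subspaceT; exact: continuous_cos.
rewrite distrC E normrM normrN (distrC a) ler_piMl//.
exact: sin_max.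
Qed.

Lemma sin_sub_le z : `|sin z - z| <= z ^+ 2.
Proof.
wlog z0 : z / 0 <= z.
  move=> W; case: (leP 0 z) => [|/ltW] z0; first exact: W.
  by have := W (- z); rewrite oppr_ge0 sinN sqrrN -opprD normrN; exact.
have [|c cz E] := @MVT_segment R (@sin R) (@cos R) 0 z z0.
  by apply: continuous_subspaceT; exact: continuous_sin.
move: E; rewrite sin0 !subr0 => ->.
rewrite -[X in _ - X]mul1r -mulrBl normrM (ger0_norm z0) expr2 ler_wpM2r//.
rewrite -(@cos0 R) (le_trans (cos_lipschitz _ _))// subr0.
by move: cz; rewrite in_itv/= => /andP[c0 cz]; rewrite ger0_norm.
Qed.

(** The squares of these bounded approximations of z are trigonometric polynomials, so second
    moments can be read off a characteristic function. *)
Lemma cvg_natr_sin z : n.+1%:R * sin (z / n.+1%:R) @[n --> \oo] --> z.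
Proof.
apply/cvgrPdist_le => e e0; near=> n.
have n0 : 0 < n.+1%:R :> R by rewrite ltr0Sn.
have -> : z - n.+1%:R * sin (z / n.+1%:R) =
          - (n.+1%:R * (sin (z / n.+1%:R) - z / n.+1%:R)).
  by field; rewrite gt_eqF.
rewrite normrN normrM gtr0_norm//.
apply: (@le_trans _ _ (n.+1%:R * (z / n.+1%:R) ^+ 2)).
  by rewrite ler_wpM2l ?(ltW n0)// sin_sub_le.
have -> : n.+1%:R * (z / n.+1%:R) ^+ 2 = z ^+ 2 / n.+1%:R by field; rewrite gt_eqF.
rewrite ler_pdivrMr// -ler_pdivrMl//.
near: n; exists (Num.trunc (e^-1 * z ^+ 2)).+1 => // n /= nk.
rewrite (le_trans (ltW (truncnS_gt _)))// ler_nat; exact: leqW.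
Unshelve. all: by end_near. Qed.

End Trigonometry.

Section NullSets.
Context d (T : measurableType d) (R : realType) (P : {measure set T -> \bar R}).
Import HBNNSimple.
Local Open Scope ereal_scope.

(** Serves versions that are measurable only for the completion. A simple function below u can be
    set to 0 on N; its integral does not change and it is then below v, so the two suprema that
    define the integrals agree. *)
Lemma integral_eq_off_null (N : set T) (f g : T -> \bar R) :
  measurable N -> P N = 0 -> (forall x, ~ N x -> f x = g x) ->
  \int[P]_x f x = \int[P]_x g x.
Proof.
move=> mN PN fg.
suff le (u v : T -> \bar R) : (forall x, 0 <= u x) -> (forall x, 0 <= v x) ->
    (forall x, ~ N x -> u x = v x) -> \int[P]_x u x <= \int[P]_x v x.
  have eq (u v : T -> \bar R) : (forall x, 0 <= u x) -> (forall x, 0 <= v x) ->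
      (forall x, ~ N x -> u x = v x) -> \int[P]_x u x = \int[P]_x v x.
    move=> u0 v0 uv; apply/eqP; rewrite eq_le !le// => x Nx.
    by rewrite uv.
  rewrite integralE [RHS]integralE; congr (_ - _); apply: eq => // x Nx.
    by rewrite !funeposE fg.
  by rewrite !funenegE fg.
move=> u0 v0 uv; rewrite !ge0_integralTE//.
apply: ge_ereal_sup => _ [h /= hu <-].
have mNc : measurable (~` N) by exact: measurableC.
have -> : sintegral P h = sintegral P (proj_nnsfun h mNc).
  rewrite -!integralT_nnsfun; apply: ge0_ae_eq_integral => //.
  - exact/measurable_EFinP.
  - exact/measurable_EFinP.
  - by move=> x _; rewrite lee_fin.
  - by move=> x _; rewrite lee_fin.
  exists N; split=> // x /= hx; apply: contrapT => Nx; apply: hx => _.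
  by rewrite mindicE mem_set// mulr1.
apply: ereal_sup_ubound; exists (proj_nnsfun h mNc) => // x /=.
rewrite mindicE; have [xN|xN] := boolP (x \in ~` N).
  by rewrite mulr1 -uv; [exact: hu|exact: set_mem].
by rewrite mulr0; exact: v0.
Qed.

End NullSets.

Section Laws.
Context d d' (T : measurableType d) (T' : measurableType d') (R : realType).
Context (P : probability T R) (phi : T -> T').
Hypothesis mphi : measurable_fun setT phi.

Lemma law_exists :
  exists Q : probability T' R, forall A, measurable A -> Q A = P (phi @^-1` A).
Proof.
pose phi' : {mfun T >-> T'} := mfun_Sub (mem_set mphi).
by exists (distribution P phi').
Qed.

Lemma integral_law (Q : probability T' R) (f : T' -> \bar R) :
  (forall A, measurable A -> Q A = P (phi @^-1` A)) -> measurable_fun setT f ->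
  (\int[Q]_y f y = \int[P]_x f (phi x))%E.
Proof.
move=> QP mf; pose phi' : {mfun T >-> T'} := mfun_Sub (mem_set mphi).
have E : (\int[Q]_y f y = \int[distribution P phi']_y f y)%E.
  by apply: eq_measure_integral => A mA _; exact: QP.
rewrite E integralE [RHS]integralE; congr (_ - _)%E.
- transitivity (\int[P]_x (f^\+ \o phi') x)%E.
    by apply: ge0_integral_distribution => //; exact: measurable_funepos.
  by apply: eq_integral => x _; rewrite /= !funeposE.
- transitivity (\int[P]_x (f^\- \o phi') x)%E.
    by apply: ge0_integral_distribution => //; exact: measurable_funeneg.
  by apply: eq_integral => x _; rewrite /= !funenegE.
Qed.

Lemma Rintegral_law (Q : probability T' R) (f : T' -> R) :
  (forall A, measurable A -> Q A = P (phi @^-1` A)) -> measurable_fun setT f ->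
  \int[Q]_y f y = \int[P]_x f (phi x).
Proof.
move=> QP mf; congr fine; apply: (integral_law QP).
exact/measurable_EFinP.
Qed.

End Laws.

Section BorelVersion.
Context (R : realType) (X : hilbertType R) (sepX : separable X).
Context (P : probability (borel X) R).

(** The preimage of each ball of a countable base is Borel up to a null set. Off the union N of
    these null sets all of them are Borel at once, and on N the map is replaced by 0. *)
Lemma borel_version (S : X -> X) :
  (forall B : set (borel X), measurable B ->
     completed_algebra_gen P (S @^-1` B)) ->
  exists S' : borel X -> borel X, measurable_fun setT S' /\
    exists N : set (borel X), [/\ measurable N, P N = 0%E & forall x, ~ N x -> S' x = S x].
Proof.
move=> mS; have [d dd] := separable_enum sepX.
pose B (p : nat * nat) : set (borel X) := [set x | `|x - d p.1| < p.2.+1%:R^-1].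
have mB p : measurable (B p).
  apply: sub_sigma_algebra.
  rewrite (_ : B p = ball (d p.1) p.2.+1%:R^-1); first exact: ball_open.
  by apply/seteqP; split=> x; rewrite /B -ball_normE/= distrC.
have AN p : exists AN : set (borel X) * set (borel X), [/\ measurable AN.1,
    measurable AN.2, P AN.2 = 0%E & forall x, ~ AN.2 x -> B p (S x) <-> AN.1 x].
  have [A mA [N [M [mM PM NM]] E]] := mS _ (mB p).
  exists (A, M); split=> // x /= Mx.
  have -> : B p (S x) = (S @^-1` B p) x by [].
  by rewrite -E; split=> [[//|/NM]|]; [|left].
have [AN_ AN_P] := choice AN.
pose N := \bigcup_n \bigcup_m (AN_ (n, m)).2.
have mN : measurable N.
  apply: bigcupT_measurable => n; apply: bigcupT_measurable => m.
  by have [] := AN_P (n, m).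
have PN : P N = 0%E.
  apply: measure_negligible => //.
  apply: negligible_bigcup => n; apply: negligible_bigcup => m.
  by have [_ mM PM _] := AN_P (n, m); exact/negligibleP.
pose S' x := if x \in N then 0 else S x.
exists S'; split; last first.
  exists N; split=> // x Nx; rewrite /S' ifF//.
  by apply/negP => /set_mem.
have mS' p : measurable (S' @^-1` B p).
  have [mA mM _ ANp] := AN_P p.
  (* On N the map is constantly 0, so N lies in this preimage entirely or not at all, according to
     [B p 0]. *)
  have -> : S' @^-1` B p = ((AN_ p).1 `\` N) `|` (N `&` [set _ | B p 0]).
    apply/seteqP; split=> x /=; rewrite /S'.
      case: ifPn => [/set_mem Nx B0|/negP Nx BSx]; first by right.
      have Nx' : ~ N x by move=> Nx'; exact/Nx/mem_set.
      left; split=> //; apply/ANp => // Mx; apply: Nx'.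
      by exists p.1 => //; exists p.2 => //; rewrite -surjective_pairing.
    case=> [[Ax Nx]|[Nx B0]]; last by rewrite mem_set.
    rewrite ifF; last by apply/negP => /set_mem.
    apply/ANp => // Mx; apply: Nx.
    by exists p.1 => //; exists p.2 => //; rewrite -surjective_pairing.
  apply: measurableU; first exact: measurableD.
  have [B0|B0] := pselect (B p 0).
    by rewrite (_ : _ `&` _ = N)//; apply/seteqP; split=> [x []|x].
  by rewrite (_ : _ `&` _ = set0)//; apply/seteqP; split=> x // [].
apply: (@measurability _ _ _ (borel X) _ _ (@open X)) => //.
move=> _ [U oU <-]; rewrite setTI.
have -> : S' @^-1` U = \bigcup_n \bigcup_(m in [set m | B (n, m) `<=` U]) S' @^-1` B (n, m).
  apply/seteqP; split=> [x Ux|x [n _ [m BU]]]; last exact: BU.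
  have /nbhs_ballP[e /= e0 xe] : nbhs (S' x) U by exact: open_nbhs_nbhs.
  have [m _ /(_ m (leqnn m)) /= me] :=
    near_infty_natSinv_lt (PosNum (divr_gt0 e0 (ltr0Sn R 1))).
  have m0 : 0 < (m.+1%:R^-1 : R) by rewrite invr_gt0 ltr0Sn.
  have [n xn] := dd (S' x) _ m0.
  exists n => //; exists m => //= y; rewrite /B/= => yn; apply: xe.
  rewrite -ball_normE/= (_ : S' x - y = (S' x - d n) - (y - d n)); last first.
    by rewrite opprB addrA subrK.
  rewrite (le_lt_trans (ler_normB _ _))// [ltRHS]splitr.
  exact: ltrD (lt_trans xn me) (lt_trans yn me).
by apply: bigcupT_measurable => n; apply: bigcup_measurable => m _.
Qed.

End BorelVersion.

(** * Gaussian measures and linear versions *)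

Section GaussianMoments.
Context (R : realType) (X : hilbertType R) (sepX : separable X).
Implicit Types (Q : X -> X) (m : probability (borel X) R) (h x : X).

Lemma gaussian_wave m a Q : is_gaussian m a Q -> forall h theta,
  \int[m]_x cos (inner x h + theta) =
  cos (inner a h + theta) * expR (- (inner (Q h) h / 2)).
Proof.
move=> mG h theta; have [cE sE] := mG h.
have bc : bounded_measurable (fun x : borel X => cos (inner x h)).
  by apply: bounded_measurable_cos; exact: measurable_inner.
have bs : bounded_measurable (fun x : borel X => sin (inner x h)).
  by apply: bounded_measurable_sin; exact: measurable_inner.
rewrite (_ : (fun x : borel X => _) = (fun x =>
    cos theta * cos (inner x h) - sin theta * sin (inner x h))); last first.
  by apply/funext => x; rewrite cosD; ring.
rewrite Rintegral_bmB.
- by rewrite !Rintegral_bmZ// cE sE cosD; ring.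
- by apply: bounded_measurableM => //; exact: bounded_measurable_cst.
- by apply: bounded_measurableM => //; exact: bounded_measurable_cst.
Qed.

(** The approximations u_n of <x, h>^2 have integrals given by the characteristic function, at most
    q by 1 - exp(- t) <= t; Fatou's lemma passes to the limit. *)
Lemma gaussian_second_moment m Q h : linear Q -> is_gaussian m 0 Q ->
  (\int[m]_x (inner x h ^+ 2)%:E <= (inner (Q h) h)%:E)%E.
Proof.
move=> lQ mG; set q := inner (Q h) h.
pose u n (x : borel X) : R := (n.+1%:R * sin (inner x h / n.+1%:R)) ^+ 2.
have mu_ n : measurable_fun setT (u n).
  apply: measurable_funX; apply: measurable_funM => //.
  have [] // := @bounded_measurable_sin _ (borel X) R (fun x => inner x h / n.+1%:R).
  by apply: measurable_funM => //; exact: measurable_inner.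
have uq n : (\int[m]_x (u n x)%:E <= q%:E)%E.
  have n0 : n.+1%:R != 0 :> R by rewrite pnatr_eq0.
  pose k := (2 / n.+1%:R) *: h; pose c := 2^-1 * n.+1%:R ^+ 2 : R.
  (* By 2 sin^2 z = 1 - cos(2 z). The constants satisfy c <Q k, k> / 2 = q. *)
  have -> : u n = (fun x => c - c * cos (inner x k + 0)).
    apply/funext => x; rewrite /u /c /k innerZr addr0.
    set z := inner x h / n.+1%:R.
    have -> : 2 / n.+1%:R * inner x h = z + z by rewrite /z; field.
    rewrite cosD exprMn; have := cos2Dsin2 z.
    set a := cos z; set b := sin z => ab.
    by have -> : a * a = 1 - b ^+ 2; [rewrite -ab; ring|field].
  have bc : bounded_measurable (fun x : borel X => cos (inner x k + 0)).
    by apply: bounded_measurable_cos; apply: measurable_funD => //; exact: measurable_inner.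
  rewrite -integral_bm; last first.
    apply: bounded_measurableB; first exact: bounded_measurable_cst.
    by apply: bounded_measurableM => //; exact: bounded_measurable_cst.
  rewrite Rintegral_bmB; first last.
  - by apply: bounded_measurableM => //; exact: bounded_measurable_cst.
  - exact: bounded_measurable_cst.
  rewrite Rintegral_cst1 Rintegral_bmZ// (gaussian_wave mG) inner0l addr0 cos0 mul1r.
  have c0 : 0 <= c by rewrite mulr_ge0 ?sqr_ge0.
  have e1 := expR_ge1Dx (- (inner (Q k) k / 2)).
  have -> : q = c * (inner (Q k) k / 2).
    by rewrite /k (linear_mapZ lQ) innerZl innerZr -/q /c; field.
  by rewrite lee_fin -[X in X - _]mulr1 -mulrBr ler_wpM2l//; lra.
have cu x : (u n x)%:E @[n --> \oo] --> (inner x h ^+ 2)%:E.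
  apply: cvg_EFin; first exact: nearW.
  rewrite (_ : _ \o _ = (fun n => n.+1%:R * sin (inner x h / n.+1%:R) *
    (n.+1%:R * sin (inner x h / n.+1%:R)))).
    by rewrite expr2; apply: cvgM; exact: cvg_natr_sin.
  by apply/funext => n /=; rewrite /u expr2.
apply: (@le_trans _ _ (\int[m]_x limn_einf (fun n => (u n x)%:E))%E).
  rewrite le_eqVlt; apply/orP; left; apply/eqP; apply: eq_integral => x _.
  by have [-> _] := cvg_limn_einf_sup (cu x).
apply: le_trans (fatou m measurableT _ _) _.
- by move=> n; exact/measurable_EFinP.
- by move=> n x _; rewrite lee_fin sqr_ge0.
rewrite limn_einf_lim; apply: lime_le; first exact: is_cvg_einfs.
apply: nearW => n; apply: le_trans (uq n).
by apply: ereal_inf_lbound; exists n => /=.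
Qed.

Context (Q : X -> X) (e : nat -> X) (m : probability (borel X) R).
Hypotheses (cQ : covariance_operator Q) (be : eigenbasis Q e).
Hypothesis mG : is_gaussian m 0 Q.

Let lQ : linear Q. Proof. by have [/nonneg_whole[]] := cQ. Qed.

Lemma gaussian_norm_integrable : (\int[m]_x (`|x : X| ^+ 2)%:E < +oo)%E.
Proof.
have [_ trQ] := cQ; apply: le_lt_trans trQ.
have bf := trace_basisP sepX.
rewrite /trace -/(@trace_basis R X); set f := @trace_basis R X in bf *.
have -> : (\int[m]_x (`|x : X| ^+ 2)%:E =
    \int[m]_x (\sum_(0 <= k <oo) (inner x (f k) ^+ 2)%:E))%E.
  apply: eq_integral => x _; apply/esym/cvg_lim => //.
  rewrite (_ : (fun n => _) = (fun n => (\sum_(i < n) inner x (f i) * inner x (f i))%:E)).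
    apply: cvg_EFin; first exact: nearW.
    by rewrite -inner_norm; exact: parseval.
  by apply/funext => n; rewrite big_mkord sumEFin.
rewrite integral_nneseries//; last 2 first.
- move=> n; apply/measurable_EFinP; apply: measurable_funX.
  exact: measurable_inner.
- by move=> n x _; rewrite lee_fin sqr_ge0.
apply: lee_nneseries => [n _ _|n _].
  by apply: integral_ge0 => x _; rewrite lee_fin sqr_ge0.
exact: gaussian_second_moment.
Qed.

Lemma gaussian_kernel h : inner (Q h) h = 0 ->
  {ae m, forall x : borel X, inner x h = 0}.
Proof.
move=> Qh.
have m2 : measurable_fun setT (fun x : borel X => (inner x h ^+ 2)%:E).
  by apply/measurable_EFinP; apply: measurable_funX; exact: measurable_inner.
have : (\int[m]_x `|(inner x h ^+ 2)%:E| = 0)%E.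
  apply/eqP; rewrite eq_le integral_ge0 ?andbT//.
  have := gaussian_second_moment h lQ mG; rewrite Qh; apply: le_trans.
  rewrite le_eqVlt; apply/orP; left; apply/eqP; apply: eq_integral => x _.
  by rewrite gee0_abs// lee_fin sqr_ge0.
move=> /(ae_eq_integral_abs m measurableT m2).
apply: filterS => x /(_ Logic.I) /= [] /eqP.
by rewrite sqrf_eq0 => /eqP.
Qed.

(** The component of each d_j in the kernel of Q is a direction of zero variance, so almost every x
    is orthogonal to all of them; testing x - [range_proj e x] against the dense d_j shows that it
    vanishes. *)
Lemma gaussian_support : {ae m, forall x : borel X, range_proj e x = x}.
Proof.
have [d dd] := separable_enum sepX; have nQ := cQ.1.
pose k j := d j - range_proj e (d j).
have Qk j : inner (Q (k j)) (k j) = 0.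
  have : kernel Q (k j).
    rewrite -(kernel_root nQ) /kernel/= (linear_mapB (root_linear nQ)).
    by rewrite (root_range_proj nQ be) subrr.
  by rewrite /kernel/= => ->; rewrite inner0l.
have : {ae m, forall x : borel X, forall j, inner x (k j) = 0}.
  by apply/ae_foralln => j; exact: gaussian_kernel.
apply: filterS => x xk; apply/eqP; rewrite -subr_eq0 -normr_le0.
apply/(norm_le_dense _ dd (lexx 0)) => j.
have P x' z : inner (range_proj e x') z = inner (range_proj e x') (range_proj e z).
  rewrite innerC -(range_proj_inner nQ be z)//; first exact: innerC.
  exact: range_proj_compl.
rewrite mul0r innerBl P innerC -P innerC.
by have := xk j; rewrite /k innerBr => /subr0_eq ->; rewrite subrr normr0.
Qed.

Lemma measurable_proj n : measurable_fun setT (proj e n : borel X -> borel X).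
Proof.
apply: (measurable_to_borel sepX) => h.
under eq_fun do rewrite inner_projl.
apply: measurable_sum => i; apply: measurable_funM => //; exact: measurable_inner.
Qed.

Lemma bounded_operator_id : bounded_operator (id : X -> X).
Proof. by split=> // x; exact: cvg_id. Qed.

Lemma measurable_sub_proj A n : bounded_operator A -> measurable_fun setT
  (fun x : borel X => (`|A (proj e n x) - A x : X| ^+ 2)%:E).
Proof.
move=> [lA cA]; apply/measurable_EFinP; apply: measurable_funX.
apply: measurable_norm; apply: (measurable_to_borel sepX) => h.
have mA : measurable_fun setT (A : borel X -> borel X) by exact: continuous_borel_borel.
have mAh : measurable_fun setT (fun x : borel X => inner (A x) h).
  exact: (measurableT_comp (@measurable_inner R X h) mA).
under eq_fun do rewrite innerBl.
apply: measurable_funB => //.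
exact: (measurableT_comp mAh (measurable_proj n)).
Qed.

Lemma gaussian_proj_cvg :
  (\int[m]_x (`|proj e n x - x : X| ^+ 2)%:E)%E @[n --> \oo] --> (0 : \bar R)%E.
Proof.
have m2 n : measurable_fun setT (fun x : borel X => (`|proj e n x - x : X| ^+ 2)%:E).
  exact: (@measurable_sub_proj id n bounded_operator_id).
have [||||_ _] := @dominated_convergence _ _ R m setT measurableT
  (fun n (x : borel X) => (`|proj e n x - x : X| ^+ 2)%:E) (cst 0%E)
  (fun x : borel X => (`|x : X| ^+ 2)%:E) m2.
- exact: measurable_cst.
- apply: filterS gaussian_support => x Px _.
  apply: cvg_EFin; first exact: nearW.
  have /cvg_norm : proj e n x - x @[n --> \oo] --> range_proj e x - x.
    by apply: cvgB; [exact: (range_proj_cvg be)|exact: cvg_cst].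
  rewrite Px subrr normr0 => x0.
  have : `|proj e n x - x| * `|proj e n x - x| @[n --> \oo] --> (0 * 0 : R).
    exact: cvgM.
  by rewrite mulr0 (_ : fine \o _ = (fun n => `|proj e n x - x| * `|proj e n x - x|)).
- apply/integrableP; split.
    by apply/measurable_EFinP; apply: measurable_funX; exact: measurable_norm.
  rewrite (eq_integral (fun x : borel X => (`|x : X| ^+ 2)%:E)).
    exact: gaussian_norm_integrable.
  by move=> x _; rewrite gee0_abs// lee_fin sqr_ge0.
- apply: aeW => x n _; rewrite gee0_abs ?lee_fin ?sqr_ge0// ler_pXn2r ?nnegrE//.
  by rewrite distrC; exact: (norm_sub_proj_le (eigenbasis_system be)).
by rewrite integral0; apply.
Qed.

Lemma gaussian_operator_cvg A : bounded_operator A ->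
  (\int[m]_x (`|A (proj e n x) - A x : X| ^+ 2)%:E)%E @[n --> \oo] --> (0 : \bar R)%E.
Proof.
move=> bA; have [C C0 AC] := bounded_operator_norm bA.
apply: (@squeeze_cvge _ _ _ _ (fun=> 0%E) _
  (fun n => (C ^+ 2)%:E * \int[m]_x (`|proj e n x - x : X| ^+ 2)%:E)%E).
- apply: nearW => n; apply/andP; split.
    by apply: integral_ge0 => x _; rewrite lee_fin sqr_ge0.
  rewrite -ge0_integralZl_EFin ?sqr_ge0//;
    last exact: (@measurable_sub_proj id n bounded_operator_id).
  apply: ge0_le_integral => //.
  + exact: measurable_sub_proj.
  + apply: measurable_funeM; exact: (@measurable_sub_proj id n bounded_operator_id).
  + move=> x _; rewrite -EFinM lee_fin -exprMn ler_pXn2r ?nnegrE ?mulr_ge0//.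
    by rewrite -(linear_mapB bA.1).
- exact: cvg_cst.
- by rewrite -(mule0 (C ^+ 2)%:E); apply: cvgeZl => //; exact: gaussian_proj_cvg.
Qed.

End GaussianMoments.

(** * Convergence in mean square *)

Section MeanSquareLimits.
Context (R : realType) (X : hilbertType R) (sepX : separable X).
Context d (T : measurableType d) (P : probability T R).
Implicit Types (u v w : T -> borel X).

Definition mean_square_cvg (u : nat -> T -> borel X) v : Prop :=
  (\int[P]_x (`|u n x - v x : X| ^+ 2)%:E)%E @[n --> \oo] --> (0 : \bar R)%E.

Lemma measurable_sqr_dist u v : measurable_fun setT u -> measurable_fun setT v ->
  measurable_fun setT (fun x => `|u x - v x : X| ^+ 2).
Proof.
move=> mu mv; apply: measurable_funX; apply: measurable_norm.
apply: (measurable_to_borel sepX) => h; under eq_fun do rewrite innerBl.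
by apply: measurable_funB; apply: (measurableT_comp (@measurable_inner R X h)).
Qed.

Lemma mean_square_wave (u : nat -> T -> borel X) v h theta :
  (forall n, measurable_fun setT (u n)) -> measurable_fun setT v ->
  mean_square_cvg u v ->
  \int[P]_x cos (inner (u n x : X) h + theta) @[n --> \oo] -->
  \int[P]_x cos (inner (v x : X) h + theta).
Proof.
move=> mu mv uv; apply/cvgrPdist_le => e e0.
have bc w : measurable_fun setT w ->
    bounded_measurable (fun x => cos (inner (w x : X) h + theta)).
  move=> mw; apply: bounded_measurable_cos; apply: measurable_funD => //.
  exact: (measurableT_comp (@measurable_inner R X h)).
(* By |t| <= r + t^2 / r and Cauchy-Schwarz, the cosines differ by at most r + K |u n x - v x|^2;
   once the mean square is at most r / (K + 1), the integral is at most 2 r = e. *)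
pose r := e / 2; have r0 : 0 < r by rewrite divr_gt0.
pose K := `|h| ^+ 2 / r; have K0 : 0 <= K by rewrite divr_ge0 ?sqr_ge0// ltW.
have Kr : 0 < r / (K + 1) by rewrite divr_gt0// ltr_wpDl.
have [N _ NI] : \forall n \near \oo,
    (\int[P]_x (`|u n x - v x : X| ^+ 2)%:E <= (r / (K + 1))%:E)%E.
  have /uv : nbhs (0 : \bar R)%E [set y | (y < (r / (K + 1))%:E)%E].
    by apply: open_nbhs_nbhs; split; [exact: open_ereal_lt_ereal|rewrite /= lte_fin].
  by move=> [N _ NI]; exists N => // n Nn; apply: ltW; exact: NI.
exists N => // n /= /NI In.
rewrite -Rintegral_bmB; [|exact: bc..].
have bB : bounded_measurable (fun x =>
    cos (inner (v x : X) h + theta) - cos (inner (u n x : X) h + theta)).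
  by apply: bounded_measurableB; exact: bc.
rewrite (le_trans (le_normr_Rintegral _ (bounded_measurable_integrable P bB)))//.
rewrite -lee_fin integral_bm; last first.
  case: bB => mB [M BM]; split; first exact: measurableT_comp.
  by exists M => x; rewrite normr_id.
have mI : measurable_fun setT (fun x => (`|u n x - v x : X| ^+ 2)%:E).
  by apply/measurable_EFinP; exact: measurable_sqr_dist.
apply: (@le_trans _ _ (\int[P]_x (r%:E + K%:E * (`|u n x - v x : X| ^+ 2)%:E))%E).
  apply: ge0_le_integral => //.
  - by apply/measurable_EFinP; apply: measurableT_comp => //; exact: bB.1.
  - by apply: emeasurable_funD => //; exact: measurable_funeM.
  move=> x _; rewrite -EFinM -EFinD lee_fin.
  rewrite (le_trans (cos_lipschitz _ _))//.
  rewrite (_ : _ - _ = - inner (u n x - v x : X) h); last by rewrite innerBl; ring.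
  rewrite normrN; set t := inner _ h.
  have tt : t ^+ 2 <= `|h| ^+ 2 * `|u n x - v x : X| ^+ 2.
    rewrite -exprMn -[t ^+ 2]real_normK ?num_real// ler_pXn2r ?nnegrE ?mulr_ge0//.
    by rewrite mulrC cauchy_schwarz.
  rewrite (@le_trans _ _ (r + t ^+ 2 / r))//.
    rewrite -(ler_pM2r r0) mulrDl divfK ?gt_eqF// -[t ^+ 2]real_normK ?num_real//.
    by have := sqr_ge0 (`|t| - r); have := sqr_ge0 (`|t|); have := sqr_ge0 r; nra.
  rewrite lerD2l ler_pdivrMr// (le_trans tt)// le_eqVlt; apply/orP; left; apply/eqP.
  by rewrite /K; field; rewrite gt_eqF.
rewrite ge0_integralD//; last 3 first.
- by move=> x _; rewrite lee_fin ltW.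
- by move=> x _; rewrite -EFinM lee_fin mulr_ge0.
- exact: measurable_funeM.
rewrite integral_cst// [X in (_ * X)%E](_ : _ = 1%E); last exact: probability_setT.
rewrite mule1 ge0_integralZl_EFin//.
apply: (@le_trans _ _ (r%:E + K%:E * (r / (K + 1))%:E)%E).
  by rewrite leeD2l// lee_pmul// integral_ge0// => x _; rewrite lee_fin sqr_ge0.
rewrite -EFinM -EFinD lee_fin.
have : K * (r / (K + 1)) <= r.
  by rewrite mulrCA ler_piMr ?(ltW r0)// ler_pdivrMr ?mul1r ?lerDl// ltr_wpDl.
by rewrite /r; lra.
Qed.

Lemma mean_square_unique (u : nat -> T -> borel X) v w :
  (forall n, measurable_fun setT (u n)) -> measurable_fun setT v ->
  measurable_fun setT w -> mean_square_cvg u v -> mean_square_cvg u w ->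
  {ae P, forall x, v x = w x}.
Proof.
move=> mu mv mw uv uw.
have mI v1 v2 : measurable_fun setT v1 -> measurable_fun setT v2 ->
    measurable_fun setT (fun x => (`|v1 x - v2 x : X| ^+ 2)%:E).
  by move=> m1 m2; apply/measurable_EFinP; exact: measurable_sqr_dist.
have : (\int[P]_x `|(`|v x - w x : X| ^+ 2)%:E| = 0)%E.
  apply/eqP; rewrite eq_le integral_ge0 ?andbT//.
  have lim0 : (2%:E * \int[P]_x (`|u n x - v x : X| ^+ 2)%:E +
     2%:E * \int[P]_x (`|u n x - w x : X| ^+ 2)%:E)%E @[n --> \oo] --> (0 : \bar R)%E.
    rewrite -[X in _ --> X]adde0 -(mule0 2%:E).
    by apply: cvgeD; [|exact: cvgeZl|exact: cvgeZl]; rewrite !mule0.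
  apply: (cvge_to_ge lim0); apply: nearW => n.
  rewrite -!ge0_integralZl_EFin//; try exact: mI.
  rewrite -ge0_integralD//; try by apply: measurable_funeM; exact: mI.
  apply: ge0_le_integral => //.
  - by apply: measurableT_comp => //; exact: mI.
  - by apply: emeasurable_funD; apply: measurable_funeM; exact: mI.
  move=> x _; rewrite gee0_abs; last by rewrite lee_fin sqr_ge0.
  rewrite -!EFinM -EFinD lee_fin.
  set a := u n x - v x; set b := u n x - w x.
  have -> : v x - w x = b - a :> X by rewrite /a /b opprB [RHS]addrC subrKA.
  have := sqr_ge0 (`|b + a : X|); rewrite sqr_normB sqr_normD; lra.
move=> /(ae_eq_integral_abs P measurableT (mI _ _ mv mw)).
apply: filterS => x /(_ Logic.I) /= [] /eqP.
by rewrite sqrf_eq0 normr_eq0 subr_eq0 => /eqP.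
Qed.

End MeanSquareLimits.

Section LinearVersions.
Context (R : realType) (X : hilbertType R) (sepX : separable X).
Context (Q : X -> X) (e : nat -> X) (m : probability (borel X) R).
Hypotheses (cQ : covariance_operator Q) (be : eigenbasis Q e).
Hypothesis mG : is_gaussian m 0 Q.
Let H := cameron_martin Q.
Context (D : X -> X).
Hypothesis lD : forall a h k,
  carrier H h -> carrier H k -> D (a *: h + k) = a *: D h + D k.

Let DprojE n x : D (proj e n x) = \sum_(i < n) inner x (e i) *: D (e i).
Proof. exact: (linear_on_carrier cQ.1 be). Qed.

Lemma measurable_on_proj n :
  measurable_fun setT ((fun x => D (proj e n x)) : borel X -> borel X).
Proof.
apply: (measurable_to_borel sepX) => h.
under eq_fun do rewrite DprojE inner_suml.
apply: measurable_sum => i; under eq_fun do rewrite innerZl.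
by apply: measurable_funM => //; exact: measurable_inner.
Qed.

(** From here on only W' occurs in image laws and product integrals; the mean-square distances to W
    and to W' coincide, as they differ on a null set only. *)
Lemma linear_version_borel (W : X -> X) : linear_version m e D W ->
  exists W' : borel X -> borel X, [/\ measurable_fun setT W',
    exists N : set (borel X), [/\ measurable N, m N = 0%E & forall x, ~ N x -> W' x = W x]
    & mean_square_cvg m (fun n x => D (proj e n x)) W'].
Proof.
move=> [_ mW Wcvg]; have [W' [mW' [N [mN N0 WN]]]] := borel_version sepX mW.
exists W'; split=> //; first by exists N.
rewrite /mean_square_cvg (_ : (fun n => _) =
  (fun n => \int[m]_x (`|D (proj e n x) - W x : X| ^+ 2)%:E)%E)//.
apply/funext => n.
by apply: (integral_eq_off_null mN N0) => x Nx; rewrite WN.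
Qed.

(** <D (proj e n x), h> = <x, z_n> with z_n the sum of <D e_i, h> e_i over i < n, a Gaussian
    variable of variance <Q z_n, z_n>, which is the n-th partial sum; the waves then converge along
    the mean-square limit. *)
Lemma mean_square_limit_wave (W' : borel X -> borel X) (sigma : X -> R) h theta :
  measurable_fun setT W' -> mean_square_cvg m (fun n x => D (proj e n x)) W' ->
  \sum_(i < n) inner (Q (e i)) (e i) * inner (D (e i)) h ^+ 2 @[n --> \oo] --> sigma h ->
  \int[m]_x cos (inner (W' x : X) h + theta) = cos theta * expR (- (sigma h / 2)).
Proof.
move=> mW' cW' sh.
have cW := mean_square_wave sepX (h := h) (theta := theta) measurable_on_proj mW' cW'.
rewrite -(cvg_lim (@Rhausdorff R) cW); apply: (cvg_lim (@Rhausdorff R)).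
pose z n := \sum_(i < n) inner (D (e i)) h *: e i.
rewrite (_ : (fun n => _) = (fun n => cos theta * expR (- (inner (Q (z n)) (z n) / 2)))).
  have zs : - (inner (Q (z n)) (z n) / 2) @[n --> \oo] --> - (sigma h / 2).
    apply: cvgN; apply: cvgMl; rewrite (_ : (fun n => _) =
      (fun n => \sum_(i < n) inner (Q (e i)) (e i) * inner (D (e i)) h ^+ 2))//.
    apply/funext => n.
    exact: (cov_orthosum cQ.1 be (fun i => inner (D (e i)) h)).
  by apply: cvgMr; exact: (cvg_comp _ _ zs (@continuous_expR R _)).
apply/funext => n.
rewrite -[in RHS](add0r theta) -(inner0l (z n)) -(gaussian_wave mG).
apply: eq_Rintegral => x _; congr (cos (_ + _)).
rewrite DprojE inner_suml /z innerC inner_suml.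
by apply: eq_bigr => i _; rewrite !innerZl (innerC (e i)) mulrC.
Qed.

End LinearVersions.

(** * The covariance operators Q(t,s) and Q(t,-oo) *)

Section BilinearBound.
Context (R : realType) (X : hilbertType R).

(** Homogeneity reduces to unit vectors, where |x|^2 + |y|^2 = 2. *)
Lemma bilinear_bound (b : X -> X -> R) (C : R) :
  (forall a x y z, b (a *: x + y) z = a * b x z + b y z) ->
  (forall x y, b x y = b y x) ->
  (forall x y, `|b x y| <= C * (`|x| ^+ 2 + `|y| ^+ 2)) ->
  forall x y, `|b x y| <= C * 2 * (`|x| * `|y|).
Proof.
move=> bl bC bB x y.
have b0 z : b 0 z = 0.
  by have := bl (-1) 0 0 z; rewrite scaler0 addr0 mulN1r addNr.
have bZl a u v : b (a *: u) v = a * b u v.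
  by have := bl a u 0 v; rewrite addr0 b0 addr0.
have bZr a u v : b u (a *: v) = a * b u v by rewrite bC bZl bC.
have [->|x0] := eqVneq x 0; first by rewrite b0 !normr0 mul0r mulr0.
have [->|y0] := eqVneq y 0; first by rewrite bC b0 !normr0 !mulr0.
have xp : 0 < `|x| by rewrite normr_gt0.
have yp : 0 < `|y| by rewrite normr_gt0.
have := bB (`|x|^-1 *: x) (`|y|^-1 *: y).
rewrite bZl bZr !normrM !normrZ !normfV !normr_id !mulVf ?normr_eq0//.
by rewrite expr1n mulrA -invfM mulrC ler_pdivrMr ?mulr_gt0.
Qed.

End BilinearBound.

Section NoiseIntegral.
Context (R : realType) (X : hilbertType R) (sepX : separable X).
Context (U : R -> R -> X -> X) (B : R -> X -> X).
Hypotheses (hU : evolution_operator U) (hB : bounded_measurable_family B).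
Implicit Types (r s t : R) (x y h : X).
Local Notation leb := (@lebesgue_measure R).

Lemma evolution_bounded s t : s <= t -> bounded_operator (U t s).
Proof. by have [bU _ _ _] := hU; exact: bU. Qed.

Lemma noise_bounded r : bounded_operator (B r).
Proof. by have [bB _ _] := hB; exact: bB. Qed.

(** The covariances are integrals over r of the Gram forms of these operators, which makes their
    symmetry and positivity visible. *)
Definition dual_noise t r x : X :=
  adjoint whole whole (B r) (adjoint whole whole (U t r) x).

Lemma noise_integrand t r x h : r <= t ->
  inner (U t r (B r (dual_noise t r x))) h = inner (dual_noise t r x) (dual_noise t r h).
Proof.
move=> rt; rewrite (inner_adjoint sepX _ _ (evolution_bounded rt)).
by rewrite (inner_adjoint sepX _ _ (noise_bounded r)).
Qed.

Lemma dual_noise_linear t r : r <= t -> linear (dual_noise t r).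
Proof.
move=> rt; apply: (linear_comp (A := adjoint whole whole (B r))).
  exact: (adjoint_linear sepX (noise_bounded r)).
exact: (adjoint_linear sepX (evolution_bounded rt)).
Qed.

Let past t : set R := [set` `]-oo, t]].

Lemma evolution_continuous t x : {within past t, continuous (fun r => U t r x)}.
Proof.
have [_ cU _ _] := hU.
apply/subspace_continuousP => r rt.
have /subspace_continuousP/(_ (r, t)) := cU x.
have rt' : r <= t by move: rt; rewrite /past/= in_itv.
move=> /(_ rt') cUr.
have pair_cvg : (fun r' => (r', t)) @ within (past t) (nbhs r) -->
    within [set st : R * R | st.1 <= st.2] (nbhs (r, t)).
  move=> S [[P P'] /= [Pr P't] PS]; apply: filterS Pr => r' Pr' r't.
  apply: (PS (r', t)) => /=; first by split=> //; exact: nbhs_singleton P't.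
  by move: r't; rewrite /past/= in_itv.
exact: (cvg_comp _ _ pair_cvg cUr).
Qed.

(** Measurability in r is available only for pairings of U(t,r) and B(r) with fixed vectors;
    Parseval's expansion writes the products of two r-dependent vectors as limits of sums of such
    pairings. *)
Lemma dual_noise_measurable t x y :
  measurable_fun (past t) (fun r => inner (dual_noise t r x) (dual_noise t r y)).
Proof.
have [f bf] := orthonormal_basis_exists sepX.
have mpast : measurable (past t) by exact: measurable_itv.
have mU z w : measurable_fun (past t) (fun r => inner (adjoint whole whole (U t r) z) w).
  apply: (@eq_measurable_fun _ _ _ _ _ (fun r => inner z (U t r w))).
    move=> r /set_mem rt; rewrite [RHS]innerC -inner_adjoint//; first exact: innerC.
    by apply: evolution_bounded; move: rt; rewrite /past/= in_itv.
  apply: subspace_continuous_measurable_fun => //.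
  apply/subspace_continuousP => r rt; apply: cvg_innerr.
  by have /subspace_continuousP := @evolution_continuous t w; apply.
have mB z w : measurable_fun setT (fun r => inner (B r z) w).
  have [_ _ /(_ z) [_ mBz]] := hB.
  exact: (measurableT_comp (@measurable_inner R X w) mBz).
have mV z w : measurable_fun (past t) (fun r => inner (dual_noise t r z) w).
  apply: (@eq_measurable_fun _ _ _ _ _
      (fun r => inner (adjoint whole whole (U t r) z) (B r w))).
    move=> r _; rewrite [RHS]innerC /dual_noise -inner_adjoint; first exact: innerC.
      by [].
    exact: noise_bounded.
  apply: (@measurable_fun_cvg _ _ _ _ (fun n r => \sum_(i < n)
      inner (adjoint whole whole (U t r) z) (f i) * inner (B r w) (f i))).
    move=> n; apply: measurable_sum => i; apply: measurable_funM => //.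
    exact: measurable_funTS.
  by move=> r _; exact: parseval.
apply: (@measurable_fun_cvg _ _ _ _ (fun n r => \sum_(i < n)
    inner (dual_noise t r x) (f i) * inner (dual_noise t r y) (f i))).
  by move=> n; apply: measurable_sum => i; exact: measurable_funM.
by move=> r _; exact: parseval.
Qed.

(** Strong continuity on the compact segment bounds each orbit r -> U(t,r) x, and the uniform
    boundedness principle turns this into a bound on the operator norms; B is bounded by
    assumption. *)
Lemma dual_noise_bound s t : exists2 C, 0 <= C &
  forall r x, s <= r <= t -> `|dual_noise t r x| <= C * `|x|.
Proof.
pose F := [set U t r | r in [set` `[s, t]]].
have Fb f : F f -> bounded_fun_norm f /\ linear f.
  move=> [r]; rewrite /= in_itv/= => /andP[sr rt] <-.
  have bU := evolution_bounded rt; split; last exact: bU.1.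
  have [C C0 UC] := bounded_operator_norm bU => q.
  by exists (C * q) => x xq; rewrite (le_trans (UC x))// ler_wpM2l.
have Fp : pointwise_bounded F.
  move=> x.
  have cst : {within [set` `[s, t]], continuous (fun r => U t r x)}.
    apply: continuous_subspaceW (@evolution_continuous t x) => r /=.
    by rewrite /past/= !in_itv/= => /andP[].
  have /compact_bounded[M [_ MF]] := continuous_compact cst (segment_compact (a := s) (b := t)).
  exists (M + 1) => f [r rst <-]; apply: (MF (M + 1)); first by rewrite ltrDl.
  by exists r.
have [M MF] := Banach_Steinhauss Fb Fp 1.
have [_ [MB BMB] _] := hB.
have M0 : forall r x, s <= r <= t -> `|U t r x| <= `|M| * `|x|.
  move=> r x /andP[sr rt]; have bU := evolution_bounded rt.
  have [->|x0] := eqVneq x 0; first by rewrite (linear_map0 bU.1) !normr0 mulr0.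
  have := MF (U t r) _ (`|x|^-1 *: x).
  rewrite (linear_mapZ bU.1) !normrZ normfV normr_id mulVf ?normr_eq0// lexx.
  rewrite mulrC ler_pdivrMr ?normr_gt0// => /(_ _ isT) UM.
  rewrite (le_trans (UM _))//; first by exists r => //=; rewrite in_itv/= sr rt.
  by rewrite ler_wpM2r// ler_norm.
exists (`|MB| * `|M|) => [|r x srt]; first by rewrite mulr_ge0.
have /andP[sr rt] := srt.
rewrite /dual_noise -mulrA.
have h1 z : `|adjoint whole whole (B r) z| <= `|MB| * `|z|.
  apply: (adjoint_norm sepX (noise_bounded r)) => // w.
  by rewrite (le_trans (BMB r w))// ler_wpM2r// ler_norm.
rewrite (le_trans (h1 _))// ler_wpM2l//.
by apply: (adjoint_norm sepX (evolution_bounded rt)) => // w; exact: M0.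
Qed.

Section OnASet.
Context (t : R) (D : set R) (mD : @measurable _ (measurableTypeR R) D) (Dt : D `<=` past t).
Context (C : R) (C0 : 0 <= C).
(** On a segment this comes from local boundedness, and on a half-line from the uniform bound on
    traces. *)
Hypothesis energy : forall x,
  (\int[leb]_(r in D) (`|dual_noise t r x| ^+ 2)%:E <= (C * `|x| ^+ 2)%:E)%E.

Let b x y := \int[leb]_(r in D) inner (dual_noise t r x) (dual_noise t r y).

Let mV x y : measurable_fun D (fun r => inner (dual_noise t r x) (dual_noise t r y)).
Proof.
exact: (measurable_funS (measurable_itv _) Dt (@dual_noise_measurable t x y)).
Qed.

Let mN x : measurable_fun D (fun r => `|dual_noise t r x| ^+ 2).
Proof. by under eq_fun do rewrite -inner_norm; exact: mV. Qed.

Let intN x : leb.-integrable D (fun r => (`|dual_noise t r x| ^+ 2)%:E).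
Proof.
apply/integrableP; split; first by apply/measurable_EFinP; exact: mN.
apply: (@le_lt_trans _ _ (C * `|x| ^+ 2)%:E); last exact: ltry.
apply: le_trans (energy x); rewrite le_eqVlt; apply/orP; left; apply/eqP.
by apply: eq_integral => r _; rewrite gee0_abs// lee_fin sqr_ge0.
Qed.

Let amgm r x y : `|inner (dual_noise t r x) (dual_noise t r y)| <=
  `|dual_noise t r x| ^+ 2 + `|dual_noise t r y| ^+ 2.
Proof.
rewrite (le_trans (cauchy_schwarz _ _))//.
have := sqr_ge0 (`|dual_noise t r x| - `|dual_noise t r y|).
have := sqr_ge0 (`|dual_noise t r x|); have := sqr_ge0 (`|dual_noise t r y|).
nra.
Qed.

Let intV x y :
  leb.-integrable D (fun r => (inner (dual_noise t r x) (dual_noise t r y))%:E).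
Proof.
have := integrableD mD (intN x) (intN y); apply: le_integrable => //.
  by apply/measurable_EFinP; exact: mV.
move=> r _; rewrite -EFinD/= lee_fin (le_trans (amgm _ _ _))//.
exact: ler_norm.
Qed.

Let b_linear a x y z : b (a *: x + y) z = a * b x z + b y z.
Proof.
rewrite /b -RintegralZl//; last exact: intV.
rewrite -RintegralD//; first last.
- exact: intV.
- by have := integrableZl mD a (intV x z).
apply: eq_Rintegral => r /set_mem/Dt; rewrite /past/= in_itv/= => rt.
by rewrite dual_noise_linear// inner_linear.
Qed.

Let b_sym x y : b x y = b y x.
Proof. by apply: eq_Rintegral => r _; rewrite innerC. Qed.

Let b_bound x y : `|b x y| <= C * (`|x| ^+ 2 + `|y| ^+ 2).
Proof.
rewrite (le_trans (le_normr_Rintegral mD (intV x y)))//.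
have iN := integrableD mD (intN x) (intN y).
rewrite (@le_trans _ _ (\int[leb]_(r in D)
    (`|dual_noise t r x| ^+ 2 + `|dual_noise t r y| ^+ 2)))//.
  by apply: le_Rintegral => //; have := integrable_abse (intV x y).
have eN z : \int[leb]_(r in D) `|dual_noise t r z| ^+ 2 <= C * `|z| ^+ 2.
  rewrite -lee_fin /Rintegral fineK; first exact: energy.
  by apply: (integrable_fin_num mD); exact: intN.
by rewrite (RintegralD mD (intN x) (intN y)) mulrDr lerD.
Qed.

(** The form b is bounded by [bilinear_bound], so Riesz' theorem represents it by an operator; this
    provides the vector that [vintegral] selects and excludes its default value 0. *)
Lemma noise_integralP : nonneg_operator whole (noise_integral U B t D) /\
  forall x h, inner (noise_integral U B t D x) h =
    \int[leb]_(r in D) inner (dual_noise t r x) (dual_noise t r h).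
Proof.
have bb := bilinear_bound b_linear b_sym b_bound.
have bE x h : \int[leb]_(r in D) inner (U t r (B r (dual_noise t r x))) h = b x h.
  apply: eq_Rintegral => r /set_mem/Dt; rewrite /past/= in_itv/= => rt.
  exact: noise_integrand.
have NE x h : inner (noise_integral U B t D x) h = b x h.
  rewrite /noise_integral /vintegral.
  case: xgetP => [v _ vE|]; first by rewrite (vE h).2 bE.
  have [v vE] : exists v, forall h, inner v h = b x h.
    apply: (riesz sepX (C := C * 2 * `|x|)) => [a y z|y].
      by rewrite b_sym b_linear !(b_sym x).
    by rewrite -mulrA.
  move=> /(_ v)[] k; split; last by rewrite vE bE.
  have := intV x k; apply: eq_integrable => // r /set_mem/Dt.
  rewrite /past/= in_itv/= => rt; congr EFin.
  exact/esym/noise_integrand.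
split=> //; apply/nonneg_whole; split.
- by move=> a x y; apply: inner_ext => h; rewrite innerDl innerZl !NE b_linear.
- exists (C * 2) => [|x]; first by rewrite mulr_ge0.
  apply: norm_le_inner; first by rewrite !mulr_ge0.
  by rewrite NE -mulrA (le_trans (ler_norm _)).
- by move=> x y; rewrite NE b_sym innerC NE.
- by move=> x; rewrite NE; apply: Rintegral_ge0 => r _; exact: inner_ge0.
Qed.

Lemma noise_integral_energy x :
  (inner (noise_integral U B t D x) x)%:E =
  (\int[leb]_(r in D) (`|dual_noise t r x| ^+ 2)%:E)%E.
Proof.
rewrite noise_integralP.2 /Rintegral fineK; last exact: integrable_fin_num.
by apply: eq_integral => r _; rewrite inner_norm.
Qed.

End OnASet.

End NoiseIntegral.

Section TraceBound.
Context (R : realType) (X : hilbertType R) (sepX : separable X).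

(** With J the root of Q and (b_i) the trace basis, <Q x, x> = |J x|^2 is the sum of <x, J b_i>^2,
    at most |x|^2 times the sum of |J b_i|^2 = <Q b_i, b_i>. *)
Lemma quadratic_le_trace (Q : X -> X) (C : R) : nonneg_operator whole Q ->
  (trace Q <= C%:E)%E -> forall x, inner (Q x) x <= C * `|x| ^+ 2.
Proof.
move=> nQ trQ x; have bt := trace_basisP sepX.
have pQ y : 0 <= inner (Q y) y by have [_ _ _] := (nonneg_whole Q).1 nQ; exact.
rewrite -root_norm// -inner_norm; set J := sqrt_operator whole Q.
have : \sum_(i < n) inner (J x) (trace_basis X i) * inner (J x) (trace_basis X i)
    @[n --> \oo] --> inner (J x) (J x) by exact: parseval.
move=> /cvgr_to_le; apply; apply: nearW => n.
apply: (@le_trans _ _ (\sum_(i < n)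
    inner (Q (trace_basis X i)) (trace_basis X i) * `|x| ^+ 2)).
  apply: ler_sum => i _; rewrite -expr2 /J root_sym// -[leLHS]real_normK ?num_real//.
  rewrite -root_norm// -exprMn ler_pXn2r ?nnegrE ?mulr_ge0//.
  by rewrite mulrC cauchy_schwarz.
rewrite -mulr_suml ler_wpM2r ?sqr_ge0// -lee_fin.
exact: le_trans (sum_le_trace n pQ) trQ.
Qed.

End TraceBound.

Section NoiseCovariances.
Context (R : realType) (X : hilbertType R) (sepX : separable X).
Context (U : R -> R -> X -> X) (B : R -> X -> X).
Hypotheses (hU : evolution_operator U) (hB : bounded_measurable_family B).
Implicit Types (r s t : R) (x y h : X).
Local Notation leb := (@lebesgue_measure R).
Let V := dual_noise U B.

Let mitv (i : interval R) : @measurable _ (measurableTypeR R) [set` i].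
Proof. exact: measurable_itv. Qed.

Let past_sub s t : [set` `[s, t]] `<=` [set` `]-oo, t]].
Proof. by move=> r /=; rewrite !in_itv/= => /andP[]. Qed.

Let mV t x : @measurable_fun _ _ (measurableTypeR R) _ [set` `]-oo, t]]
  (fun r => (`|V t r x| ^+ 2)%:E).
Proof.
rewrite (_ : (fun r => _) = EFin \o (fun r => inner (V t r x) (V t r x))).
  by apply/measurable_EFinP; exact: dual_noise_measurable.
by apply/funext => r /=; rewrite inner_norm.
Qed.

Lemma energy_segment s t : exists2 C, 0 <= C & forall x,
  (\int[leb]_(r in [set` `[s, t]]) (`|V t r x| ^+ 2)%:E <= (C * `|x| ^+ 2)%:E)%E.
Proof.
have [K K0 VK] := dual_noise_bound sepX hU hB s t.
exists (K ^+ 2 * fine (leb [set` `[s, t]])) => [|x].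
  by rewrite mulr_ge0 ?sqr_ge0// fine_ge0.
apply: (@le_trans _ _ (\int[leb]_(r in [set` `[s, t]]) (K ^+ 2 * `|x| ^+ 2)%:E)%E).
  apply: ge0_le_integral => //.
  - exact: (measurable_funS (mitv _) (@past_sub s t) (@mV t x)).
  - move=> r /=; rewrite in_itv/= => srt.
    by rewrite lee_fin -exprMn ler_pXn2r ?nnegrE ?mulr_ge0// VK.
have fin : leb [set` `[s, t]] \is a fin_num.
  by rewrite lebesgue_measure_itv/=; case: ifP.
rewrite integral_cst//= -[X in (_ * X <= _)%E](fineK fin) -EFinM.
by rewrite lee_fin [leRHS]mulrAC.
Qed.

Lemma segmentP s t : nonneg_operator whole (Qcov U B t s) /\
  forall x, (inner (Qcov U B t s x) x)%:E =
    (\int[leb]_(r in [set` `[s, t]]) (`|V t r x| ^+ 2)%:E)%E.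
Proof.
have [C C0 VC] := energy_segment s t.
have past := @past_sub s t.
split; first exact: (noise_integralP sepX hU hB (mitv _) past C0 VC).1.
by move=> x; rewrite (noise_integral_energy sepX hU hB (mitv _) past C0 VC).
Qed.

Hypotheses (htr : finite_trace U B) (hst : stable U B).

Lemma Qcov_covariance s t : s < t -> covariance_operator (Qcov U B t s).
Proof. by move=> st; split; [exact: (segmentP s t).1|exact: htr]. Qed.

Lemma trace_Qcov_bounded t : exists2 C, 0 <= C &
  forall s, s < t -> (trace (Qcov U B t s) <= C%:E)%E.
Proof.
have [supT _] := hst t; set S := ereal_sup _ in supT.
have pQ s y : 0 <= inner (Qcov U B t s y) y.
  by have [_ _ _] := (nonneg_whole _).1 (segmentP s t).1; exact.
have leS s : s < t -> (trace (Qcov U B t s) <= S)%E.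
  by move=> st; apply: ereal_sup_ubound; exists s => //=; rewrite in_itv.
have S0 : (0 <= S)%E.
  apply: le_trans (leS (t - 1) _); last by rewrite gtrBl.
  by have := sum_le_trace 0 (pQ (t - 1)); rewrite big_ord0.
exists (fine S); first exact: fine_ge0.
by move=> s st; rewrite fineK ?leS// ge0_fin_numE.
Qed.

Let pastE t : [set` `]-oo, t]] = \bigcup_(n : nat) [set` `[t - n.+1%:R, t]] :> set R.
Proof.
apply/seteqP; split=> [r /=|r [n _] /=]; last by rewrite !in_itv/= => /andP[].
rewrite in_itv/= => rt; exists (Num.trunc (t - r)) => //=.
rewrite in_itv/= rt andbT lerBlDr -lerBlDl.
by rewrite ltW// truncnS_gt.
Qed.

Let segment_cvg t x :
  (\int[leb]_(r in [set` `[(t - n.+1%:R)%R, t]]) (`|V t r x| ^+ 2)%:E)%E @[n --> \oo] -->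
  (\int[leb]_(r in [set` `]-oo, t]]) (`|V t r x| ^+ 2)%:E)%E.
Proof.
rewrite pastE; apply: ge0_nondecreasing_set_cvg_integral => //.
- move=> m n mn; apply/subsetPset => r /=; rewrite !in_itv/= => /andP[rm ->].
  by rewrite andbT (le_trans _ rm)// lerD2l lerN2 ler_nat.
- by move=> n; exact: (measurable_funS (mitv _) (@past_sub _ t) (@mV t x)).
Qed.

(** The trace bounds the quadratic form of Q(t, t - n - 1) uniformly in n, and monotone convergence
    exhausts the half-line. *)
Lemma energy_past t : exists2 C, 0 <= C & forall x,
  (\int[leb]_(r in [set` `]-oo, t]]) (`|V t r x| ^+ 2)%:E <= (C * `|x| ^+ 2)%:E)%E.
Proof.
have [C C0 trC] := trace_Qcov_bounded t; exists C => // x.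
have /cvge_to_le := @segment_cvg t x; apply; apply: nearW => n.
rewrite -(segmentP _ _).2 lee_fin; apply: (quadratic_le_trace sepX).
  exact: (segmentP _ _).1.
by apply: trC; rewrite gtrBl.
Qed.

Lemma pastP t : nonneg_operator whole (Qinf U B t) /\
  forall x, (inner (Qinf U B t x) x)%:E =
    (\int[leb]_(r in [set` `]-oo, t]]) (`|V t r x| ^+ 2)%:E)%E.
Proof.
have [C C0 VC] := energy_past t.
split; first exact: (noise_integralP sepX hU hB (mitv _) (@subset_refl _ _) C0 VC).1.
by move=> x; rewrite (noise_integral_energy sepX hU hB (mitv _) (@subset_refl _ _) C0 VC).
Qed.

Lemma Qinf_covariance t : covariance_operator (Qinf U B t).
Proof.
have [nQ QE] := pastP t; split=> //.
have [C C0 trC] := trace_Qcov_bounded t.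
apply: (@le_lt_trans _ _ C%:E); last exact: ltry.
apply: trace_le => [|n]; first by have [_ _ _] := (nonneg_whole _).1 nQ.
pose b i : X := trace_basis X i.
have cvgQ x : inner (Qcov U B t (t - n0.+1%:R) x) x @[n0 --> \oo] -->
              inner (Qinf U B t x) x.
  have := @segment_cvg t x; rewrite -QE => /fine_cvg; apply: cvg_trans.
  by apply: near_eq_cvg; apply: nearW => k /=; rewrite -(segmentP _ _).2.
have : \sum_(i < n) inner (Qcov U B t (t - k.+1%:R) (b i)) (b i) @[k --> \oo] -->
       \sum_(i < n) inner (Qinf U B t (b i)) (b i).
  by apply: cvg_big => [|i _]; [exact: add_continuous|exact: cvgQ].
move=> /cvgr_to_le; apply; apply: nearW => k; rewrite -lee_fin.
have st : t - k.+1%:R < t by rewrite gtrBl.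
apply: le_trans (trC _ st); apply: sum_le_trace.
by have [_ _ _] := (nonneg_whole _).1 (segmentP (t - k.+1%:R) t).1.
Qed.

(** The half-line is cut at s. For r <= s, U(t,r) = U(t,s) U(s,r), so [V t r x] is [V s r] evaluated
    at the adjoint of U(t,s) applied to x. *)
Lemma Qinf_decomposition s t x : s <= t ->
  inner (Qinf U B t x) x =
  inner (Qinf U B s (adjoint whole whole (U t s) x)) (adjoint whole whole (U t s) x) +
  inner (Qcov U B t s x) x.
Proof.
move=> st; apply/EFin_inj; rewrite EFinD (pastP t).2 (pastP s).2 (segmentP s t).2.
have -> : [set` `]-oo, t]] = [set` `]-oo, s]] `|` [set` `]s, t]] :> set R.
  apply: itv_bndbnd_setU => //; by rewrite bnd_simp.
have pos r : (0 <= (`|V t r x| ^+ 2)%:E)%E by rewrite lee_fin sqr_ge0.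
have mst : @measurable_fun _ _ (measurableTypeR R) _ [set` `]s, t]]
    (fun r => (`|V t r x| ^+ 2)%:E).
  apply: (measurable_funS (mitv _) _ (@mV t x)).
  by move=> r /=; rewrite !in_itv/= => /andP[].
rewrite ge0_integral_setU//; first last.
- apply/disj_setPS => r [] /=; rewrite !in_itv/= => rs /andP[sr _].
  by move: sr; rewrite ltNge rs.
- apply: (measurable_funS (mitv _) _ (@mV t x)).
  move=> r [] /=; rewrite !in_itv/=; last by case/andP.
  by move=> rs; exact: le_trans st.
(* The cut leaves the interval open at s, whereas [Qcov] integrates over the closed one; the
   endpoint is a null set. *)
congr (_ + _)%E; last exact: integral_itv_obnd_cbnd.
apply: eq_integral => r /set_mem; rewrite /= in_itv/= => rs.
congr (_ ^+ 2)%:E; congr `|_|; congr adjoint.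
apply: inner_ext => h.
have bts := evolution_bounded hU st; have bsr := evolution_bounded hU rs.
have btr := evolution_bounded hU (le_trans rs st).
have [_ _ _ UU] := hU.
rewrite innerC -(inner_adjoint sepX _ _ btr) -(UU r s t)//.
by rewrite (inner_adjoint sepX _ _ bts) (inner_adjoint sepX _ _ bsr) innerC.
Qed.

End NoiseCovariances.

(** * The splitting of a Gaussian measure *)

Section GaussianFactorization.
Context (R : realType) (X : hilbertType R) (sepX : separable X).
Context (Q1 Q2 : X -> X) (e1 e2 : nat -> X) (m1 m2 : probability (borel X) R).
Hypotheses (cQ1 : covariance_operator Q1) (be1 : eigenbasis Q1 e1).
Hypotheses (cQ2 : covariance_operator Q2) (be2 : eigenbasis Q2 e2).
Hypotheses (G1 : is_gaussian m1 0 Q1) (G2 : is_gaussian m2 0 Q2).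
Context (A : X -> X) (bA : bounded_operator A).
Let A' := adjoint whole whole A.
Hypothesis dominated : forall x, inner (Q1 (A' x)) (A' x) <= inner (Q2 x) x.
Implicit Types (x y z h k : X) (theta : R) (V W : X -> X).
Let H1 := cameron_martin Q1.
Let H2 := cameron_martin Q2.
Let L := adjoint H1 H2 A.
Let T := adjoint H2 H1 L.
Let D := defect H2 H1 L.

(** In the application A = U(t,s), and Q1, Q2 are the covariances at times s and t. T is an adjoint
    chosen pointwise and is known on H1 only, which is where the maps [T \o proj e1 n] evaluate
    it. *)
Let TE h : carrier H1 h -> T h = A h.
Proof. exact: (adjoint_dominated sepX cQ1.1 be1 cQ2.1 be2 bA dominated). Qed.

Let T_linear a h k : carrier H1 h -> carrier H1 k -> T (a *: h + k) = a *: T h + T k.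
Proof.
move=> H1h H1k; rewrite !TE//; last exact: carrier_linear cQ1.1 _ _ _ H1h H1k.
by rewrite bA.1.
Qed.

Let D_linear a h k : carrier H2 h -> carrier H2 k -> D (a *: h + k) = a *: D h + D k.
Proof.
have [[[C [_ lD _]] _ _] _] :=
  defectP sepX cQ1.1 be1 cQ2.1 be2 bA dominated.
exact: lD.
Qed.

Let mA : measurable_fun setT (A : borel X -> borel X).
Proof. exact: continuous_borel_borel bA.2. Qed.

Let A_cvg : mean_square_cvg m1 (fun n x => T (proj e1 n x)) A.
Proof.
rewrite /mean_square_cvg (_ : (fun n => _) =
  (fun n => \int[m1]_x (`|A (proj e1 n x) - A x : X| ^+ 2)%:E)%E).
  exact: (gaussian_operator_cvg sepX cQ1 be1 G1 bA).
apply/funext => n; apply: eq_integral => x _.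
by rewrite TE//; exact: (carrier_proj cQ1.1 be1).
Qed.

Lemma dominated_linear_version : linear_version m1 e1 T A.
Proof.
split; [exact: bA.1| |exact: A_cvg].
move=> S mS; exists (A @^-1` S); first by rewrite -[_ @^-1` _]setTI; exact: mA.
by exists set0; [exact: negligible_set0|rewrite setU0].
Qed.

Lemma linear_version_ae V : linear_version m1 e1 T V ->
  exists M : set (borel X), [/\ measurable M, m1 M = 0%E & forall x, ~ M x -> V x = A x].
Proof.
move=> /(linear_version_borel sepX)[V' [mV' [M [mM M0 VM]] cV']].
have mT := measurable_on_proj sepX cQ1 be1 T_linear.
have [M' [mM' M'0 M'P]] := mean_square_unique sepX mT mV' mA cV' A_cvg.
exists (M `|` M'); split; first exact: measurableU.
  by rewrite measureU0.
move=> x /not_orP[Mx M'x]; rewrite -VM//.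
by apply: contra_notP M'x => VA; exact: M'P.
Qed.

(** Let E = V - A, null almost everywhere. For k in the range of the adjoint of E, <x, k> = 0 almost
    everywhere, so the characteristic function at k is 1 and Q1 k = 0. Hence E Q1 = 0, so E kills
    the eigenvectors, then H1 and its closure by continuity. *)
Lemma linear_version_bounded V : linear_version m1 e1 T V -> bounded_operator V ->
  forall x, closure (carrier H1) x -> V x = A x.
Proof.
move=> vV bV; have [M [mM M0 VM]] := linear_version_ae vV.
pose E x := V x - A x.
have lE : linear E.
  by move=> a x y; rewrite /E bV.1 bA.1 scalerBr opprD !addrA; congr (_ + _); rewrite addrAC.
have cE : continuous E.
  by move=> x; apply: cvgB; [exact: bV.2|exact: bA.2].
have bE : bounded_operator E by split.
have EQ x : E (Q1 x) = 0.
  apply: inner_ext => y; rewrite inner0l (inner_adjoint sepX _ _ bE).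
  set k := adjoint whole whole E y.
  suff kQ : inner (Q1 k) k = 0.
    have -> : inner (Q1 x) k = inner x (Q1 k).
      by have [_ _ + _] := (nonneg_whole Q1).1 cQ1.1; exact.
    have : kernel (sqrt_operator whole Q1) k.
      have := root_norm cQ1.1 k; rewrite kQ => /eqP.
      by rewrite sqrf_eq0 normr_eq0 => /eqP.
    by rewrite (kernel_root cQ1.1) => ->; rewrite inner0r.
  have := gaussian_wave G1 k 0; rewrite inner0l addr0 cos0 mul1r.
  rewrite (_ : \int[m1]_x0 _ = 1).
    by move=> /esym/(congr1 (@ln R)); rewrite expRK ln1; lra.
  rewrite -[RHS](Rintegral_cst1 m1); congr fine.
  apply: (integral_eq_off_null mM M0) => z Mz; congr EFin.
  by rewrite -(inner_adjoint sepX _ _ bE) /E VM// subrr inner0l add0r cos0.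
have clE : closed [set x | E x = 0].
  have := @closed_comp _ _ E [set 0]; apply; first by move=> x _; exact: cE.
  exact: accessible_closed_set1 (hausdorff_accessible (@norm_hausdorff _ _)) _.
have eE i : E (e1 i) = 0.
  have [/(eigenvalue_eq0 cQ1.1 be1) ->|l0] := eqVneq (inner (Q1 (e1 i)) (e1 i)) 0.
    exact: linear_map0.
  rewrite (_ : e1 i = (inner (Q1 (e1 i)) (e1 i))^-1 *: Q1 (e1 i)); last first.
    by rewrite [X in _ *: X](eigenvector be1) scalerA mulVf// scale1r.
  by rewrite linear_mapZ// EQ scaler0.
move=> x H1x; apply/eqP; rewrite -subr_eq0; apply/eqP.
have /closure_id clE' := clE.
rewrite -/(E x); have : closure [set x | E x = 0] x; last by rewrite -clE'.
apply: closureS H1x => h [z _ <-] /=.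
have K := root_compl cQ1.1 z.
apply: (closed_cvg (fun x => E x = 0) clE _ _ (eigenbasis_cvg cQ1.1 be1 K)).
apply: nearW => n; rewrite /proj; elim: n => [|n IH].
  by rewrite big_ord0 linear_map0.
by rewrite big_ord_recr/= addrC lE eE IH scaler0 addr0.
Qed.

(** Stands for the quadratic form of Q(t,s), the only trace that operator leaves in a characteristic
    function. *)
Context (kap : X -> R).
Hypothesis kapE : forall x, inner (Q2 x) x = inner (Q1 (A' x)) (A' x) + kap x.

Lemma shifted_wave W' x h theta : measurable_fun setT (W' : borel X -> borel X) ->
  mean_square_cvg m2 (fun n x => D (proj e2 n x)) W' ->
  \int[m2]_y cos (inner (A x + W' y) h + theta) =
  cos (inner (A x) h + theta) * expR (- (kap h / 2)).
Proof.
move=> mW' cW'.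
under eq_Rintegral do rewrite innerDl (addrC (inner (A x) h)) -addrA.
apply: (mean_square_limit_wave sepX cQ2 be2 G2 D_linear (sigma := kap)) => //.
rewrite (_ : kap h = inner (Q2 h) h - inner (Q1 (A' h)) (A' h)).
  exact: (defect_variance sepX cQ1.1 be1 cQ2.1 be2 bA dominated).
by rewrite kapE addrAC subrr add0r.
Qed.

Lemma convolved_wave W' h theta : measurable_fun setT (W' : borel X -> borel X) ->
  mean_square_cvg m2 (fun n x => D (proj e2 n x)) W' ->
  \int[m1]_x \int[m2]_y cos (inner (A x + W' y) h + theta) =
  cos theta * expR (- (inner (Q2 h) h / 2)).
Proof.
move=> mW' cW'; under eq_Rintegral do rewrite shifted_wave// mulrC.
rewrite Rintegral_bmZ; last first.
  apply: bounded_measurable_cos; apply: measurable_funD => //.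
  exact: measurableT_comp (@measurable_inner R X h) mA.
under eq_Rintegral do rewrite (inner_adjoint sepX _ _ bA).
rewrite (gaussian_wave G1) inner0l add0r kapE mulrC -mulrA -expRD -/A'.
by congr (_ * expR _); rewrite mulrDl opprD.
Qed.

Context (N : X -> (X -> X) -> probability (borel X) R) (hN : gaussian_family N).

Lemma shifted_law W' (m : probability (borel X) R) x (f : borel X -> R) :
  measurable_fun setT (W' : borel X -> borel X) ->
  mean_square_cvg m2 (fun n x => D (proj e2 n x)) W' ->
  (forall h theta, \int[m]_y cos (inner y h + theta) =
    cos (inner (A x) h + theta) * expR (- (kap h / 2))) ->
  measurable_fun setT f -> \int[m]_y f y = \int[m2]_y f (A x + W' y).
Proof.
move=> mW' cW' mwave mf.
pose phi (y : borel X) : borel X := A x + W' y.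
have mphi : measurable_fun setT phi by exact: measurable_borelD.
have [P PE] := law_exists m2 mphi.
rewrite -[RHS](Rintegral_law mphi PE)//.
congr fine; apply: eq_measure_integral => S mS _.
apply: (fourier_uniqueness sepX hN) => // h theta.
rewrite mwave (Rintegral_law mphi PE).
  exact/esym/shifted_wave.
exact: (bounded_measurable_cos (measurable_funD (measurable_inner h) (measurable_cst _))).1.
Qed.

Lemma convolved_law W' (S : set (borel X)) :
  measurable_fun setT (W' : borel X -> borel X) ->
  mean_square_cvg m2 (fun n x => D (proj e2 n x)) W' -> measurable S ->
  m2 S = (m1 \x m2)%E ((fun z : borel X * borel X => (A z.1 + W' z.2 : X) : borel X) @^-1` S).
Proof.
move=> mW' cW' mS.
pose phi (z : borel X * borel X) : borel X := A z.1 + W' z.2.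
have mphi : measurable_fun setT phi.
  apply: (measurable_borelD sepX).
    exact: measurableT_comp mA (@measurable_fst _ _ _ _).
  exact: measurableT_comp mW' (@measurable_snd _ _ _ _).
have [P PE] := law_exists (m1 \x m2)%E mphi.
rewrite -(PE _ mS); apply: (fourier_uniqueness sepX hN) => // h theta.
have bwave := bounded_measurable_cos
  (measurable_funD (measurable_inner h) (measurable_cst theta)).
rewrite (Rintegral_law mphi PE); last exact: bwave.1.
have bphi : bounded_measurable
    (fun z : borel X * borel X => cos (inner (phi z : X) h + theta)).
  by split; [exact: measurableT_comp bwave.1 mphi|exists 1 => z; exact: cos_max].
rewrite (gaussian_wave G2) inner0l add0r -(@convolved_wave W')//.
exact/esym/(Rintegral_prod m1 m2 bphi).
Qed.

End GaussianFactorization.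

(** * Averages on L^p spaces *)

Section LpFacts.
Context d (T : measurableType d) (R : realType) (P : probability T R).
Implicit Types (f g : T -> R) (p : R).

Lemma measurable_powR_norm p f : measurable_fun setT f ->
  measurable_fun setT (fun x => (`|f x| `^ p)%:E).
Proof.
move=> mf; apply/measurable_EFinP.
apply: (@measurableT_comp _ _ _ _ _ _ (@powR R ^~ p)); first exact: measurable_powR.
exact: measurableT_comp.
Qed.

Lemma powR_LnormE p f : 1 <= p ->
  ('N[P]_p%:E[EFin \o f] `^ p = \int[P]_x (`|f x| `^ p)%:E)%E.
Proof. by move=> p1; rewrite powR_Lnorm// gt_eqF// (lt_le_trans ltr01). Qed.

Lemma Lnorm_le_powR p f (c : \bar R) : 1 <= p -> (0 <= c)%E ->
  (\int[P]_x (`|f x| `^ p)%:E <= c `^ p)%E -> ('N[P]_p%:E[EFin \o f] <= c)%E.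
Proof.
move=> p1 c0 Ic; have p0 : 0 < p by exact: lt_le_trans p1.
have <- : ((c `^ p) `^ p^-1 = c)%E by rewrite -poweRrM mulfV ?gt_eqF// poweRe1.
rewrite unlock /Lnorm; apply: gt0_ler_poweR => //.
- by rewrite invr_ge0 ltW.
- by rewrite in_itv/= leey andbT integral_ge0.
- by rewrite in_itv/= leey andbT poweR_ge0.
Qed.

(** Hölder's inequality against the constant 1; p = 1 is set apart because its conjugate exponent is
    infinite. *)
Lemma Lnorm1_le p f : measurable_fun setT f -> 1 <= p ->
  ('N[P]_1[EFin \o f] <= 'N[P]_p%:E[EFin \o f])%E.
Proof.
move=> mf; rewrite le_eqVlt => /predU1P[<-//|p1].
have p0 : 0 < p by exact: lt_trans p1.
have q0 : 0 < p / (p - 1) by rewrite divr_gt0// subr_gt0.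
have := @hoelder _ _ _ P f (cst 1) p (p / (p - 1)) mf (measurable_cst _) p0 q0.
rewrite Lnorm_cst1 [X in (_ * X `^ _)%E](_ : _ = 1%E) ?poweR1r ?mule1; last first.
  exact: probability_setT.
rewrite (_ : f \* cst 1 = f); last by apply/funext => x /=; rewrite mulr1.
apply; rewrite invf_div; field; lra.
Qed.

(** Jensen's inequality for the p-th power, obtained from the comparison of the L^1 and L^p norms;
    it is trivial when the right-hand side is infinite. *)
Lemma Rintegral_powR_le p f : measurable_fun setT f -> 1 <= p ->
  ((`|\int[P]_x f x| `^ p)%:E <= \int[P]_x (`|f x| `^ p)%:E)%E.
Proof.
move=> mf p1; have [fy|/negPf fy] := eqVneq (\int[P]_x (`|f x| `^ p)%:E)%E +oo%E.
  by rewrite fy leey.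
have N1p := Lnorm1_le mf p1.
have Npy : ('N[P]_p%:E[EFin \o f] < +oo)%E.
  rewrite ltey; apply/eqP => Ny; move: fy; rewrite -powR_LnormE// Ny.
  by rewrite poweRyr ?eqxx// gt_eqF// (lt_le_trans ltr01).
have if_ : P.-integrable setT (EFin \o f).
  apply/integrableP; split; first exact/measurable_EFinP.
  by rewrite -Lnorm1 (le_lt_trans N1p).
rewrite -powR_LnormE// -poweR_EFin; apply: gt0_ler_poweR.
- by rewrite (le_trans _ p1).
- by rewrite in_itv/= lee_fin normr_ge0 leey.
- by rewrite in_itv/= Lnorm_ge0 leey.
apply: le_trans N1p; rewrite Lnorm1 EFin_normr_Rintegral//.
apply: le_abse_integral => //; exact/measurable_EFinP.
Qed.

Lemma Lfun_prob_integrable p f : 1 <= p -> f \in Lfun P p%:E ->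
  P.-integrable setT (EFin \o f).
Proof.
move=> p1; rewrite inE => /andP[/[!inE]/= mf Nf]; apply/integrableP; split.
  exact/measurable_EFinP.
by rewrite -Lnorm1 (le_lt_trans (Lnorm1_le mf p1)).
Qed.

Lemma Lnorm_ae_eq p f g : measurable_fun setT f -> measurable_fun setT g ->
  f = g %[ae P] -> ('N[P]_p%:E[EFin \o f] = 'N[P]_p%:E[EFin \o g])%E.
Proof.
move=> mf mg fg; rewrite unlock /Lnorm; congr (_ `^ _)%E.
apply: ae_eq_integral => //.
- exact: measurable_powR_norm.
- exact: measurable_powR_norm.
by apply: filterS fg => x /= fg _; rewrite fg.
Qed.

Lemma bounded_Lfun p f : 1 <= p -> bounded_measurable f -> f \in Lfun P p%:E.
Proof.
move=> p1 [mf [M fM]]; rewrite inE; apply/andP; split; rewrite inE//=.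
rewrite /finite_norm; apply: (@le_lt_trans _ _ `|M|%:E); last exact: ltry.
apply: Lnorm_le_powR => //; rewrite -[leRHS]mule1 -(probability_setT P).
rewrite -integral_cst//; apply: ge0_le_integral => //.
- exact: measurable_powR_norm.
- move=> x _; rewrite lee_fin ge0_ler_powR ?nnegrE//; first exact: le_trans p1.
  by rewrite (le_trans (fM x))// ler_norm.
Qed.

Definition truncation f (n : nat) (x : T) : R :=
  Num.max (- n%:R) (Num.min (f x) n%:R).

Lemma truncation_bounded f n : measurable_fun setT f ->
  bounded_measurable (truncation f n).
Proof.
move=> mf; split.
  by apply: measurable_maxr => //; apply: measurable_minr.
exists n%:R => x; have n0 : 0 <= n%:R :> R by [].
rewrite ler_norml /truncation le_max lexx/= ge_max ge_min lexx orbT andbT.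
by rewrite (le_trans _ n0)// oppr_le0.
Qed.

Lemma truncation_dist f n x : `|f x - truncation f n x| <= `|f x|.
Proof.
have n0 : 0 <= n%:R :> R by [].
rewrite /truncation; case: (leP (f x) n%:R) => fn; last first.
  rewrite max_r; last by rewrite (le_trans _ n0)// oppr_le0.
  have f0 := le_lt_trans n0 fn.
  by rewrite !gtr0_norm ?subr_gt0//; lra.
case: (leP (- n%:R) (f x)) => nf; first by rewrite subrr normr0.
by rewrite !ltr0_norm; lra.
Qed.

Lemma truncation_id f n x : `|f x| <= n%:R -> truncation f n x = f x.
Proof. by rewrite ler_norml /truncation => /andP[? ?]; rewrite min_l// max_r. Qed.

Lemma truncation_Lnorm p f (eps : R) : 1 <= p -> f \in Lfun P p%:E -> 0 < eps ->
  exists n, ('N[P]_p%:E[EFin \o (f \- truncation f n)%R] <= eps%:E)%E.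
Proof.
move=> p1 Lf e0; have p0 : 0 < p by exact: lt_le_trans p1.
have mf : measurable_fun setT f by move: Lf; rewrite inE => /andP[]; rewrite inE.
have mt n := (truncation_bounded n mf).1.
have md n : measurable_fun setT (f \- truncation f n) by exact: measurable_funB.
have intf := Lfun_integrable p1 Lf.
have [|||||_ _] := @dominated_convergence _ T R P setT measurableT
  (fun n x => (`|f x - truncation f n x| `^ p)%:E) (cst 0%E)
  (fun x => (`|f x| `^ p)%:E).
- by move=> n; exact: measurable_powR_norm (md n).
- exact: measurable_cst.
- apply: aeW => x _; apply: cvg_near_cst.
  exists (Num.trunc `|f x|).+1 => // n /= fn.
  rewrite truncation_id; last by rewrite ltW// (lt_le_trans (truncnS_gt _))// ler_nat.
  by rewrite subrr normr0 powR0// gt_eqF.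
- exact: intf.
- move=> /=; apply: aeW => x n _; rewrite lee_fin ger0_norm ?powR_ge0//.
  by rewrite ge0_ler_powR ?nnegrE ?truncation_dist// ltW.
rewrite integral0 => I0.
have ep : (0 < (eps `^ p)%:E)%E by rewrite lte_fin powR_gt0.
have /fine_cvgP[fin /cvgrPdist_le/(_ _ (powR_gt0 p e0))] := I0.
move=> near_le; have := filterI fin near_le => -[k _ /(_ k (leqnn k))[/= fk]].
rewrite sub0r normrN => Ik; exists k; apply: Lnorm_le_powR => //.
  by rewrite lee_fin ltW.
rewrite poweR_EFin -[leLHS]fineK// lee_fin; exact: le_trans (ler_norm _) Ik.
Qed.

End LpFacts.

Section LpDensity.
Context (R : realType) (X : hilbertType R) (mu nu : probability (borel X) R).
Context (p : R) (p1 : (1 <= p%:E)%E).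

(** A truncation of f is bounded, and the remainder has small norm, hence small images under both
    operators. *)
Lemma Lp_operator_ext (E E' : LfunType mu p1 -> LfunType nu p1) :
  Lp_operator E -> Lp_operator E' ->
  (forall f : LfunType mu p1, bounded_measurable f -> E f = E' f %[ae nu]) ->
  forall f, E f = E' f %[ae nu].
Proof.
move=> [_ linE [C C0 EC]] [_ linE' [C' C'0 E'C]] EE' f.
have p1' : 1 <= p by rewrite -lee_fin.
have mf : measurable_fun setT f by exact: measurable_funP.
have mE (g : LfunType nu p1) : measurable_fun setT g by exact: measurable_funP.
suff N0 : ('N[nu]_p%:E[EFin \o (E f \- E' f)%R] = 0)%E.
  have := Lnorm_eq0_eq0 _ _ N0; rewrite lte_fin (lt_le_trans ltr01 p1').
  move=> /(_ _ isT) H; have {H} : (EFin \o (E f \- E' f)%R) = \0%E %[ae nu].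
    by apply: H; apply/measurable_EFinP; exact: measurable_funB.
  by apply: filterS => x /= /(_ I)[/eqP]; rewrite subr_eq0 => /eqP.
apply/eqP; rewrite eq_le Lnorm_ge0 andbT; apply/lee_addgt0Pr => eps e0; rewrite add0e.
(* The images of the remainder add up to at most (C + C') del <= eps; the added 1 keeps the
   denominator positive. *)
pose del := eps / (C + C' + 1).
have CC0 : 0 < C + C' + 1 by rewrite ltr_wpDl// addr_ge0.
have [n fn] := truncation_Lnorm p1' (LfunP f) (divr_gt0 e0 CC0).
have bt := truncation_bounded n mf.
pose g : LfunType mu p1 := Lfun_Sub p1 (bounded_Lfun mu p1' bt).
(* The remainder f - g, in the form a g + f of the linearity clause of [Lp_operator]. *)
pose h : LfunType mu p1 := (-1) *: g + f.
have Nh : ('N[mu]_p%:E[EFin \o h] <= del%:E)%E.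
  apply: le_trans fn; rewrite le_eqVlt; apply/orP; left; apply/eqP.
  by apply: eq_Lnorm => x /=; rewrite addrC scaleN1r.
have -> : ('N[nu]_p%:E[EFin \o (E f \- E' f)%R] =
           'N[nu]_p%:E[EFin \o (E h \- E' h)%R])%E.
  apply: Lnorm_ae_eq; [exact: measurable_funB|exact: measurable_funB|].
  apply: filterS3 (linE (-1) g f) (linE' (-1) g f) (EE' g bt) => x E1 E2 E3 _ /=.
  by rewrite E1// E2// E3//; ring.
have -> : (E h \- E' h)%R = (E h \+ (\- E' h))%R by [].
apply: (le_trans (eminkowski _ _ _ _)) => //.
have -> : ('N[nu]_p%:E[EFin \o (\- E' h)%R] = 'N[nu]_p%:E[EFin \o E' h])%E.
  rewrite -[RHS]oppe_Lnorm; exact: eq_Lnorm.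
apply: le_trans (leeD (EC h) (E'C h)) _.
rewrite -muleDl ?ge0_adde_def ?inE ?lee_fin//; last first.
  by rewrite ge0_fin_numE ?Lnorm_ge0// (le_lt_trans Nh)// ltry.
apply: (@le_trans _ _ ((C + C')%:E * del%:E)%E).
  by rewrite EFinD lee_wpmul2l// -EFinD lee_fin addr_ge0.
rewrite -EFinM lee_fin /del mulrA ler_pdivrMr// mulrC ler_pM2l//; lra.
Qed.

End LpDensity.

Section Averaging.
Context d1 d2 d3 (T1 : measurableType d1) (T2 : measurableType d2)
  (T3 : measurableType d3) (R : realType).
Context (P1 : probability T1 R) (P2 : probability T2 R) (P3 : probability T3 R).
Context (phi : T1 * T2 -> T3) (mphi : measurable_fun setT phi).
Hypothesis law : forall A, measurable A -> P3 A = (P1 \x P2)%E (phi @^-1` A).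
Implicit Types (f g : T3 -> R) (p : R).

Definition average f x : R := \int[P2]_y f (phi (x, y)).

Let msec x : measurable_fun setT (fun y => phi (x, y)).
Proof. exact: measurable_fun_pair2. Qed.

Lemma average_ge0 (f : T3 -> \bar R) :
  measurable_fun setT f -> (forall z, (0 <= f z)%E) ->
  (\int[P1]_x \int[P2]_y f (phi (x, y)) = \int[P3]_z f z)%E.
Proof.
move=> mf f0; rewrite (integral_law (P := (P1 \x P2)%E) mphi law mf).
rewrite fubini_tonelli1//; exact: measurableT_comp.
Qed.

(** The preimage of N is null for the product, so almost all its sections are null; this makes
    [average] well defined on classes of functions. *)
Lemma average_null (N : set T3) : measurable N -> P3 N = 0%E ->
  {ae P1, forall x, P2 ((fun y => phi (x, y)) @^-1` N) = 0%E}.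
Proof.
move=> mN N0.
have mI : measurable_fun setT (EFin \o \1_N : T3 -> \bar R).
  by apply/measurable_EFinP; exact: measurable_indic.
have I0 z : (0 <= (EFin \o \1_N : T3 -> \bar R) z)%E by rewrite lee_fin.
have secE x : P2 ((fun y => phi (x, y)) @^-1` N) = (\int[P2]_y (EFin \o \1_N) (phi (x, y)))%E.
  rewrite (_ : (fun y => _) = EFin \o \1_((fun y => phi (x, y)) @^-1` N)).
    by rewrite integral_indic ?setIT// -[X in measurable X]setTI; exact: msec.
  by apply/funext => y /=; congr EFin; rewrite !indicE; congr (_ %:R); apply/idP/idP; rewrite !inE.
have E0 : (\int[P1]_x \int[P2]_y (EFin \o \1_N) (phi (x, y)) = 0)%E.
  by rewrite (average_ge0 mI I0) -[RHS]N0 integral_indic// setIT.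
have mF : measurable_fun setT (fun x => \int[P2]_y (EFin \o \1_N) (phi (x, y)))%E.
  apply: (@measurable_fun_fubini_tonelli_F _ _ _ _ _ P2
    (fun z => (EFin \o \1_N) (phi z))) => [|z]; last exact: I0.
  exact: measurableT_comp mI mphi.
have : (\int[P1]_x `|\int[P2]_y (EFin \o \1_N) (phi (x, y))| = 0)%E.
  rewrite -E0; apply: eq_integral => x _; rewrite gee0_abs//.
  by apply: integral_ge0 => y _; exact: I0.
move=> /(ae_eq_integral_abs P1 measurableT mF).
by apply: filterS => x /(_ I) /= E; rewrite secE.
Qed.

Lemma average_ae_eq f g : f = g %[ae P3] -> average f = average g %[ae P1].
Proof.
move=> [N [mN N0 fgN]]; have := average_null mN N0.
apply: filterS => x Nx _; congr fine.
apply: (integral_eq_off_null _ Nx) => [|y /= Ny].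
  by rewrite -[X in measurable X]setTI; exact: msec.
congr EFin; have := contra_notP (fgN (phi (x, y))) Ny.
by move=> H; apply: H.
Qed.

Lemma average_integrable f : P3.-integrable setT (EFin \o f) ->
  (P1 \x P2)%E.-integrable setT (fun z => (f (phi z))%:E).
Proof.
move=> /integrableP[mf fi]; apply/integrableP; split.
  exact: measurableT_comp mf mphi.
rewrite -(integral_law (P := (P1 \x P2)%E) (f := fun z => `|(f z)%:E|%E) mphi law)//.
exact: measurableT_comp.
Qed.

Lemma average_measurable f : P3.-integrable setT (EFin \o f) ->
  measurable_fun setT (average f).
Proof.
move=> /average_integrable/measurable_fubini_F mF.
by apply: measurableT_comp mF.
Qed.

Lemma average_linear f g (a : R) :
  P3.-integrable setT (EFin \o f) -> P3.-integrable setT (EFin \o g) ->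
  average (fun z => a * f z + g z) = (fun x => a * average f x + average g x) %[ae P1].
Proof.
move=> /average_integrable/ae_integrable1 fi /average_integrable/ae_integrable1 gi.
apply: filterS2 fi gi => x fi gi _; rewrite /average RintegralD//; last first.
  exact: integrableZl fi.
by rewrite RintegralZl.
Qed.

(** Jensen's inequality in y for each x, then integration in x, where [law] identifies the double
    integral. *)
Lemma average_powR p f : 1 <= p -> f \in Lfun P3 p%:E ->
  (\int[P1]_x (`|average f x| `^ p)%:E <= \int[P3]_z (`|f z| `^ p)%:E)%E.
Proof.
move=> p1 Lf.
have mf : measurable_fun setT f by move: Lf; rewrite inE => /andP[]; rewrite inE.
have mavg := average_measurable (Lfun_prob_integrable p1 Lf).
rewrite -average_ge0; first last.
- by move=> z; rewrite lee_fin powR_ge0.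
- exact: measurable_powR_norm.
apply: ge0_le_integral => //.
- exact: measurable_powR_norm.
- apply: (@measurable_fun_fubini_tonelli_F _ _ _ _ _ P2
    (fun z => (`|f (phi z)| `^ p)%:E)) => [|z]; last by rewrite lee_fin powR_ge0.
  exact: measurable_powR_norm (measurableT_comp mf mphi).
- by move=> x _; apply: Rintegral_powR_le => //; exact: measurableT_comp mf (msec x).
Qed.

Lemma average_Lnorm p f : 1 <= p -> f \in Lfun P3 p%:E ->
  ('N[P1]_p%:E[EFin \o average f] <= 'N[P3]_p%:E[EFin \o f])%E.
Proof.
move=> p1 Lf; apply: (Lnorm_le_powR p1 (Lnorm_ge0 _ _ _)).
by rewrite (powR_LnormE P3 f p1); exact: average_powR.
Qed.

Lemma average_Lfun p f : 1 <= p -> f \in Lfun P3 p%:E -> average f \in Lfun P1 p%:E.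
Proof.
move=> p1 Lf; rewrite inE; apply/andP; split; rewrite inE.
  exact: average_measurable (Lfun_prob_integrable p1 Lf).
rewrite /= /finite_norm (le_lt_trans (average_Lnorm p1 Lf))//.
by move: Lf; rewrite inE => /andP[_]; rewrite inE.
Qed.

End Averaging.

Lemma average_Lp_operator (R : realType) (X : hilbertType R)
    (m1 m2 : probability (borel X) R) (phi : borel X * borel X -> borel X)
    (p : R) (p1 : (1 <= p%:E)%E) :
  measurable_fun setT phi ->
  (forall A, measurable A -> m2 A = (m1 \x m2)%E (phi @^-1` A)) ->
  exists2 E : LfunType m2 p1 -> LfunType m1 p1,
    Lp_operator E & forall f, E f = average m2 phi f :> (borel X -> R).
Proof.
move=> mphi law; have p1' : 1 <= p by rewrite -lee_fin.
exists (fun f => Lfun_Sub p1 (average_Lfun mphi law p1' (LfunP f))) => //.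
split.
- by move=> f g fg; exact: (average_ae_eq mphi law fg).
- move=> a f g.
  by apply: (average_linear mphi law); apply: (Lfun_prob_integrable p1'); exact: LfunP.
- by exists 1 => // f; rewrite mul1e; apply: (average_Lnorm mphi law p1'); exact: LfunP.
Qed.

(** * The Mehler representation of the transition operators and its extension to L^p *)

Theorem proposition5p5 (R : realType) (X : hilbertType R)
  (sepX : separable X)
  (U : R -> R -> X -> X) (B : R -> X -> X)
  (hU : evolution_operator U)
  (hB : bounded_measurable_family B)
  (htr : finite_trace U B)
  (hst : stable U B)
  (N : X -> (X -> X) -> probability (borel X) R)
  (hN : gaussian_family N)
  (s t : R) (st : s <= t)
  (es et : nat -> X)
  (hes : eigenbasis (Qinf U B s) es)
  (het : eigenbasis (Qinf U B t) et) :
  let gs := N 0 (Qinf U B s) in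
  let gt := N 0 (Qinf U B t) in
  let Hs := cameron_martin (Qinf U B s) in
  let Ht := cameron_martin (Qinf U B t) in
  let L := adjoint Hs Ht (U t s) in
  let P := transition N U B s t in
  let versions := Gamma_versions gt gs Ht Hs et es L in
  [/\ (* L is the adjoint of U(t,s) : H_s -> H_t; both are contractions *)
      [/\ operator_le 1 Hs Ht (U t s), operator_le 1 Ht Hs L
        & is_adjoint Hs Ht (U t s) L],
      (* U(t,s) is a version of (L^\star)_oo, and with this version P f and
         Gamma(L) f agree at every point *)
      linear_version gs es (adjoint Ht Hs L) (U t s) /\
      (forall W, versions (U t s) W ->
       forall f, bounded_borel f -> forall x, P f x = Gamma gt (U t s) W f x),
      (* any other bounded version of (L^\star)_oo, such as the one vanishing on
         the orthogonal of H_s, gives the same values on the closure of H_s *)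
      (forall V W, versions V W -> bounded_operator V ->
       forall f, bounded_borel f ->
       forall x, closure (carrier Hs) x -> P f x = Gamma gt V W f x),
      (* any version gives the same values almost everywhere *)
      (forall V W, versions V W ->
       forall f, bounded_borel f -> P f = Gamma gt V W f %[ae gs])
    & (* P and Gamma(L) have one and the same extension to L^p *)
      s < t -> forall (p : R) (p1 : (1 <= p%:E)%E) V W, versions V W ->
      exists E : LfunType gt p1 -> LfunType gs p1,
        [/\ Lp_extension gt gs bounded_borel P E,
            Lp_extension gt gs exp_growth (Gamma gt V W) E
          & forall E', Lp_extension gt gs bounded_borel P E' \/
                       Lp_extension gt gs exp_growth (Gamma gt V W) E' ->
            forall f, E' f = E f %[ae gs]]].

Proof.
move=> gs gt Hs Ht L P versions.
have cs := Qinf_covariance sepX hU hB hst s.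
have ct := Qinf_covariance sepX hU hB hst t.
have Gs : is_gaussian gs 0 (Qinf U B s) by exact: (hN _ _ cs).
have Gt : is_gaussian gt 0 (Qinf U B t) by exact: (hN _ _ ct).
have bU := evolution_bounded hU st.
have QE := Qinf_decomposition sepX hU hB hst _ st.
have dom x : inner (Qinf U B s (adjoint whole whole (U t s) x))
    (adjoint whole whole (U t s) x) <= inner (Qinf U B t x) x.
  rewrite QE lerDl.
  by have [_ _ _] := (nonneg_whole _).1 (segmentP sepX hU hB s t).1; exact.
have W_borel W : linear_version gt et (defect Ht Hs L) W ->
  exists W' : borel X -> borel X, [/\ measurable_fun setT W',
    exists M : set (borel X), [/\ measurable M, gt M = 0%E & forall y, ~ M y -> W' y = W y]
    & mean_square_cvg gt (fun n x => defect Ht Hs L (proj et n x)) W'].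
  exact: linear_version_borel.
have mehler (W' : borel X -> borel X) : measurable_fun setT W' ->
    mean_square_cvg gt (fun n x => defect Ht Hs L (proj et n x)) W' ->
    forall f, bounded_borel f -> forall x, P f x = Gamma gt (U t s) W' f x.
  move=> mW' cW' f [mf _] x.
  have shift := shifted_law sepX cs hes ct het Gt bU dom QE hN mW' cW' _ mf.
  rewrite /P /transition; case: ifPn => [slt|].
    apply: shift => h theta.
    exact: (gaussian_wave (hN _ _ (Qcov_covariance sepX hU hB htr slt))).
  rewrite -leNgt => ts; have {ts}ets : t = s by apply/le_anti; rewrite ts st.
  (* For s = t the family N has no member to compare with, as P_{t,t} is the
     identity: the law of U x + W' y is the Dirac mass at x. *)
  transitivity (\int[\d_(x : borel X)]_y f y).
    by rewrite /Rintegral integral_dirac ?diracT ?mul1e//; exact/measurable_EFinP.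
  have [_ _ idU _] := hU.
  have Uid y : U t s y = y by rewrite {1}ets.
  apply: shift => h theta.
  have U'h : adjoint whole whole (U t s) h = h.
    apply: inner_ext => z.
    by rewrite innerC -(inner_adjoint sepX _ _ bU) Uid innerC.
  (* For s = t the decomposition of Q(t,-oo), with U(t,s) the identity, leaves 0 for the quadratic
     form of Q(t,t). *)
  have -> : inner (Qcov U B t s h) h = 0.
    by have := QE h; rewrite U'h ets; lra.
  rewrite mul0r oppr0 expR0 mulr1 Uid /Rintegral integral_dirac//.
    by rewrite diracT mul1e.
  apply/measurable_EFinP.
  exact: (bounded_measurable_cos
    (measurable_funD (measurable_inner h) (measurable_cst theta))).1.
(* Passage from W to its Borel version under the integral in y, legitimate at any x where V agrees
   with U(t,s). *)
have Gamma_version (V W W' : X -> X) (M : set (borel X)) f x : V x = U t s x ->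
    measurable M -> gt M = 0%E -> (forall y, ~ M y -> W' y = W y) ->
    Gamma gt V W f x = Gamma gt (U t s) W' f x.
  move=> Vx mM M0 WW'; congr fine; apply: (integral_eq_off_null mM M0) => y My.
  by rewrite Vx WW'.
have pointwise V W f x : versions V W -> bounded_borel f -> V x = U t s x ->
    P f x = Gamma gt V W f x.
  move=> [_ /W_borel[W' [mW' [M [mM M0 WW']] cW']]] bf Vx.
  by rewrite (mehler W')//; apply/esym/(Gamma_version V W W' M).
have ae_version V W : versions V W -> {ae gs, forall x : borel X, V x = U t s x}.
  move=> [+ _] => /(linear_version_ae sepX cs hes ct het Gs bU dom)[M [mM M0 VM]].
  by exists M; split=> // x /= Vx; apply: contrapT => /VM.
have ae_pointwise V W : versions V W -> forall f, bounded_borel f ->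
    P f = Gamma gt V W f %[ae gs].
  move=> vVW f bf; apply: filterS (ae_version V W vVW) => x Vx _.
  exact: pointwise.
split.
- split.
  + exact: (dominated_operator_le sepX cs.1 hes ct.1 het bU dom).
  + exact: (dominated_adjoint_le sepX cs.1 hes ct.1 het bU dom).
  + exact: (dominated_is_adjoint sepX cs.1 hes ct.1 het bU dom).
- split; first exact: (dominated_linear_version sepX cs hes ct het Gs bU dom).
  by move=> W vW f bf x; exact: pointwise.
- move=> V W vVW bV f bf x Hx; apply: pointwise => //.
  exact: (linear_version_bounded sepX cs hes ct het Gs bU dom vVW.1 bV Hx).
- exact: ae_pointwise.
move=> slt p p1 V W vVW.
have [_ /W_borel[W' [mW' [M [mM M0 WW']] cW']]] := vVW.
pose phi (z : borel X * borel X) : borel X := U t s z.1 + W' z.2.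
have mphi : measurable_fun setT phi.
  apply: (measurable_borelD sepX).
    exact: measurableT_comp (continuous_borel_borel bU.2) (@measurable_fst _ _ _ _).
  exact: measurableT_comp mW' (@measurable_snd _ _ _ _).
have law S : measurable S -> gt S = (gs \x gt)%E (phi @^-1` S).
  exact: (convolved_law sepX cs hes ct het Gs Gt bU dom QE hN mW' cW').
have [E opE EE] := average_Lp_operator p1 mphi law.
have EGamma f x : E f x = Gamma gt (U t s) W' f x by rewrite EE.
have EP (f : LfunType gt p1) : bounded_borel f -> E f = P f %[ae gs].
  by move=> bf; apply: aeW => x _; rewrite EGamma (mehler W').
have bounded_exp (f : borel X -> R) : bounded_borel f -> exp_growth f.
  move=> [mf [K fK]]; split=> //; exists (`|K| + 1), 1; split=> // x.
  rewrite mul1r (le_trans (fK x))//.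
  have e1 : 1 <= expR `|x : X| by rewrite -expR0 ler_expR.
  have := ler_norm K; have := normr_ge0 K; nra.
exists E; split.
- by split=> // f; exact: EP.
- split=> // f _; apply: filterS (ae_version V W vVW) => x Vx _.
  by rewrite EGamma; apply/esym/(Gamma_version V W W' M).
(* Bounded functions lie in both domains, and there the two formulas agree almost everywhere, so
   both kinds of extension coincide with E on them; density gives the rest. *)
move=> E' ext f; apply/ae_eq_sym; apply: Lp_operator_ext => //.
  by case: ext => -[].
move=> g bg; case: ext => -[_ E'P].
  by apply: ae_eq_trans (EP g bg) _; apply: ae_eq_sym; exact: E'P.
apply: ae_eq_trans (EP g bg) _; apply: ae_eq_trans (ae_pointwise V W vVW g bg) _.
by apply: ae_eq_sym; apply: E'P; exact: bounded_exp.
Qed.
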